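(* Let $\alpha\in\,]0,1[$ be irrational, let $T$ be the translation by $\alpha$ on $\mathbb T$, let $s$ be a non-integer real number, and let $\beta,t\in\mathbb T$. There exists a measurable function $f$ of modulus $1$ on $\mathbb T$ satisfying, $\lambda$-almost everywhere, $$\exp(2i\pi s\,\phi_\beta)=e^{2i\pi t}\,\frac{f}{f\circ T}$$ if and only if there exist a sequence of integers $(b_n)_{n\ge 0}$ and an integer $k'$ such that $$\beta=\sum_{n\ge 0}b_nq_n\alpha \mod 1\quad\text{and}\quad t=k'\alpha-\sum_{n\ge 0}[b_ns]\,q_n\alpha\mod 1,$$ with $$\sum_{n\ge 0}\frac{|b_n|}{a_{n+1}}<\infty\quad\text{and}\quad \sum_{n\ge 0}\|b_ns\|^2<\infty .$$
   Context: $\mathbb T=\mathbb R/\mathbb Z$ with Lebesgue measure $\lambda$. $(a_n)_{n\ge1}$ are the partial quotients and $(p_n/q_n)_{n\ge0}$ the convergents of the continued fraction of $\alpha$ ($p_0=0$, $q_0=1$). For real $x$, $\|x\|$ is the distance from $x$ to the nearest integer, denoted $[x]$, and $\{x\}$ is the usual fractional part. For $\beta\in\mathbb T$, $\phi_\beta:\mathbb T\to\mathbb R$ is $\phi_\beta=\mathbf 1_{[0,\{\beta\}[}-\{\beta\}$, where $\{\beta\}\in[0,1[$ is the representative of $\beta$. Infinite sums ''mod 1'' are convergent series in $\mathbb T$. *)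

(* Defs.v *)
From HB Require Import structures.
From mathcomp Require Import all_boot all_order all_algebra generic_quotient.
From mathcomp Require Import ring_quotient complex.
From mathcomp Require Import all_classical all_reals all_analysis.

Set Implicit Arguments.
Unset Strict Implicit.
Unset Printing Implicit Defensive.

Import Order.TTheory GRing.Theory Num.Theory.
Import numFieldNormedType.Exports.

Local Open Scope classical_set_scope.
Local Open Scope ring_scope.
Local Open Scope quotient_scope.

Definition integers (R : realType) : zmodClosed R :=
  GRing.ZmodClosed.clone R (@Num.int_num_subdef R) _.

Definition torus (R : realType) : Type :=
  quotient_topology (Quotient.quot (integers R)).

Section torus_structure.
Variable R : realType.

HB.instance Definition _ := Topological.on (torus R).
HB.instance Definition _ := Pointed.on (torus R).
HB.instance Definition _ := Quotient.on (torus R).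
(* Copying the structure from the quotient would not register the alias. *)
HB.instance Definition _ := GRing.isZmodule.Build (torus R)
  (@Quotient.addqA R (integers R)) (@Quotient.addqC R (integers R))
  (@Quotient.add0q R (integers R)) (@Quotient.addNq R (integers R)).

Definition mod1 (x : R) : torus R := \pi_(torus R) x.

(* The Borel sets of the circle: those whose 1-periodic lift is Borel. *)
Definition torus_measurable : set (set (torus R)) :=
  image_set_system [set: R] mod1 measurable.

Let torus_sigma_algebra : sigma_algebra setT torus_measurable.
Proof. exact/sigma_algebra_image/sigma_algebra_measurable. Qed.

Let torus_measurable0 : torus_measurable set0.
Proof. by case: torus_sigma_algebra. Qed.

Let torus_measurableC A : torus_measurable A -> torus_measurable (~` A).
Proof. by rewrite -setTD; case: torus_sigma_algebra => _ + _; exact. Qed.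

Let torus_measurable_bigcup (F : (set (torus R))^nat) :
  (forall i, torus_measurable (F i)) -> torus_measurable (\bigcup_i F i).
Proof. by case: torus_sigma_algebra => _ _; exact. Qed.

HB.instance Definition _ := isMeasurable.Build default_measure_display
  (torus R) torus_measurable0 torus_measurableC torus_measurable_bigcup.

Lemma measurable_mod1 : measurable_fun [set: R] mod1.
Proof. by move=> _ A. Qed.

Definition unit_interval_measurable : measurable (`[0, 1[ : set R) :=
  measurable_itv `[0, 1[.

(* A |-> lebesgue_measure {x in [0, 1[ | x mod 1 in A} *)
Definition torus_lebesgue : set (torus R) -> \bar R :=
  pushforward (mrestr (@lebesgue_measure R) unit_interval_measurable) mod1.

Let torus_lebesgue0 : torus_lebesgue set0 = 0%E.
Proof. by apply: measure0; exact: measurable_mod1. Qed.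

Let torus_lebesgue_ge0 A : (0 <= torus_lebesgue A)%E.
Proof. by apply: measure_ge0; exact: measurable_mod1. Qed.

Let torus_lebesgue_sigma_additive : semi_sigma_additive torus_lebesgue.
Proof.
by apply: measure_semi_sigma_additive; exact: measurable_mod1.
Qed.

HB.instance Definition _ := isMeasure.Build _ (torus R) R torus_lebesgue
  torus_lebesgue0 torus_lebesgue_ge0 torus_lebesgue_sigma_additive.

End torus_structure.

Section definitions.
Variable R : realType.
Implicit Types (x alpha : R) (beta : torus R).

(* The representative of a class in [0, 1[. *)
Definition frac_part beta : R := repr beta - (Num.floor (repr beta))%:~R.

Definition phi beta (y : torus R) : R :=
  \1_(`[0, frac_part beta[ : set R) (frac_part y) - frac_part beta.

(* Ties are rounded upwards. *)
Definition nearest x : int := Num.floor (x + 2^-1).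

Definition dist_int x : R := `|x - (nearest x)%:~R|.

(* Iterates of the Gauss map: cf_rem alpha n is the n-th remainder in the
   continued fraction expansion of alpha. *)
Fixpoint cf_rem alpha (n : nat) : R :=
  if n is m.+1
  then (cf_rem alpha m)^-1 - (Num.floor (cf_rem alpha m)^-1)%:~R
  else alpha - (Num.floor alpha)%:~R.

(* alpha = [a_0; a_1, a_2, ...] with a_n = partial_quotient alpha n *)
Definition partial_quotient alpha (n : nat) : int :=
  if n is m.+1 then Num.floor (cf_rem alpha m)^-1 else Num.floor alpha.

(* q_0 = 1, q_1 = a_1 and q_(n+2) = a_(n+2) q_(n+1) + q_n *)
Fixpoint cf_den alpha (n : nat) : int :=
  match n with
  | 0 => 1
  | m.+1 => match m with
            | 0 => partial_quotient alpha n
            | k.+1 => partial_quotient alpha n * cf_den alpha m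
                      + cf_den alpha k
            end
  end.

(* exp(i x) *)
Definition expi x : R[i] := (cos x +i* sin x)%C.

Definition cmeasurable (f : torus R -> R[i]) : Prop :=
  measurable_fun [set: torus R] (fun y => complex.Re (f y)) /\
  measurable_fun [set: torus R] (fun y => complex.Im (f y)).

End definitions.

(* Main.v *)
Require Import Defs.
From HB Require Import structures.
From mathcomp Require Import all_boot all_order all_algebra generic_quotient.
From mathcomp Require Import ring_quotient complex.
From mathcomp Require Import all_classical all_reals all_analysis.
From mathcomp Require Import measurable_realfun.
From mathcomp Require Import zify ring lra.

Set Implicit Arguments.
Unset Strict Implicit.
Unset Printing Implicit Defensive.

Import Order.TTheory GRing.Theory Num.Theory.
Import numFieldNormedType.Exports.

Local Open Scope classical_set_scope.
Local Open Scope ring_scope.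

(** Write e(x) for exp(2 i pi x), q_n and p_n for the convergents of [alpha],
    D_n = q_n alpha - p_n, d_n = |D_n| and a_n for the partial quotients. Lifted to
    the line, with ccount beta x = floor x - floor (x - beta), the equation reads
    f(x + alpha) = e(t + s beta) e(-s)^(ccount beta x) f(x).

    Necessity. Let A_l(x) be the integral of f over [x, x + l]. Since |f| = 1,
    the windows A_l(x) have modulus close to l for most x when l is small
    ([deficit_small]). Iterate the equation m times: the jumps of the Birkhoff sum
    coming from the orbit of 0 spoil windows of length comparable to d_n unless
    each of them is cancelled by a nearby jump coming from the orbit of [beta].
    As bad windows are rare ([few_bad]), [beta] is within c d_n of some j alpha
    modulo 1 with |j| <= c q_(n+1) ([approx_shift]). Consecutive values of j differ
    by a multiple b_n q_n ([digit]), which gives the expansion of [beta].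

    The cost of a digit is measured by an energy. Cauchy-Schwarz makes
    q_n |A_(d_(n-1))|^2 / d_(n-1) + q_(n-1) |A_(d_n)|^2 / d_n, averaged over x,
    nondecreasing in n, and its increments dominate the mean square variations of
    A_(d_n) under shifts by multiples of d_n ([energy_sum]); the total is bounded.
    On the other hand the equation iterated q_n times expresses, near a point
    M alpha, the window at y + d_n as the window at y times a constant, except on a
    stretch of length about |b_n| d_n where the factor e(s) or e(-s) enters. This
    bounds |b_n| / a_(n+1) by a constant times the energy at scale n, and
    ||b_n s||^2 by the same plus the square of the relative error of the next
    approximation of [beta] ([digit_cost]); both are summable ([expansion]).

    Sufficiency. The coboundary of one digit is explicit: a sum of b_n q_n fractional
    parts ([transfer_shift]). Outside a set of measure at most 4 |b_n| / a_(n+1) its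
    phase is, modulo 1, (b_n s - [b_n s]) times a sawtooth of period 1 / q_n
    ([digit_phase]). Sawtooth functions of different scales are nearly orthogonal
    ([sawtooth_corr]), so the sum of the phases converges in mean as soon as
    ||b_n s|| is square summable, and a subsequence converges almost everywhere
    ([coboundary_exists]).

    The value of t. Dividing a solution by the one just constructed for the same
    digits leaves h(x + alpha) = e(tau) h(x), where tau is the difference of the two
    values of t. Then ||q_n tau|| is O(d_n), so the nearest integers to q_n tau
    eventually satisfy the recursion of the q_n, and tau is an integer combination of
    1 and [alpha] ([eigenvalue]). *)

(** * Continued fractions *)

Section continued_fraction.
Variables (R : realType) (alpha : R).

Definition irrational01 : Prop := [/\ 0 < alpha, alpha < 1 & irrational alpha].

Hypothesis Ha : irrational01.

Definition pq n : int := partial_quotient alpha n.+1.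

(** Continuants shifted by one, so that the recurrences start from the formal
    convergents 1/0 and 0/1. *)
Fixpoint cfQ n : int :=
  match n with
  | 0 => 0
  | m.+1 => match m with 0 => 1 | k.+1 => pq k * cfQ m + cfQ k end
  end.

Fixpoint cfP n : int :=
  match n with
  | 0 => 1
  | m.+1 => match m with 0 => 0 | k.+1 => pq k * cfP m + cfP k end
  end.

(** The product of the first [n] iterates of the Gauss map; with the shifted
    indices it is |Q_n alpha - P_n|. *)
Fixpoint cfd n : R := if n is m.+1 then cfd m * cf_rem alpha m else 1.

Lemma cfQSS n : cfQ n.+2 = pq n * cfQ n.+1 + cfQ n. Proof. by []. Qed.
Lemma cfPSS n : cfP n.+2 = pq n * cfP n.+1 + cfP n. Proof. by []. Qed.

Lemma cf_den_cfQ n : cf_den alpha n = cfQ n.+1.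
Proof.
suff: cf_den alpha n = cfQ n.+1 /\ cf_den alpha n.+1 = cfQ n.+2 by case.
elim: n => [|n [IH1 IH2]]; first by split=> //=; rewrite mulr1 addr0.
by split=> //; rewrite [RHS]cfQSS -IH1 -IH2.
Qed.

Lemma cf_rem_irr n : [/\ 0 < cf_rem alpha n, cf_rem alpha n < 1 &
  irrational (cf_rem alpha n)].
Proof.
have fl (x : R) : irrational x -> 0 < x - (Num.floor x)%:~R < 1 /\
    irrational (x - (Num.floor x)%:~R).
  move=> irrx.
  have irr : irrational (x - (Num.floor x)%:~R).
    move=> [r _ er]; apply: irrx; exists (r + (Num.floor x)%:~R) => //.
    rewrite rmorphD /= -[RHS](subrK (Num.floor x)%:~R).
    by congr (_ + _); [exact: er|exact: ratr_int].
  split=> //; have /andP[h1 h2] := floor_itv x.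
  rewrite intrD in h2.
  apply/andP; split; last by lra.
  rewrite lt_neqAle subr_ge0 h1 andbT; apply/eqP => e.
  by apply: irr; exists 0 => //; rewrite rmorph0.
case: Ha => a0 a1 ai.
elim: n => [|n [h0 h1 hi]] /=.
  by have [/andP[]] := fl _ ai.
have irv : irrational (cf_rem alpha n)^-1.
  move=> [r _ er]; apply: hi; exists r^-1 => //.
  rewrite fmorphV -[RHS]invrK; congr (_^-1); exact: er.
by have [/andP[]] := fl _ irv.
Qed.

Lemma pq_ge1 n : 1 <= pq n.
Proof.
have [h0 h1 _] := cf_rem_irr n.
by rewrite /pq /= -gtz0_ge1 floor_gt0 invf_ge1 // ltW.
Qed.

Lemma pqr_ge1 n : 1 <= (pq n)%:~R :> R.
Proof. by rewrite ler1z pq_ge1. Qed.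

Lemma cfd_gt0 n : 0 < cfd n.
Proof.
elim: n => [|n IH] //=; apply: mulr_gt0 => //.
by have [] := cf_rem_irr n.
Qed.

Lemma cfd_rec n : cfd n = (pq n)%:~R * cfd n.+1 + cfd n.+2.
Proof.
have [h0 h1 _] := cf_rem_irr n.
rewrite /pq /=; set x := cf_rem alpha n; set f := (Num.floor _)%:~R.
have nx : x != 0 by rewrite gt_eqF.
by rewrite mulrBr -[cfd n * x / x]mulrA divff // mulr1; ring.
Qed.

Lemma cfdS_lt n : cfd n.+1 < cfd n.
Proof.
have [h0 h1 _] := cf_rem_irr n.
by rewrite /= gtr_pMr // cfd_gt0.
Qed.

Lemma cfdSS_le n : 2 * cfd n.+2 <= cfd n.
Proof.
have := cfd_rec n; have := cfdS_lt n.+1; have := cfd_gt0 n.+1.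
have := pqr_ge1 n; nra.
Qed.

Lemma cfd_le m n : (m <= n)%N -> cfd n <= cfd m.
Proof.
elim: n => [|n IH]; first by rewrite leqn0 => /eqP ->.
rewrite leq_eqVlt => /predU1P[-> //|]; rewrite ltnS => /IH.
by apply: le_trans; exact/ltW/cfdS_lt.
Qed.

Lemma cfQ_ge0 n : 0 <= cfQ n.
Proof.
suff: 0 <= cfQ n /\ 0 <= cfQ n.+1 by case.
elim: n => [|n [h1 h2]] //; split=> //; rewrite cfQSS.
have := pq_ge1 n; nia.
Qed.

Lemma cfQS_ge1 n : 1 <= cfQ n.+1.
Proof.
elim: n => [|n h2] //; rewrite cfQSS.
have := pq_ge1 n; have := cfQ_ge0 n; nia.
Qed.

Lemma cfQ_leS n : (0 < n)%N -> cfQ n <= cfQ n.+1.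
Proof.
case: n => // n _; rewrite cfQSS.
have := pq_ge1 n; have := cfQ_ge0 n; have := cfQ_ge0 n.+1; nia.
Qed.

Lemma cfQS_leSS n : cfQ n.+1 + cfQ n <= cfQ n.+2.
Proof.
rewrite cfQSS.
have := pq_ge1 n; have := cfQ_ge0 n; have := cfQ_ge0 n.+1; nia.
Qed.

Lemma cfQ_leSS n : 2 * cfQ n.+1 <= cfQ n.+3.
Proof.
have := cfQS_leSS n.+1; have := cfQ_leS (isT : (0 < n.+1)%N); lia.
Qed.

Lemma cfD n : (cfQ n)%:~R * alpha - (cfP n)%:~R = (-1) ^+ n.+1 * cfd n.
Proof.
suff: (cfQ n)%:~R * alpha - (cfP n)%:~R = (-1) ^+ n.+1 * cfd n /\
  (cfQ n.+1)%:~R * alpha - (cfP n.+1)%:~R = (-1) ^+ n.+2 * cfd n.+1 by case.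
elim: n => [|n [h1 h2]].
  case: Ha => a0 a1 _; split; first by rewrite /=; ring.
  have -> : cfd 1 = alpha.
    rewrite /= mul1r; have -> : Num.floor alpha = 0.
      by apply: floor_def; rewrite add0r ltW.
    by rewrite subr0.
  by rewrite /=; ring.
split=> //; rewrite cfQSS cfPSS !intrD !intrM.
have -> : cfd n.+2 = cfd n - (pq n)%:~R * cfd n.+1.
  by rewrite {1}(cfd_rec n); ring.
have -> : (-1) ^+ n.+3 * (cfd n - (pq n)%:~R * cfd n.+1) =
  (pq n)%:~R * ((-1) ^+ n.+2 * cfd n.+1) + ((-1) ^+ n.+1 * cfd n).
  by rewrite !exprS; ring.
by rewrite -h1 -h2; ring.
Qed.

Lemma cfW n : (cfQ n.+1)%:~R * cfd n + (cfQ n)%:~R * cfd n.+1 = 1.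
Proof.
elim: n => [|n IH]; first by rewrite /=; ring.
by rewrite -[RHS]IH cfQSS intrD intrM (cfd_rec n); ring.
Qed.

Lemma cfdet n : cfQ n.+1 * cfP n - cfQ n * cfP n.+1 = (-1) ^+ n.
Proof.
elim: n => [|n IH]; first by rewrite /=; ring.
by rewrite cfQSS cfPSS [in RHS]exprS -IH; ring.
Qed.

(** The integer vectors (Q(n+1), P(n+1)) and (Q(n+2), P(n+2)) form a basis of
    Z^2, in which the form k alpha - z has coefficients of opposite signs. *)
Lemma cf_basis n (k z : int) : exists x y : int,
  [/\ k = x * cfQ n.+1 + y * cfQ n.+2, z = x * cfP n.+1 + y * cfP n.+2 &
      k%:~R * alpha - z%:~R =
      (-1) ^+ n * (x%:~R * cfd n.+1 - y%:~R * cfd n.+2)].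
Proof.
have h := cfdet n.+1; have h1 : (-1 : int) ^+ n.+1 * (-1) ^+ n.+1 = 1.
  by rewrite -expr2 sqrr_sign.
pose x := (-1) ^+ n.+1 * (z * cfQ n.+2 - k * cfP n.+2).
pose y := (-1) ^+ n.+1 * (k * cfP n.+1 - z * cfQ n.+1).
exists x, y.
have ek : k = x * cfQ n.+1 + y * cfQ n.+2.
  transitivity ((-1) ^+ n.+1 * (-1) ^+ n.+1 * k); first by rewrite h1 mul1r.
  by rewrite -{2}h /x /y; ring.
have ez : z = x * cfP n.+1 + y * cfP n.+2.
  transitivity ((-1) ^+ n.+1 * (-1) ^+ n.+1 * z); first by rewrite h1 mul1r.
  by rewrite -{2}h /x /y; ring.
clearbody x y.
split=> //; rewrite ek ez !intrD !intrM.
transitivity (x%:~R * ((cfQ n.+1)%:~R * alpha - (cfP n.+1)%:~R) +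
  y%:~R * ((cfQ n.+2)%:~R * alpha - (cfP n.+2)%:~R)); first by ring.
by rewrite !cfD !exprS; ring.
Qed.

(** When k is small the coefficients of [cf_basis] have opposite signs, so that
    the two terms of k alpha - z add up. *)
Lemma cf_best n (k z : int) : k != 0 -> `|k| < cfQ n.+2 ->
  cfd n.+1 <= `|k%:~R * alpha - z%:~R|.
Proof.
move=> k0 kQ; have [x [y [ek ez ->]]] := cf_basis n k z.
rewrite normrM normrX normrN1 expr1n mul1r.
have d1 := cfd_gt0 n.+1; have d2 := cfd_gt0 n.+2.
have q1 := cfQS_ge1 n; have q2 := cfQS_ge1 n.+1.
have key : (y = 0 /\ x != 0) \/ (1 <= x /\ y <= -1) \/ (x <= -1 /\ 1 <= y).
  case: (eqVneq y 0) => [y0|y0].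
    by left; split=> //; apply: contra k0 => /eqP x0; rewrite ek x0 y0 !mul0r.
  right; nia.
case: key => [[-> x0]|[[x1 y1]|[x1 y1]]].
- rewrite mulr0z mul0r subr0 normrM (gtr0_norm d1) ler_peMl ?(ltW d1) //.
  by rewrite -intr_norm ler1z -gtz0_ge1 normr_gt0.
- have : 1 <= x%:~R :> R by rewrite ler1z.
  have : y%:~R <= -1 :> R by rewrite -[X in _ <= X]/((-1)%:~R) ler_int.
  move=> hy hx; apply: le_trans (ler_norm _); nra.
- have : x%:~R <= -1 :> R by rewrite -[X in _ <= X]/((-1)%:~R) ler_int.
  have : 1 <= y%:~R :> R by rewrite ler1z.
  move=> hy hx; rewrite -normrN; apply: le_trans (ler_norm _); nra.
Qed.

Lemma cf_sep n (i j : nat) (z : int) : i != j ->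
  i%:Z < cfQ n.+2 -> j%:Z < cfQ n.+2 ->
  cfd n.+1 <= `|i%:R * alpha - j%:R * alpha - z%:~R|.
Proof.
move=> ij hi hj; have -> : i%:R * alpha - j%:R * alpha = (i%:Z - j%:Z)%:~R * alpha.
  by rewrite intrB mulrBl.
by apply: cf_best; move: ij hi hj; clear; lia.
Qed.

Lemma cfQS_gtr0 n : 0 < (cfQ n.+1)%:~R :> R.
Proof. by rewrite ltr0z; have := cfQS_ge1 n; lia. Qed.

Lemma cfQr_ge0 n : 0 <= (cfQ n)%:~R :> R.
Proof. by rewrite ler0z cfQ_ge0. Qed.

Lemma cfQd_le1 n : (cfQ n.+1)%:~R * cfd n <= 1.
Proof.
have := cfW n; have := cfd_gt0 n.+1; have := cfQr_ge0 n; nra.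
Qed.

Lemma cfQd_ge n : 1 <= 2 * ((cfQ n.+1)%:~R * cfd n).
Proof.
have := cfW n; have := cfdS_lt n.
have h : (cfQ n)%:~R <= (cfQ n.+1)%:~R :> R.
  rewrite ler_int; case: n => // n; exact: cfQ_leS.
have := cfd_gt0 n.+1; have := cfd_gt0 n; have := cfQr_ge0 n; nra.
Qed.

Lemma cfQdS_ge n : 1 <= ((pq n)%:~R + 2) * ((cfQ n.+1)%:~R * cfd n.+1).
Proof.
have W := cfW n; rewrite (cfd_rec n) in W; have h1 := cfdS_lt n.+1.
have h : (cfQ n)%:~R <= (cfQ n.+1)%:~R :> R.
  rewrite ler_int; case: n {W h1} => // n; exact: cfQ_leS.
have h2 := cfd_gt0 n.+1; have h3 := cfQr_ge0 n; have h4 := cfQr_ge0 n.+1.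
have : (cfQ n.+1)%:~R * cfd n.+2 <= (cfQ n.+1)%:~R * cfd n.+1.
  by rewrite ler_wpM2l // ltW.
have : (cfQ n)%:~R * cfd n.+1 <= (cfQ n.+1)%:~R * cfd n.+1.
  by rewrite ler_wpM2r // ltW.
lra.
Qed.

Lemma cfaQdS_le n : (pq n)%:~R * ((cfQ n.+1)%:~R * cfd n.+1) <= 1.
Proof.
have := cfQd_le1 n; rewrite (cfd_rec n).
have := cfd_gt0 n.+2; have := cfQS_gtr0 n; nra.
Qed.

Lemma cfQ_geid n : n%:Z <= cfQ n.+2.
Proof.
elim: n => [|n IH]; first exact: cfQ_ge0.
by have := cfQS_leSS n.+1; have := cfQS_ge1 n; lia.
Qed.

Lemma cfd_le_inv n : cfd n.+1 <= n.+1%:R^-1.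
Proof.
have h := cfQd_le1 n.+1; have d := cfd_gt0 n.+1.
have : 1 <= cfQ n.+2 - n%:Z.
  elim: n {h d} => [|n IH]; first by have := cfQS_ge1 1; lia.
  by have := cfQS_leSS n.+1; have := cfQS_ge1 n; lia.
rewrite -(ler_int R) intrB -pmulrn => hq.
rewrite -[_^-1]mul1r ler_pdivlMr // -natr1.
by have : cfd n.+1 * (n%:R + 1) <= cfd n.+1 * (cfQ n.+2)%:~R; [nra|lra].
Qed.

End continued_fraction.
(** * Integrals over a period *)

Section window_integrals.
Variable R : realType.
Implicit Types (f g : R -> R) (x y z h M : R).
Notation mu := (@lebesgue_measure R).

(** Bounded measurable functions are integrable on bounded intervals and stable
    under every operation used below. *)
Definition bmeas g :=
  measurable_fun [set: R] g /\ exists M, forall x, `|g x| <= M.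

Lemma bmeas_cst (c : R) : bmeas (fun=> c).
Proof. by split; [exact: measurable_cst|exists `|c|]. Qed.

Lemma bmeasD f g : bmeas f -> bmeas g -> bmeas (fun x => f x + g x).
Proof.
move=> [mf [M hM]] [mg [N hN]]; split; first exact: measurable_funD.
by exists (M + N) => x; apply: le_trans (ler_normD _ _) _; rewrite lerD.
Qed.

Lemma bmeasM f g : bmeas f -> bmeas g -> bmeas (fun x => f x * g x).
Proof.
move=> [mf [M hM]] [mg [N hN]]; split; first exact: measurable_funM.
by exists (M * N) => x; rewrite normrM; apply: ler_pM.
Qed.

Lemma bmeasN f : bmeas f -> bmeas (fun x => - f x).
Proof.
move=> [mf [M hM]]; split; first exact: measurableT_comp.
by exists M => x; rewrite normrN.
Qed.

Lemma bmeasB f g : bmeas f -> bmeas g -> bmeas (fun x => f x - g x).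
Proof. by move=> bf bg; apply: bmeasD => //; exact: bmeasN. Qed.

Lemma bmeasZ (c : R) f : bmeas f -> bmeas (fun x => c * f x).
Proof. by move=> bf; apply: bmeasM => //; exact: bmeas_cst. Qed.

Lemma bmeas_sqr f : bmeas f -> bmeas (fun x => f x ^+ 2).
Proof.
by move=> bf; under [X in bmeas X]eq_fun do rewrite expr2; exact: bmeasM.
Qed.

Lemma bmeas_norm f : bmeas f -> bmeas (fun x => `|f x|).
Proof.
move=> [mf [M hM]]; split; first exact: measurableT_comp.
by exists M => x; rewrite normr_id.
Qed.

Lemma bmeas_sum (I : Type) (r : seq I) (F : I -> R -> R) :
  (forall i, bmeas (F i)) -> bmeas (fun x => \sum_(i <- r) F i x).
Proof.
move=> bF; elim: r => [|i r IH].
  by under [X in bmeas X]eq_fun do rewrite big_nil; exact: bmeas_cst.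
by under [X in bmeas X]eq_fun do rewrite big_cons; exact: bmeasD.
Qed.

Lemma bmeas_shift h f : bmeas f -> bmeas (fun x => f (x + h)).
Proof.
move=> [mf [M hM]]; split; last by exists M.
by apply: (measurableT_comp mf); apply: measurable_funD => //; exact: measurable_id.
Qed.

Lemma measurable_fun_floor :
  measurable_fun [set: R] (fun x => (Num.floor x)%:~R : R).
Proof.
apply: nondecreasing_measurable => // x y xy.
by rewrite ler_int le_floor.
Qed.

Lemma bmeas_int f x y : bmeas f -> mu.-integrable `[x, y] (EFin \o f).
Proof.
move=> [mf [M hM]]; apply: measurable_bounded_integrable => //.
- rewrite /= lebesgue_measure_itv /=; case: ifP => // _.
  by rewrite -EFinB ltry.
- exact: measurable_funTS.
- exists M; split; first by rewrite num_real.
  by move=> N MN z _; apply: le_trans (hM z) _; exact: ltW.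
Qed.
Hint Resolve bmeas_int : core.

Definition wint g x y : R := \int[mu]_(v in `[x, y]) g v.

Lemma eq_wint f g x y : (forall v, x <= v <= y -> f v = g v) ->
  wint f x y = wint g x y.
Proof.
move=> fg; apply: eq_Rintegral => v; rewrite inE /= in_itv /=; exact: fg.
Qed.

Lemma wintD f g x y : bmeas f -> bmeas g ->
  wint (fun v => f v + g v) x y = wint f x y + wint g x y.
Proof. by move=> bf bg; rewrite /wint RintegralD //; exact: bmeas_int. Qed.

Lemma wintB f g x y : bmeas f -> bmeas g ->
  wint (fun v => f v - g v) x y = wint f x y - wint g x y.
Proof. by move=> bf bg; rewrite /wint RintegralB //; exact: bmeas_int. Qed.

Lemma wintZ (c : R) f x y : bmeas f ->
  wint (fun v => c * f v) x y = c * wint f x y.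
Proof. by move=> bf; rewrite /wint RintegralZl //; exact: bmeas_int. Qed.

Lemma wint_cst (c : R) x y : x <= y -> wint (fun=> c) x y = c * (y - x).
Proof.
move=> xy; rewrite /wint Rintegral_cst //= lebesgue_measure_itv /= lte_fin.
case: ltP => //= yx; congr (_ * _); apply/esym/eqP; rewrite subr_eq0.
by rewrite eq_le yx xy.
Qed.

Lemma wint_le f g x y : bmeas f -> bmeas g ->
  (forall v, x <= v <= y -> f v <= g v) -> wint f x y <= wint g x y.
Proof.
move=> bf bg fg; apply: le_Rintegral => //; exact: bmeas_int.
Qed.

Lemma wint_ge0 f x y : (forall v, x <= v <= y -> 0 <= f v) -> 0 <= wint f x y.
Proof.
by move=> f0; apply: Rintegral_ge0 => v; rewrite /= in_itv /=; exact: f0.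
Qed.

Lemma wint_norm f x y : bmeas f -> `|wint f x y| <= wint (fun v => `|f v|) x y.
Proof. by move=> bf; apply: le_normr_Rintegral => //; exact: bmeas_int. Qed.

Lemma wint_bound f x y M : bmeas f -> x <= y ->
  (forall v, x <= v <= y -> `|f v| <= M) -> `|wint f x y| <= M * (y - x).
Proof.
move=> bf xy fM; apply: le_trans (wint_norm _ _ bf) _.
rewrite -(wint_cst M xy); apply: wint_le => //; last exact: bmeas_cst.
exact: bmeas_norm.
Qed.

Lemma wint_chasles f x y z : bmeas f -> x <= y -> y <= z ->
  wint f x z = wint f x y + wint f y z.
Proof.
move=> bf xy yz; apply/eqP; rewrite addrC -subr_eq; apply/eqP.
rewrite /wint Rintegral_itvB ?bnd_simp //; last exact: bmeas_int.
rewrite Rintegral_itv_obnd_cbnd //.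
by apply: integrableS (bmeas_int y z bf) => //; apply: subset_itvr; rewrite bnd_simp.
Qed.

Lemma wint_ae f g x y : bmeas f -> bmeas g ->
  {ae mu, forall v, x <= v <= y -> f v = g v} -> wint f x y = wint g x y.
Proof.
move=> bf bg fg; rewrite /wint /Rintegral; congr fine.
apply: ae_eq_integral => //.
- by apply/measurable_EFinP; apply: measurable_funTS; case: bf.
- by apply/measurable_EFinP; apply: measurable_funTS; case: bg.
- case: fg => N [mN N0 sN]; exists N; split=> // v nv; apply: sN => /= h.
  by apply: nv => /=; rewrite in_itv /= => /h ->.
Qed.

Lemma ae_itv_closed (P : R -> Prop) x y :
  {ae mu, forall v, x < v < y -> P v} -> {ae mu, forall v, x <= v <= y -> P v}.
Proof.
move=> [N [mN N0 sN]]; exists (N `|` [set x] `|` [set y]); split.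
- by apply: measurableU => //; apply: measurableU.
- have s0 (a : R) : mu [set a] = 0%E by exact: lebesgue_measure_set1.
  have mNx : measurable (N `|` [set x]) by exact: measurableU.
  by rewrite (measureU0 mNx (measurable_set1 y) (s0 y)) (measureU0 mN (measurable_set1 x) (s0 x)).
move=> v nv; apply: contrapT => /not_orP[/not_orP[nN nx] ny]; apply: nv => /= xvy.
have hv : x < v < y.
  move/eqP: nx => nx; move/eqP: ny => ny.
  by case/andP: xvy => h1 h2; rewrite !lt_neqAle h1 h2 eq_sym nx ny.
by apply: contrapT => h; apply: nN; apply: sN => /= /(_ hv).
Qed.

Lemma wint_le_ae f g x y : bmeas f -> bmeas g ->
  {ae mu, forall v, x < v < y -> f v <= g v} -> wint f x y <= wint g x y.
Proof.
move=> bf bg /ae_itv_closed[N [mN N0 sN]].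
have bm : bmeas (fun v => Num.max (f v) (g v)).
  case: bf bg => mf [M hM] [mg [M' hM']]; split; first exact: measurable_maxr.
  exists (Num.max M M') => v; rewrite le_max; case: (leP (f v) (g v)) => _.
    by rewrite hM' orbT.
  by rewrite hM.
have -> : wint g x y = wint (fun v => Num.max (f v) (g v)) x y.
  apply: wint_ae => //; exists N; split=> // v nv; apply: sN => /= h; apply: nv.
  by move=> /h fg; rewrite (max_idPr fg).
by apply: wint_le => // v _; rewrite le_max lexx.
Qed.

Definition translate h (x : measurableTypeR R) : measurableTypeR R := x + h.

Lemma measurable_translate h : measurable_fun [set: measurableTypeR R] (translate h).
Proof. by apply: measurable_funD => //; exact: measurable_id. Qed.

HB.instance Definition _ h := isMeasurableFun.Build _ _ _ _ (translate h)
  (measurable_translate h).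

Lemma lebesgue_translate h (A : set R) : measurable A ->
  mu (translate h @^-1` A) = mu A.
Proof.
move=> mA; apply/esym.
apply: (@lebesgue_measure_unique R (pushforward mu (translate h))) => //.
move=> _ [[a b] _ <-] /=; rewrite /pushforward.
have -> : translate h @^-1` `]a, b] = `]a - h, b - h]%classic.
  apply/seteqP; split=> x /=; rewrite /translate !in_itv /=;
    by rewrite ltrBlDr lerBrDr.
rewrite !lebesgue_measure_itv /= !lte_fin ltrD2r; case: ifP => // _.
by congr (_%:E); ring.
Qed.

Lemma wint_shift f x y h : bmeas f ->
  wint (fun v => f (v + h)) x y = wint f (x + h) (y + h).
Proof.
move=> bf; rewrite /wint /Rintegral; congr fine.
have e : translate h @^-1` (`[x + h, y + h]%classic : set R) = `[x, y]%classic.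
  by apply/seteqP; split=> v /=; rewrite /translate !in_itv /= !lerD2r.
transitivity (\int[pushforward mu (translate h)]_(v in `[(x + h)%R, (y + h)%R]) (f v)%:E)%E.
  rewrite integral_pushforward //.
  - by rewrite e.
  - by apply/measurable_EFinP; case: bf.
  - by rewrite e; exact: (bmeas_int x y (bmeas_shift h bf)).
apply: eq_measure_integral => A mA _; exact: lebesgue_translate.
Qed.

Lemma ae_shift h (P : R -> Prop) :
  {ae mu, forall x, P x} -> {ae mu, forall x, P (x + h)}.
Proof.
move=> [N [mN N0 PN]]; exists (translate h @^-1` N); split.
- by rewrite -[_ @^-1` _]setTI; exact: measurable_translate.
- by rewrite lebesgue_translate.
- by move=> x /= nP; apply: PN.
Qed.

Definition periodic1 (T : Type) (f : R -> T) := forall x, f (x + 1) = f x.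

Lemma periodic1_int (T : Type) (f : R -> T) (k : int) x : periodic1 f ->
  f (x + k%:~R) = f x.
Proof.
move=> pf; have N n y : f (y + n%:R) = f y.
  by elim: n => [|n IH]; rewrite ?addr0 // -natr1 addrA pf IH.
case: k => n; first exact: N.
by rewrite NegzE mulrNz -[in RHS](subrK (n.+1)%:R x) N.
Qed.


Definition pint g := wint g 0 1.

Lemma wint_period g h : bmeas g -> periodic1 g -> wint g h (h + 1) = pint g.
Proof.
move=> bg pg; pose n := Num.floor h; pose r := h - n%:~R.
have /andP[h1 h2] := floor_itv h; rewrite intrD in h2.
have -> : wint g h (h + 1) = wint g r (r + 1).
  rewrite -[RHS](@eq_wint (fun v => g (v + n%:~R))).
    by rewrite wint_shift //; congr wint; rewrite /r; ring.
  by move=> v _; rewrite periodic1_int.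
have r0 : 0 <= r by rewrite subr_ge0.
have r1 : r <= 1 by rewrite /r lerBlDl; exact: ltW.
rewrite (@wint_chasles _ _ 1) // ?lerDr //.
rewrite /pint (@wint_chasles _ 0 r 1) // addrC; congr (_ + _).
rewrite -[in RHS](@eq_wint (fun v => g (v + 1))); last by move=> v _; rewrite pg.
by rewrite wint_shift // add0r.
Qed.

Lemma pint_shift g h : bmeas g -> periodic1 g -> pint (fun v => g (v + h)) = pint g.
Proof. by move=> bg pg; rewrite /pint wint_shift // add0r addrC wint_period. Qed.

End window_integrals.
(** * Energy of the averages at the scales of the continued fraction *)

Section energy.
Variable R : realType.
Implicit Types (g : R -> R) (x y l : R).

Definition win g l x : R := wint g x (x + l).

Lemma win_le g l x M : bmeas g -> 0 <= l -> (forall v, `|g v| <= M) ->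
  `|win g l x| <= M * l.
Proof.
move=> bg l0 gM; apply: le_trans (wint_bound bg _ (fun v _ => gM v)) _.
  by rewrite lerDl.
by rewrite addrC addKr.
Qed.

Lemma win_add g l l' x : bmeas g -> 0 <= l -> 0 <= l' ->
  win g (l + l') x = win g l x + win g l' (x + l).
Proof.
by move=> bg l0 l0'; rewrite /win addrA (@wint_chasles _ _ _ (x + l)) // lerDl.
Qed.

Lemma win_lip g l x y M : bmeas g -> 0 <= l -> (forall v, `|g v| <= M) ->
  `|win g l x - win g l y| <= 2 * M * `|x - y|.
Proof.
move=> bg l0 gM; wlog xy : x y / x <= y.
  move=> H; case/orP: (le_total x y) => [/H//|/H].
  by rewrite distrC [`|y - x|]distrC.
rewrite [`|x - y|]distrC [`|y - x|]ger0_norm ?subr_ge0 //.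
have e1 : win g l x + wint g (x + l) (y + l) = wint g x y + win g l y.
  rewrite /win -wint_chasles ?lerDl ?lerD2r // -wint_chasles // ?lerDl //.
have -> : win g l x - win g l y = wint g x y - wint g (x + l) (y + l).
  by apply/eqP; rewrite subr_eq addrAC -e1 addrK.
apply: le_trans (ler_normB _ _) _; rewrite -mulrA mulr2n mulrDl mul1r; apply: lerD.
  exact: wint_bound.
apply: le_trans (wint_bound bg _ (fun v _ => gM v)) _; first by rewrite lerD2r.
by rewrite opprD addrACA subrr addr0.
Qed.

Lemma bmeas_win g l : bmeas g -> 0 <= l -> bmeas (win g l).
Proof.
move=> bg l0; have [mg [M gM]] := bg.
have M0 : 0 <= M by apply: le_trans (gM 0).
split; last by exists (M * l) => x; exact: win_le.
have M1 : 0 < 2 * M + 1 by lra.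
have cw : continuous (win g l).
  move=> x; apply/cvgrPdist_le => e e0; near=> y.
  apply: le_trans (win_lip x y bg l0 gM) _.
  have : `|x - y| <= e / (2 * M + 1).
    near: y; apply/nbhs_ballP; exists (e / (2 * M + 1)); first by rewrite /= divr_gt0.
    by move=> y /=; exact: ltW.
  rewrite ler_pdivlMr // => h; have := normr_ge0 (x - y); nra.
exact: continuous_measurable_fun.
Unshelve. all: by end_near. Qed.

Lemma periodic1_win g l : bmeas g -> periodic1 g -> periodic1 (win g l).
Proof.
move=> bg pg x; rewrite /win addrAC -wint_shift //.
by apply: eq_wint => v _; rewrite pg.
Qed.

Lemma pintD (f g : R -> R) : bmeas f -> bmeas g ->
  pint (fun x => f x + g x) = pint f + pint g.
Proof. exact: wintD. Qed.

Lemma pintZ (c : R) g : bmeas g -> pint (fun x => c * g x) = c * pint g.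
Proof. exact: wintZ. Qed.

Lemma pint_le (f g : R -> R) : bmeas f -> bmeas g -> (forall x, f x <= g x) ->
  pint f <= pint g.
Proof. by move=> bf bg fg; apply: wint_le => // v _. Qed.

Lemma pint_ge0 g : (forall x, 0 <= g x) -> 0 <= pint g.
Proof. by move=> g0; apply: wint_ge0. Qed.

Lemma pint_cst (c : R) : pint (fun=> c) = c.
Proof. by rewrite /pint wint_cst // subr0 mulr1. Qed.

Lemma pint_sum (I : Type) (r : seq I) (F : I -> R -> R) :
  (forall i, bmeas (F i)) ->
  pint (fun x => \sum_(i <- r) F i x) = \sum_(i <- r) pint (F i).
Proof.
move=> bF; elim: r => [|i r IH].
  rewrite big_nil; under [X in pint X]eq_fun do rewrite big_nil.
  exact: pint_cst.
rewrite big_cons -IH; under [X in pint X]eq_fun do rewrite big_cons.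
by rewrite pintD //; exact: bmeas_sum.
Qed.

(** The energy that survives averaging over windows of length [l]: it is at most
    [l] when [g] is bounded by 1. *)
Definition theta g l : R := pint (fun x => win g l x ^+ 2) / l.

Definition shift_gap g l (d : nat) : R :=
  pint (fun x => (win g l (x + d%:R * l) - win g l x) ^+ 2).


Lemma theta_ge0 g l : 0 < l -> 0 <= theta g l.
Proof.
move=> l0; apply: divr_ge0; last exact: ltW.
by apply: pint_ge0 => x; exact: sqr_ge0.
Qed.

Lemma theta_le g l : bmeas g -> 0 < l -> (forall v, `|g v| <= 1) ->
  theta g l <= l.
Proof.
move=> bg l0 g1; rewrite /theta ler_pdivrMr //.
rewrite -(pint_cst (l * l)); apply: pint_le; last first.
- move=> x; rewrite -expr2 -[X in X <= _]real_normK ?num_real //.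
  rewrite lerXn2r ?nnegrE ?normr_ge0 ?(ltW l0) //.
  by have := win_le x bg (ltW l0) g1; rewrite mul1r.
- exact: bmeas_cst.
- by apply: bmeas_sqr; apply: bmeas_win => //; exact: ltW.
Qed.

Lemma win_sum g l (a : nat) x : bmeas g -> 0 <= l ->
  win g (a%:R * l) x = \sum_(i < a) win g l (x + i%:R * l).
Proof.
move=> bg l0; elim: a => [|a IH].
  by rewrite big_ord0 /win mul0r addr0 /wint set_itv1 Rintegral_set1.
by rewrite big_ord_recr /= -IH -natr1 mulrDl mul1r win_add // mulr_ge0.
Qed.

Lemma lagrange_sum (a : nat) (w : nat -> R) :
  \sum_(i < a) \sum_(j < a) (w i - w j) ^+ 2 =
  2 * (a%:R * (\sum_(i < a) w i ^+ 2) - (\sum_(i < a) w i) ^+ 2).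
Proof.
have -> : \sum_(i < a) \sum_(j < a) (w i - w j) ^+ 2 =
  \sum_(i < a) (a%:R * w i ^+ 2 - 2 * w i * (\sum_(j < a) w j) +
     \sum_(j < a) w j ^+ 2).
  apply: eq_bigr => i _.
  under eq_bigr do rewrite sqrrB.
  rewrite big_split /=; congr (_ + _).
  rewrite sumrB sumr_const card_ord mulr_natl; congr (_ - _).
  by rewrite mulr_sumr; apply: eq_bigr => j _; rewrite -mulr_natl mulrA.
rewrite big_split /= sumrB -mulr_sumr sumr_const card_ord.
under [X in _ - X]eq_bigr do rewrite -mulrA.
rewrite -mulr_sumr -mulr_suml -[X in _ + X]mulr_natl; ring.
Qed.

(** Cauchy-Schwarz makes [theta] subadditive in the length; the defect for
    [a] windows of length [l] followed by one of length [l'] is at least the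
    variance of the [a] window integrals, by Lagrange's identity. *)
Lemma theta_defect g l l' (a : nat) : bmeas g -> periodic1 g -> 0 < l ->
    0 < l' -> (0 < a)%N ->
  \sum_(i < a) \sum_(j < a)
    pint (fun x => (win g l (x + i%:R * l) - win g l (x + j%:R * l)) ^+ 2)
  <= 2 * (a%:R * l) * (a%:R * theta g l + theta g l' - theta g (a%:R * l + l')).
Proof.
move=> bg pg l0 l0' a0.
have al0 : 0 < a%:R * l by rewrite mulr_gt0 // ltr0n.
have bw y : 0 < y -> bmeas (win g y) by move=> /ltW; exact: bmeas_win.
pose w i x := win g l (x + i%:R * l).
pose B x := win g l' (x + a%:R * l).
have bwi i : bmeas (w i) by apply: bmeas_shift; exact: bw.
have bB : bmeas B by apply: bmeas_shift; exact: bw.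
have psq y h : 0 < y ->
    pint (fun x => win g y (x + h) ^+ 2) = pint (fun x => win g y x ^+ 2).
  move=> y0; apply: (pint_shift h (g := fun x => win g y x ^+ 2)).
    by apply: bmeas_sqr; exact: bw.
  by move=> x; rewrite periodic1_win.
have e1 : a%:R * theta g l = l^-1 * pint (fun x => \sum_(i < a) w i x ^+ 2).
  rewrite pint_sum; last by move=> i; exact: bmeas_sqr.
  rewrite (eq_bigr (fun=> pint (fun x => win g l x ^+ 2))); last first.
    by move=> i _; exact: psq.
  by rewrite sumr_const card_ord /theta -[X in _ = _ * X]mulr_natl; ring.
have e2 : theta g l' = l'^-1 * pint (fun x => B x ^+ 2).
  by rewrite /B psq // /theta mulrC.
have e3 : theta g (a%:R * l + l') =
    (a%:R * l + l')^-1 * pint (fun x => (\sum_(i < a) w i x + B x) ^+ 2).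
  rewrite /theta mulrC; congr (_ * pint _); apply/funext => x.
  by rewrite win_add ?ltW // win_sum ?ltW.
have bS : bmeas (fun x => \sum_(i < a) w i x) by apply: bmeas_sum.
have bSq : bmeas (fun x => \sum_(i < a) w i x ^+ 2).
  by apply: bmeas_sum => i; exact: bmeas_sqr.
have bSB : bmeas (fun x => (\sum_(i < a) w i x + B x) ^+ 2).
  by apply: bmeas_sqr; exact: bmeasD.
have -> : \sum_(i < a) \sum_(j < a)
    pint (fun x => (win g l (x + i%:R * l) - win g l (x + j%:R * l)) ^+ 2) =
    pint (fun x => \sum_(i < a) \sum_(j < a) (w i x - w j x) ^+ 2).
  have bij i j : bmeas (fun x => (w i x - w j x) ^+ 2).
    by apply: bmeas_sqr; exact: bmeasB.
  rewrite pint_sum; last by move=> i; apply: bmeas_sum.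
  by apply: eq_bigr => i _; rewrite pint_sum.
rewrite e1 e2 e3 -!pintZ //; last exact: bmeas_sqr.
rewrite -pintD; [|exact: bmeasZ|exact/bmeasZ/bmeas_sqr].
rewrite -mulN1r -pintZ; last exact: bmeasZ.
have bA : bmeas (fun x => l^-1 * (\sum_(i < a) w i x ^+ 2) + l'^-1 * B x ^+ 2).
  by apply: bmeasD; apply: bmeasZ => //; exact: bmeas_sqr.
rewrite -pintD //; last by apply: bmeasZ; exact: bmeasZ.
rewrite -pintZ; last by apply: bmeasD => //; apply: bmeasZ; exact: bmeasZ.
apply: pint_le.
- by apply: bmeas_sum => i; apply: bmeas_sum => j; apply: bmeas_sqr; exact: bmeasB.
- by apply: bmeasZ; apply: bmeasD => //; apply: bmeasZ; exact: bmeasZ.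
move=> x; rewrite (lagrange_sum a (fun i => w i x)).
set S2 := \sum_(i < a) _ ^+ 2; set S := \sum_(i < a) _; set b := B x.
set A := a%:R * l in al0 *.
have -> : 2 * (a%:R * S2 - S ^+ 2) = 2 * A * (l^-1 * S2 - S ^+ 2 / A).
  rewrite /A; field; rewrite gt_eqF //= gt_eqF // ltr0n //.
rewrite ler_pM2l; last by rewrite mulr_gt0.
suff : (S + b) ^+ 2 / (A + l') <= S ^+ 2 / A + b ^+ 2 / l'.
  rewrite mulN1r [_ / (A + l')]mulrC [b ^+ 2 / l']mulrC; lra.
have Al : 0 < A + l' by rewrite addr_gt0.
rewrite ler_pdivrMr //.
have -> : (S ^+ 2 / A + b ^+ 2 / l') * (A + l') =
   (S + b) ^+ 2 + (S * l' - b * A) ^+ 2 / (A * l').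
  by field; rewrite !gt_eqF.
by rewrite lerDl divr_ge0 ?sqr_ge0 // mulr_ge0 // ltW.
Qed.

Lemma theta_defect_gap g l l' (a h : nat) : bmeas g -> periodic1 g -> 0 < l ->
    0 < l' -> (0 < a)%N -> (2 * h <= a)%N ->
  h%:R * \sum_(0 <= d < h) shift_gap g l d
  <= 2 * (a%:R * l) * (a%:R * theta g l + theta g l' - theta g (a%:R * l + l')).
Proof.
move=> bg pg l0 l0' a0 ha; apply: le_trans (theta_defect bg pg l0 l0' a0).
pose N i j := pint (fun x => (win g l (x + i%:R * l) - win g l (x + j%:R * l)) ^+ 2).
have N0 i j : 0 <= N i j by apply: pint_ge0 => x; exact: sqr_ge0.
have Nd i d : N i (i + d)%N = shift_gap g l d.
  rewrite /shift_gap -(pint_shift (i%:R * l)); last 2 first.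
  - by apply: bmeas_sqr; apply: bmeasB; [apply: bmeas_shift|];
      apply: bmeas_win => //; exact: ltW.
  - by move=> x; rewrite addrAC !periodic1_win.
  rewrite /N; congr pint; apply/funext => x; rewrite -sqrrN opprB.
  by congr ((win g l _ - _) ^+ 2); rewrite natrD; ring.
rewrite -(big_mkord xpredT (fun i => \sum_(j < a) N i j)).
have ha' : (h <= a)%N by apply: leq_trans ha; rewrite mul2n -addnn leq_addr.
rewrite [leRHS](big_cat_nat (n := h)) //=.
apply: (@le_trans _ _ (\sum_(0 <= i < h) \sum_(j < a) N i j)); last first.
  by rewrite lerDl; apply: sumr_ge0 => i _; exact: sumr_ge0.
have -> (c : R) : h%:R * c = \sum_(0 <= i < h) c.
  by rewrite sumr_const_nat subn0 mulr_natl.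
rewrite [leLHS]big_nat [leRHS]big_nat; apply: ler_sum => i /andP[_ ih].
rewrite -(big_mkord xpredT (fun j => N i j)).
have ih2 : (i + h <= a)%N by lia.
rewrite [leRHS](big_cat_nat (n := i)) ?(leq_trans _ ih2) ?leq_addr //=.
rewrite [X in _ <= _ + X](big_cat_nat (n := i + h)%N) ?leq_addr //=.
have -> : \sum_(i <= j < i + h) N i j = \sum_(0 <= d < h) shift_gap g l d.
  rewrite -{1}(add0n i) big_addn addKn.
  by apply: eq_bigr => d _; rewrite addnC Nd.
by rewrite ler_wpDl ?sumr_ge0 // lerDl sumr_ge0.
Qed.

End energy.

Section energy_continued_fraction.
Variables (R : realType) (alpha : R).
Hypothesis Ha : irrational01 alpha.
Notation Q := (cfQ alpha).
Notation d := (cfd alpha).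

Definition pqn n : nat := `|pq alpha n|%N.

Lemma pqnE n : (pqn n)%:Z = pq alpha n.
Proof. by rewrite /pqn gez0_abs //; have := pq_ge1 Ha n; lia. Qed.

Lemma pqnrE n : (pqn n)%:R = (pq alpha n)%:~R :> R.
Proof. by rewrite -pqnE. Qed.

Lemma pqn_gt0 n : (0 < pqn n)%N.
Proof. by have := pq_ge1 Ha n; rewrite -pqnE; lia. Qed.

(** The weighted sum [q_n theta(d_(n-1)) + q_(n-1) theta(d_n)] lies in [0, 1]
    and increases with [n], so its increments, which control the variation of
    the window integrals inside each scale, are summable. *)
Lemma energy_sum (g : R -> R) N : bmeas g -> periodic1 g ->
    (forall v, `|g v| <= 1) ->
  \sum_(0 <= n < N) (Q n.+1)%:~R * ((pqn n)./2)%:R / (2 * ((pqn n)%:R * d n.+1)) *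
     (\sum_(0 <= k < (pqn n)./2) shift_gap g (d n.+1) k) <= 1.
Proof.
move=> bg pg g1.
pose Phi n := (Q n.+1)%:~R * theta g (d n) + (Q n)%:~R * theta g (d n.+1).
have PhiN : Phi N <= 1.
  rewrite -(cfW Ha N); apply: lerD; apply: ler_wpM2l; rewrite ?(cfQr_ge0 Ha) //;
    by apply: theta_le => //; exact: cfd_gt0.
have Phi0 : 0 <= Phi 0%N.
  by apply: addr_ge0; apply: mulr_ge0; rewrite ?(cfQr_ge0 Ha) // theta_ge0 // cfd_gt0.
apply: (@le_trans _ _ (Phi N - Phi 0%N)); last by lra.
rewrite -(telescope_sumr _ (leq0n N)); apply: ler_sum => n _.
have d1 := cfd_gt0 Ha n.+1; have d2 := cfd_gt0 Ha n.+2.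
have a0 := pqn_gt0 n.
have ha : (2 * (pqn n)./2 <= pqn n)%N by have := odd_double_half (pqn n); lia.
have := theta_defect_gap bg pg d1 d2 a0 ha.
rewrite pqnrE -(cfd_rec Ha n) => H.
have -> : Phi n.+1 - Phi n = (Q n.+1)%:~R * ((pq alpha n)%:~R * theta g (d n.+1) +
    theta g (d n.+2) - theta g (d n)).
  by rewrite /Phi cfQSS intrD intrM; ring.
have a0r : 0 < (pq alpha n)%:~R :> R by rewrite -pqnrE ltr0n.
have ad : 0 < 2 * ((pq alpha n)%:~R * d n.+1) by rewrite mulr_gt0 // mulr_gt0.
set S := \sum_(0 <= k < _) _ in H *.
have -> : (Q n.+1)%:~R * (pqn n)./2%:R / (2 * ((pq alpha n)%:~R * d n.+1)) * S =
  (Q n.+1)%:~R * ((pqn n)./2%:R * S / (2 * ((pq alpha n)%:~R * d n.+1))) by ring.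
by rewrite ler_wpM2l ?(cfQr_ge0 Ha) // ler_pdivrMr // [leRHS]mulrC.
Qed.

End energy_continued_fraction.
(** * Complex-valued windows *)

Section complex_norm.
Variable R : realType.
Implicit Types (z w : R[i]).
Local Notation Re := (@complex.Re R).
Local Notation Im := (@complex.Im R).

(** The modulus as a real number: the norm of [R[i]] has its values in [R[i]]. *)
Definition nm z : R := Num.sqrt (Re z ^+ 2 + Im z ^+ 2).

Lemma nmE z : `|z| = (nm z)%:C%C. Proof. exact: normc_def. Qed.

Lemma nm_ge0 z : 0 <= nm z. Proof. exact: sqrtr_ge0. Qed.

Lemma sqr_nm z : nm z ^+ 2 = Re z ^+ 2 + Im z ^+ 2.
Proof. by rewrite sqr_sqrtr // addr_ge0 ?sqr_ge0. Qed.

Lemma nmM z w : nm (z * w) = nm z * nm w.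
Proof.
by have := normrM z w; rewrite !nmE -rmorphM => /complexI.
Qed.

Lemma nmD z w : nm (z + w) <= nm z + nm w.
Proof. by have := ler_normD z w; rewrite !nmE -rmorphD lecR. Qed.

Lemma nmN z : nm (- z) = nm z.
Proof. by have := normrN z; rewrite !nmE => /complexI. Qed.

Lemma nmB z w : nm (z - w) <= nm z + nm w.
Proof. by rewrite -(nmN w); exact: nmD. Qed.

Lemma nm_distC z w : nm (z - w) = nm (w - z).
Proof. by rewrite -nmN opprB. Qed.

Lemma nmB_ge z w : nm z - nm w <= nm (z + w).
Proof. by rewrite lerBlDr -{1}(addrK w z); exact: nmB. Qed.

Lemma nm_triangle w z z' : nm (z - z') <= nm (z - w) + nm (w - z').
Proof. by rewrite -[z - z'](subrKA w); exact: nmD. Qed.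

Lemma nm1_normr z : (`|z| = 1) <-> nm z = 1.
Proof. by rewrite nmE; split=> [|->] // /(congr1 Re). Qed.

Lemma nm0 : nm 0 = 0. Proof. by rewrite /nm /= !expr0n /= addr0 sqrtr0. Qed.

Lemma nm1 : nm 1 = 1. Proof. by rewrite /nm /= expr1n expr0n /= addr0 sqrtr1. Qed.

Lemma nm_eq0 z : nm z = 0 -> z = 0.
Proof. by move=> h; apply: normr0_eq0; rewrite nmE h. Qed.

Lemma nmX z n : nm (z ^+ n) = nm z ^+ n.
Proof. by elim: n => [|n IH]; rewrite ?expr0 ?nm1 // !exprS nmM IH. Qed.

Lemma nmV z : nm z = 1 -> nm z^-1 = 1.
Proof.
move=> h; have z0 : z != 0.
  by apply/eqP => z0; move: h; rewrite z0 nm0 => /esym/eqP; rewrite oner_eq0.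
by rewrite -[LHS]mul1r -h -nmM divff // nm1.
Qed.


Lemma expi_nm (x : R) : nm (expi x) = 1.
Proof. by rewrite /nm /= cos2Dsin2 sqrtr1. Qed.

Lemma expiD (x y : R) : expi (x + y) = expi x * expi y.
Proof. apply/eqP; rewrite eq_complex /= cosD sinD; apply/andP; split; apply/eqP; ring.
Qed.

Lemma expi0 : expi 0 = 1 :> R[i].
Proof. by rewrite /expi cos0 sin0. Qed.

Lemma expiN (x : R) : expi (- x) = (expi x)^-1.
Proof.
have h : expi x * expi (- x) = 1 by rewrite -expiD subrr expi0.
have x0 : expi x != 0.
  by apply/eqP => x0; have := expi_nm x; rewrite x0 nm0 => /esym/eqP; rewrite oner_eq0.
by apply: (mulfI x0); rewrite h divff.
Qed.

Lemma expi_neq0 (x : R) : expi x != 0.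
Proof.
by apply/eqP => x0; have := expi_nm x; rewrite x0 nm0 => /esym/eqP; rewrite oner_eq0.
Qed.

Lemma expi_intr (k : int) : expi (2 * pi * k%:~R) = 1 :> R[i].
Proof.
have N n : expi (2 * pi * n%:R) = 1 :> R[i].
  elim: n => [|n IH]; first by rewrite mulr0 expi0.
  rewrite -(natr1 n) (mulrDr (2 * pi)) expiD IH mulr1.
  by rewrite mul1r /expi mulr_natl cos2pi sin2pi.
case: k => n; first exact: N.
by rewrite NegzE mulrNz mulrN expiN N invr1.
Qed.

End complex_norm.

Section complex_windows.
Variable R : realType.
Implicit Types (F G : R -> R[i]) (x y l : R).
Local Notation Re := (@complex.Re R).
Local Notation Im := (@complex.Im R).
Notation mu := (@lebesgue_measure R).

Definition cbm F := bmeas (Re \o F) /\ bmeas (Im \o F).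

Definition cint F x y : R[i] :=
  (wint (Re \o F) x y +i* wint (Im \o F) x y)%C.

Lemma cbmD F G : cbm F -> cbm G -> cbm (fun v => F v + G v).
Proof.
move=> [F1 F2] [G1 G2]; split.
  rewrite (_ : _ \o _ = fun v => (Re \o F) v + (Re \o G) v); first exact: bmeasD.
  by apply/funext => v /=; case: (F v); case: (G v).
rewrite (_ : _ \o _ = fun v => (Im \o F) v + (Im \o G) v); first exact: bmeasD.
by apply/funext => v /=; case: (F v); case: (G v).
Qed.

Lemma cbmM F G : cbm F -> cbm G -> cbm (fun v => F v * G v).
Proof.
move=> [F1 F2] [G1 G2]; split.
  rewrite (_ : _ \o _ = fun v => (Re \o F) v * (Re \o G) v - (Im \o F) v * (Im \o G) v).
    by apply: bmeasB; exact: bmeasM.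
  by apply/funext => v /=; case: (F v); case: (G v).
rewrite (_ : _ \o _ = fun v => (Re \o F) v * (Im \o G) v + (Im \o F) v * (Re \o G) v).
  by apply: bmeasD; exact: bmeasM.
by apply/funext => v /=; case: (F v); case: (G v).
Qed.

Lemma cbm_cst (c : R[i]) : cbm (fun=> c).
Proof. by split; exact: bmeas_cst. Qed.

Lemma cbm_real (g : R -> R) : bmeas g -> cbm (fun v => (g v)%:C%C).
Proof. by move=> bg; split => //; exact: bmeas_cst. Qed.

Lemma cbm_shift h F : cbm F -> cbm (fun v => F (v + h)).
Proof. by move=> [F1 F2]; split; [exact: (bmeas_shift h F1)|exact: (bmeas_shift h F2)]. Qed.

Lemma cintD F G x y : cbm F -> cbm G ->
  cint (fun v => F v + G v) x y = cint F x y + cint G x y.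
Proof.
move=> [F1 F2] [G1 G2]; apply/eqP; rewrite eq_complex /=; apply/andP; split; apply/eqP.
  by rewrite -wintD //; apply: eq_wint => v _ /=; case: (F v); case: (G v).
by rewrite -wintD //; apply: eq_wint => v _ /=; case: (F v); case: (G v).
Qed.

Lemma cintZ (c : R[i]) F x y : cbm F ->
  cint (fun v => c * F v) x y = c * cint F x y.
Proof.
move=> [F1 F2]; case: c => a b; apply/eqP; rewrite eq_complex /=.
apply/andP; split; apply/eqP.
  rewrite -!wintZ // -wintB; [|exact: bmeasZ|exact: bmeasZ].
  by apply: eq_wint => v _ /=; case: (F v).
rewrite -!wintZ // -wintD; [|exact: bmeasZ|exact: bmeasZ].
by apply: eq_wint => v _ /=; case: (F v).
Qed.

Lemma cint_chasles F x y z : cbm F -> x <= y -> y <= z ->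
  cint F x z = cint F x y + cint F y z.
Proof.
move=> [F1 F2] xy yz; rewrite /cint (wint_chasles F1 xy yz) (wint_chasles F2 xy yz).
by apply/eqP; rewrite eq_complex /= !eqxx.
Qed.

Lemma cint_ae F G x y : cbm F -> cbm G ->
  {ae mu, forall v, x <= v <= y -> F v = G v} -> cint F x y = cint G x y.
Proof.
move=> [F1 F2] [G1 G2] [N [mN N0 sN]].
have H (h : R[i] -> R) : {ae mu, forall v, x <= v <= y -> h (F v) = h (G v)}.
  exists N; split=> // v nv; apply: sN => /= e; apply: nv => /= xvy.
  by rewrite e.
by rewrite /cint; congr (_ +i* _)%C; apply: wint_ae => //; exact: H.
Qed.

Lemma cint_shift F x y h : cbm F ->
  cint (fun v => F (v + h)) x y = cint F (x + h) (y + h).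
Proof.
by move=> [F1 F2]; rewrite /cint -(wint_shift _ _ _ F1) -(wint_shift _ _ _ F2).
Qed.

(** Rotating so that the integral becomes real reduces the claim to the real
    case. *)
Lemma cint_le_ae F (w : R -> R) x y : cbm F -> bmeas w ->
  {ae mu, forall v, x < v < y -> nm (F v) <= w v} -> nm (cint F x y) <= wint w x y.
Proof.
move=> [F1 F2] bw [N [mN N0 sN]]; set I := cint F x y.
have w0 : 0 <= wint w x y.
  rewrite -(mul0r (wint w x y)) -wintZ //; apply: wint_le_ae => //; first exact: bmeasZ.
  exists N; split=> // v nv; apply: sN => /= h; apply: nv => /h /= Fw.
  by rewrite mul0r; apply: le_trans Fw; exact: nm_ge0.
have [->//|I0] := eqVneq (nm I) 0.
have Ip : 0 < nm I by rewrite lt_neqAle eq_sym I0 nm_ge0.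
rewrite -(ler_pM2l Ip) -expr2 sqr_nm.
pose a := Re I; pose b := Im I.
have -> : Re I ^+ 2 + Im I ^+ 2 =
    wint (fun v => a * (Re \o F) v + b * (Im \o F) v) x y.
  by rewrite wintD ?wintZ //; exact: bmeasZ.
rewrite -wintZ //; apply: wint_le_ae; [|exact: bmeasZ|].
  by apply: bmeasD; exact: bmeasZ.
exists N; split=> // w' nw; apply: sN => /= h; apply: nw => /h {h} /=.
move: w' => v Fv; apply: le_trans (_ : nm I * nm (F v) <= _); last first.
  by rewrite ler_pM2l.
have Fge := nm_ge0 (F v).
apply: (@le_trans _ _ `|a * Re (F v) + b * Im (F v)|); first exact: ler_norm.
rewrite -[leRHS]ger0_norm ?mulr_ge0 ?nm_ge0 // -ler_sqr ?nnegrE ?normr_ge0 //.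
rewrite !real_normK ?num_real // exprMn !sqr_nm -/a -/b.
have := sqr_ge0 (a * Im (F v) - b * Re (F v)); lra.
Qed.

Lemma cint_le F (w : R -> R) x y : cbm F -> bmeas w ->
  (forall v, x <= v <= y -> nm (F v) <= w v) -> nm (cint F x y) <= wint w x y.
Proof.
move=> bF bw Fw; apply: cint_le_ae => //.
by apply: aeW => v /andP[v1 v2]; apply: Fw; rewrite !ltW.
Qed.

Lemma cint_bound F x y : cbm F -> x <= y -> (forall v, nm (F v) <= 1) ->
  nm (cint F x y) <= y - x.
Proof.
move=> bF xy F1; apply: le_trans (cint_le bF (bmeas_cst 1) (fun v _ => F1 v)) _.
by rewrite wint_cst // mul1r.
Qed.

Definition cwin F l x := cint F x (x + l).

Lemma cwinE F l x : cwin F l x = (win (Re \o F) l x +i* win (Im \o F) l x)%C.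
Proof. by []. Qed.

Lemma cwin_lip F l x y : cbm F -> 0 <= l -> (forall v, nm (F v) <= 1) ->
  nm (cwin F l x - cwin F l y) <= 2 * `|x - y|.
Proof.
move=> bF l0 F1; wlog xy : x y / x <= y.
  move=> H; case/orP: (le_total x y) => [/H//|/H].
  by rewrite nm_distC [`|y - x|]distrC.
rewrite distrC ger0_norm ?subr_ge0 //.
have e1 : cwin F l x + cint F (x + l) (y + l) = cint F x y + cwin F l y.
  by rewrite /cwin -cint_chasles ?lerDl ?lerD2r // -cint_chasles // lerDl.
have -> : cwin F l x - cwin F l y = cint F x y - cint F (x + l) (y + l).
  by apply/eqP; rewrite subr_eq addrAC -e1 addrK.
apply: le_trans (nmB _ _) _; rewrite mulr2n mulrDl mul1r; apply: lerD.
  exact: cint_bound.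
apply: le_trans (cint_bound bF _ F1) _; first by rewrite lerD2r.
by rewrite opprD addrACA subrr addr0.
Qed.

Lemma nm_cwin_le F l x : cbm F -> 0 <= l -> (forall v, nm (F v) <= 1) ->
  nm (cwin F l x) <= l.
Proof.
move=> bF l0 F1; apply: le_trans (cint_bound bF _ F1) _; first by rewrite lerDl.
by rewrite addrC addKr.
Qed.

Definition cgap F l (d : nat) : R :=
  pint (fun x => nm (cwin F l (x + d%:R * l) - cwin F l x) ^+ 2).

Lemma bmeas_nm_cwinB F l h : cbm F -> 0 <= l ->
  bmeas (fun x => nm (cwin F l (x + h) - cwin F l x) ^+ 2).
Proof.
have H g : bmeas g -> 0 <= l -> bmeas (fun x => (win g l (x + h) - win g l x) ^+ 2).
  move=> bg l0; have bw := bmeas_win bg l0.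
  exact: bmeas_sqr (bmeasB (bmeas_shift h bw) bw).
move=> [F1 F2] l0; have := bmeasD (H _ F1 l0) (H _ F2 l0).
by congr bmeas; apply/funext => x; rewrite sqr_nm.
Qed.

Lemma cgapE F l d : cbm F -> 0 <= l ->
  cgap F l d = shift_gap (Re \o F) l d + shift_gap (Im \o F) l d.
Proof.
move=> [F1 F2] l0; rewrite /cgap /shift_gap -pintD.
- by congr pint; apply/funext => x; rewrite sqr_nm.
- have bw := bmeas_win F1 l0; exact: bmeas_sqr (bmeasB (bmeas_shift _ bw) bw).
- have bw := bmeas_win F2 l0; exact: bmeas_sqr (bmeasB (bmeas_shift _ bw) bw).
Qed.

Lemma cgap_ge0 F l d : 0 <= cgap F l d.
Proof. by apply: pint_ge0 => x; exact: sqr_ge0. Qed.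

(** For unimodular [F] this vanishes when [F] is constant on the window. *)
Definition deficit F l x : R := 1 - nm (cwin F l x) ^+ 2 / l ^+ 2.

Lemma bmeas_nm_cwin F l : cbm F -> 0 <= l -> bmeas (fun x => nm (cwin F l x) ^+ 2).
Proof.
move=> [F1 F2] l0.
have := bmeasD (bmeas_sqr (bmeas_win F1 l0)) (bmeas_sqr (bmeas_win F2 l0)).
by congr bmeas; apply/funext => x; rewrite sqr_nm.
Qed.

Lemma bmeas_deficit F l : cbm F -> 0 <= l -> bmeas (deficit F l).
Proof.
move=> bF l0; apply: bmeasB; first exact: bmeas_cst.
by apply: bmeasM; [exact: bmeas_nm_cwin|exact: bmeas_cst].
Qed.

Lemma periodic1_cwin F l : cbm F -> periodic1 F -> periodic1 (cwin F l).
Proof.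
move=> [F1 F2] pF x; rewrite !cwinE.
by congr (_ +i* _)%C; rewrite periodic1_win // => v /=; rewrite pF.
Qed.

Lemma deficit_ge0 F l x : cbm F -> 0 < l -> (forall v, nm (F v) <= 1) ->
  0 <= deficit F l x.
Proof.
move=> bF l0 F1; rewrite subr_ge0 ler_pdivrMr ?exprn_gt0 // mul1r.
by rewrite lerXn2r ?nnegrE ?nm_ge0 ?(ltW l0) // nm_cwin_le // ltW.
Qed.

End complex_windows.
(** * Most windows are nearly constant *)

Section differentiation.
Variable R : realType.
Implicit Types (f g : R -> R) (F : R -> R[i]) (x y l : R).
Local Notation Re := (@complex.Re R).
Local Notation Im := (@complex.Im R).
Notation mu := (@lebesgue_measure R).

Lemma pint_cvg (f_ : nat -> R -> R) f (M : R) :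
  (forall n, bmeas (f_ n)) -> bmeas f ->
  {ae mu, forall x, f_ n x @[n --> \oo] --> f x} ->
  (forall n x, `|f_ n x| <= M) -> pint (f_ n) @[n --> \oo] --> pint f.
Proof.
move=> bf_ bf [N [mN N0 sN]] hM.
have m01 : measurable (`[0, 1] : set (measurableTypeR R)) by exact: measurable_itv.
have [] := @dominated_convergence _ (measurableTypeR R) R mu `[0, 1]%classic m01
  (fun n x => (f_ n x)%:E) (fun x => (f x)%:E) (fun=> M%:E).
- by move=> n; apply/measurable_EFinP; apply: measurable_funTS; case: (bf_ n).
- by apply/measurable_EFinP; apply: measurable_funTS; case: bf.
- exists N; split=> // x nx; apply: sN => /= h; apply: nx => _.
  by apply: cvg_comp h _; exact: cvg_id.
- exact: (bmeas_int 0 1 (bmeas_cst M)).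
- by apply: aeW => x n _ /=; rewrite lee_fin.
move=> _ _ /= h; rewrite /pint /wint /Rintegral.
apply: (@fine_cvg R nat \oo _ _ (fine (\int[mu]_(x in `[0%R, 1%R]) (f x)%:E))).
rewrite fineK //; apply: integrable_fin_num => //; exact: (bmeas_int 0 1 bf).
Qed.

Lemma win_cvg g (l_ : nat -> R) : bmeas g -> (forall n, 0 < l_ n) ->
  l_ n @[n --> \oo] --> 0 ->
  {ae mu, forall x, (win g (l_ n) x / l_ n) @[n --> \oo] --> g x}.
Proof.
move=> bg l0 lc.
pose E (x : R) n : set R := `[x, x + l_ n]%classic.
have muE x n : mu (E x n) = (l_ n)%:E.
  rewrite /E lebesgue_measure_itv /= lte_fin ltrDl l0.
  by rewrite -EFinB addrAC subrr add0r.
have hE x : nicely_shrinking x (E x).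
  split; first by move=> n; exact: measurable_itv.
  have l2 n : 0 < 2 * l_ n by rewrite mulr_gt0.
  exists (4, fun n => PosNum (l2 n)); split => //=.
  - by rewrite -(mulr0 2); apply: cvgM => //; exact: cvg_cst.
  - move=> n y; rewrite /E /ball /= in_itv /= => /andP[h1 h2].
    rewrite distrC ger0_norm ?subr_ge0 //; have := l0 n; lra.
  - move=> n; rewrite muE lebesgue_measure_ball /=; last exact/ltW/l2.
    by rewrite lee_fin -mulr_natl; lra.
have lg : locally_integrable setT g.
  split; [by case: bg|exact: openT|move=> K _ cK].
  have [mg [M hM]] := bg.
  have mK := compact_measurable cK.
  have : mu.-integrable K (EFin \o g).
    apply: measurable_bounded_integrable => //.
    - exact: compact_finite_measure.
    - exact: measurable_funTS.
    - exists M; split; first by rewrite num_real.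
      by move=> N MN z _; apply: le_trans (hM z) _; exact: ltW.
  by move=> /integrableP[].
have [N [mN N0 sN]] := lebesgue_differentiation lg.
exists N; split=> // x nx; apply: sN => /= h; apply: nx.
have := nice_lebesgue_differentiation hE lg h.
move=> /fine_cvg /=; apply: cvg_trans; apply: near_eq_cvg; near=> n.
rewrite /= muE inver gt_eqF // /win /wint /Rintegral /E.
rewrite [in RHS]mulrC fineM //.
by apply: integrable_fin_num => //; exact: (bmeas_int x (x + l_ n) bg).
Unshelve. all: by end_near. Qed.

(** Lebesgue differentiation and bounded convergence. *)
Lemma deficit_small F eps : cbm F -> (forall v, nm (F v) = 1) -> 0 < eps ->
  exists2 l0, 0 < l0 & forall l, 0 < l <= l0 -> pint (deficit F l) <= eps.
Proof.
move=> bF F1 e0; apply: contrapT => H.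
have {}H (n : nat) : exists l, [/\ 0 < l, l <= n.+1%:R^-1 & eps < pint (deficit F l)].
  apply: contrapT => H'; apply: H; exists n.+1%:R^-1; first by rewrite invr_gt0.
  move=> l /andP[l0 l1]; rewrite leNgt; apply/negP => h; apply: H'.
  by exists l; split.
have [l_ hl] := choice H.
have l0 n : 0 < l_ n by case: (hl n).
have lc : l_ n @[n --> \oo] --> 0.
  apply: (squeeze_cvgr _ (cvg_cst 0) cvg_harmonic).
  by near=> n; apply/andP; split; [exact: ltW|case: (hl n)].
have [bR bI] := bF.
have F1' v : nm (F v) <= 1 by rewrite F1.
have cR := win_cvg bR l0 lc; have cI := win_cvg bI l0 lc.
have cD : {ae mu, forall x, deficit F (l_ n) x @[n --> \oo] --> 0}.
  move: cR cI => [N [mN N0 sN]] [M [mM M0 sM]].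
  exists (N `|` M); split; first exact: measurableU.
    by rewrite measureU0.
  move=> x nx; apply: contrapT => /not_orP[nN nM]; apply: nx => /=.
  have h1 : (win (Re \o F) (l_ n) x / l_ n) @[n --> \oo] --> Re (F x).
    by apply: contrapT => h; apply: nN; exact: sN.
  have h2 : (win (Im \o F) (l_ n) x / l_ n) @[n --> \oo] --> Im (F x).
    by apply: contrapT => h; apply: nM; exact: sM.
  have -> : (fun n => deficit F (l_ n) x) = (fun n => 1 -
     ((win (Re \o F) (l_ n) x / l_ n) * (win (Re \o F) (l_ n) x / l_ n) +
      (win (Im \o F) (l_ n) x / l_ n) * (win (Im \o F) (l_ n) x / l_ n))).
    apply/funext => n; rewrite /deficit sqr_nm cwinE /=.
    by field; rewrite gt_eqF.
  have <- : 1 - (Re (F x) * Re (F x) + Im (F x) * Im (F x)) = 0.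
    by rewrite -!expr2 -sqr_nm F1 expr1n subrr.
  by apply: cvgB; [exact: cvg_cst|apply: cvgD; apply: cvgM].
have := @pint_cvg (fun n => deficit F (l_ n)) (fun=> 0) 1
  (fun n => bmeas_deficit bF (ltW (l0 n))) (bmeas_cst 0) cD.
have bnd n x : `|deficit F (l_ n) x| <= 1.
  rewrite ger0_norm ?deficit_ge0 // gerBl divr_ge0 ?sqr_ge0 //.
move=> /(_ bnd); rewrite pint_cst => /cvgrPdist_lt /(_ _ e0) [N _ hN].
have := hN N (leqnn N); have [_ _] := hl N.
rewrite sub0r normrN => h1 h2; have := ler_norm (pint (deficit F (l_ N))); lra.
Unshelve. all: by end_near. Qed.

Lemma bmeas_indic (A : set R) : measurable A -> bmeas (\1_A : R -> R).
Proof.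
move=> mA; split; first exact: measurable_indic.
by exists 1 => x; rewrite indicE; case: (_ \in _); rewrite ?normr1 ?normr0.
Qed.

Definition frac x : R := x - (Num.floor x)%:~R.

Lemma frac_itv x : 0 <= frac x < 1.
Proof. have := floor_itv x; rewrite intrD /frac; lra. Qed.

Lemma frac_int x (k : int) : frac (x + k%:~R) = frac x.
Proof. by rewrite /frac floorDrz ?intr_int // intrKfloor intrD; ring. Qed.

Lemma frac_id x : 0 <= x < 1 -> frac x = x.
Proof.
by move=> h; rewrite /frac (floor_def (m := 0)) ?add0r // subr0.
Qed.

Lemma periodic1_frac : periodic1 frac.
Proof. by move=> x; exact: (frac_int x 1). Qed.

Lemma bmeas_frac : bmeas frac.
Proof.
split; first by apply: measurable_funB; [exact: measurable_id|exact: measurable_fun_floor].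
exists 1 => x; have /andP[h1 h2] := frac_itv x.
by rewrite ger0_norm //; exact: ltW.
Qed.

(** Translates of an interval by points that are separated modulo 1 occupy
    disjoint parts of the circle. *)
Lemma packing g (xs : nat -> R) (m : nat) (r : R) : bmeas g -> periodic1 g ->
  (forall x, 0 <= g x) -> 0 <= r -> r < 1 ->
  (forall i j (z : int), (i < j < m)%N -> r < `|xs i - xs j - z%:~R|) ->
  \sum_(i < m) wint g (xs i) (xs i + r) <= pint g.
Proof.
move=> bg pg g0 r0 r1 sep.
pose A := [set x | frac x <= r].
have mA : measurable A.
  have := bmeas_frac.1 measurableT _ (measurable_itv `]-oo, r]).
  by congr measurable; apply/seteqP; split=> x; rewrite /A /= in_itv /=; [case|split].
pose w : R -> R := \1_A.
have bw : bmeas w by exact: bmeas_indic.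
have w01 x : w x = 1 \/ w x = 0.
  by rewrite /w indicE; case: (_ \in _); [left|right].
have w0 x : 0 <= w x by case: (w01 x) => ->.
have pw : periodic1 w.
  move=> x; rewrite /w !indicE; congr (_%:R); congr nat_of_bool.
  by apply/idP/idP; rewrite !inE /A /= periodic1_frac.
have wA x : w x = 1 -> frac x <= r.
  rewrite /w indicE; case: (boolP (_ \in _)) => [|_ /esym/eqP].
    by rewrite inE.
  by rewrite oner_eq0.
have step i : wint g (xs i) (xs i + r) <= pint (fun x => g x * w (x - xs i)).
  have bgw : bmeas (fun x => g x * w (x - xs i)).
    by apply: bmeasM => //; exact: bmeas_shift.
  rewrite -(pint_shift (xs i) bgw); last first.
    by move=> x; rewrite pg addrAC pw.
  rewrite /pint (@wint_chasles _ _ 0 r 1) ?(ltW r1) //; last first.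
    by exact: (bmeas_shift (xs i) bgw).
  rewrite ler_wpDr //.
    by apply: wint_ge0 => v _; rewrite mulr_ge0.
  have -> : wint g (xs i) (xs i + r) = wint (fun v => g (v + xs i)) 0 r.
    by rewrite wint_shift // add0r addrC.
  rewrite le_eqVlt; apply/orP; left; apply/eqP; apply: eq_wint => v /andP[v0 vr].
  rewrite addrK /w indicE mem_set ?mulr1 //.
  by rewrite /A /= frac_id // v0 (le_lt_trans vr).
have cnt n x : (n <= m)%N -> \sum_(i < n) w (x - xs i) <= 1.
  elim: n => [|n IH] nm; first by rewrite big_ord0.
  rewrite big_ord_recr /=; case: (w01 (x - xs n)) => e; last first.
    by rewrite e addr0; apply: IH; exact: ltnW.
  rewrite big1 ?add0r ?e // => i _; case: (w01 (x - xs i)) => // ei.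
  have := sep i n (Num.floor (x - xs n) - Num.floor (x - xs i)).
  rewrite ltn_ord nm => /(_ isT).
  have /andP[h1 _] := frac_itv (x - xs n); have /andP[h2 _] := frac_itv (x - xs i).
  have h3 := wA _ e; have h4 := wA _ ei.
  have -> : xs i - xs n - (Num.floor (x - xs n) - Num.floor (x - xs i))%:~R =
    frac (x - xs n) - frac (x - xs i) by rewrite intrB /frac; ring.
  by rewrite ltNge ler_norml; case/negP; apply/andP; split; lra.
apply: (@le_trans _ _ (\sum_(i < m) pint (fun x => g x * w (x - xs i)))).
  by apply: ler_sum => i _; exact: step.
have bgw i : bmeas (fun x => g x * w (x - xs i)).
  by apply: bmeasM => //; exact: bmeas_shift.
rewrite -(pint_sum _ (F := fun (i : 'I_m) x => g x * w (x - xs i))) //.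
apply: pint_le => //; first by apply: bmeas_sum.
by move=> x; rewrite -mulr_sumr ler_piMr // cnt.
Qed.

End differentiation.
(** * The cocycle and its windows *)

Section window_tools.
Variable R : realType.
Implicit Types (F : R -> R[i]) (x y l w : R).
Notation mu := (@lebesgue_measure R).

Lemma cint_ae_open F G x y : cbm F -> cbm G ->
  {ae mu, forall v, x < v < y -> F v = G v} -> cint F x y = cint G x y.
Proof.
by move=> bF bG H; apply: cint_ae => //; exact: ae_itv_closed.
Qed.

(** A function that differs from its translate by a constant factor on a window
    has proportional window integrals. *)
Lemma cint_transport F x y h (z : R[i]) : cbm F ->
  {ae mu, forall v, x < v < y -> F (v + h) = z * F v} ->
  cint F (x + h) (y + h) = z * cint F x y.
Proof.
move=> bF H; rewrite -cint_shift // -cintZ //.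
by apply: cint_ae_open => //; [exact: cbm_shift|exact: cbmM (cbm_cst z) bF].
Qed.

Lemma floor_near (a x w : R) : (forall z : int, w < `|a - z%:~R|) -> `|x - a| <= w ->
  Num.floor x = Num.floor a.
Proof.
move=> H; rewrite ler_norml => /andP[h1 h2]; apply: floor_def.
have /andP[f1 f2] := floor_itv a; rewrite intrD in f2.
have := H (Num.floor a); rewrite ger0_norm ?subr_ge0 // => h3.
have := H (Num.floor a + 1); rewrite intrD -normrN ger0_norm; last lra.
move=> h4; apply/andP; split; lra.
Qed.

(** By the parallelogram identity, [X + Y] and [X + chi * Y] cannot both be almost
    as large as possible. *)
Lemma parallelogram (X Y chi : R[i]) w k : 0 < w ->
  nm X <= w -> nm Y <= w -> nm chi = 1 ->
  k = nm (chi - 1) ^+ 2 / 256 -> 0 < k ->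
  (1 - k) * (2 * w) <= nm (X + Y) -> (1 - k) * (2 * w) <= nm (X + chi * Y) -> False.
Proof.
move=> w0 Xw Yw c1 ek k0 h1 h2.
have ck : nm (chi - 1) <= 2 by apply: le_trans (nmB _ _) _; rewrite c1 nm1; lra.
have k1 : k <= 64^-1.
  rewrite ek; have := nm_ge0 (chi - 1); nra.
have para (a b : R[i]) : nm (a - b) ^+ 2 = 2 * nm a ^+ 2 + 2 * nm b ^+ 2 - nm (a + b) ^+ 2.
  by rewrite !sqr_nm; case: a => a1 a2; case: b => b1 b2 /=; ring.
have sq (a b : R) : 0 <= a -> a <= b -> a ^+ 2 <= b ^+ 2.
  by move=> a0 ab; rewrite lerXn2r ?nnegrE // (le_trans a0 ab).
have X2 := sq _ _ (nm_ge0 X) Xw; have Y2 := sq _ _ (nm_ge0 Y) Yw.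
have p0 : 0 <= (1 - k) * (2 * w) by rewrite mulr_ge0 //; lra.
have s1 := sq _ _ p0 h1; have s2 := sq _ _ p0 h2.
have d1 : nm (X - Y) ^+ 2 <= 8 * k * w ^+ 2 by rewrite para; nra.
have d2 : nm (X - chi * Y) ^+ 2 <= 8 * k * w ^+ 2 by rewrite para nmM c1 mul1r; nra.
have d3 : nm ((chi - 1) * Y) ^+ 2 <= 2 * (nm (X - Y) ^+ 2 + nm (X - chi * Y) ^+ 2).
  have -> : (chi - 1) * Y = (X - Y) - (X - chi * Y) by ring.
  rewrite para; have := sqr_ge0 (nm (X - Y + (X - chi * Y))); lra.
have Yge : (1 - 2 * k) * w <= nm Y by have := nmD X Y; nra.
have Y3 : ((1 - 2 * k) * w) ^+ 2 <= nm Y ^+ 2 by apply: sq => //; rewrite mulr_ge0 //; lra.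
rewrite nmM exprMn in d3.
have e2 : nm (chi - 1) ^+ 2 = 256 * k by rewrite ek; field.
rewrite e2 in d3.
have w2 : 0 < w ^+ 2 by rewrite exprn_gt0.
have : 256 * k * ((1 - 2 * k) * w) ^+ 2 <= 32 * k * w ^+ 2.
  apply: le_trans (_ : _ <= 256 * k * nm Y ^+ 2) _; last lra.
  by rewrite ler_wpM2l //; lra.
have -> : 256 * k * ((1 - 2 * k) * w) ^+ 2 = k * w ^+ 2 * (256 * (1 - 2 * k) ^+ 2) by ring.
have -> : 32 * k * w ^+ 2 = k * w ^+ 2 * 32 by ring.
rewrite ler_pM2l ?mulr_gt0 //; nra.
Qed.

Section bad_windows.
Variable F : R -> R[i].
Hypotheses (bF : cbm F) (pF : periodic1 F) (F1 : forall v, nm (F v) = 1).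

Let F1' v : nm (F v) <= 1. Proof. by rewrite F1. Qed.

Lemma periodic1_deficit l : periodic1 (deficit F l).
Proof. by move=> x; rewrite /deficit periodic1_cwin. Qed.

(** The window integral is Lipschitz, so a bad window spoils its neighbours. *)
Lemma deficit_bad l k x0 : 0 < l -> 0 < k -> k <= 1 ->
  nm (cwin F l x0) < (1 - k) * l ->
  k ^+ 2 * l / 8 <= wint (deficit F l) x0 (x0 + k * l / 4).
Proof.
move=> l0 k0 k1 bad.
have kl : 0 <= k * l / 4 by rewrite divr_ge0 // mulr_ge0 // ltW.
have -> : k ^+ 2 * l / 8 = wint (fun=> k / 2) x0 (x0 + k * l / 4).
  by rewrite wint_cst ?lerDl //; field.
apply: wint_le; [exact: bmeas_cst|by apply: bmeas_deficit => //; exact: ltW|].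
move=> v /andP[v0 v1].
have h := cwin_lip v x0 bF (ltW l0) F1'.
rewrite ger0_norm ?subr_ge0 // in h.
have := nmD (cwin F l v - cwin F l x0) (cwin F l x0); rewrite subrK => h2.
have h3 : nm (cwin F l v) <= (1 - k / 2) * l by lra.
have h4 : nm (cwin F l v) ^+ 2 <= ((1 - k / 2) * l) ^+ 2.
  rewrite lerXn2r ?nnegrE ?nm_ge0 //; apply: le_trans h3; exact: nm_ge0.
have l2 : 0 < l ^+ 2 by rewrite exprn_gt0.
rewrite /deficit lerBrDr -lerBrDl ler_pdivrMr //.
apply: le_trans h4 _; rewrite exprMn ler_pM2r //; nra.
Qed.

(** Each bad window carries a fixed amount of deficit, and the intervals that
    support these amounts are disjoint by [packing]. *)
Lemma few_bad l k (xs : nat -> R) (m : nat) : 0 < l -> 0 < k -> k <= 1 ->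
  l <= 1 ->
  (forall i j (z : int), (i < j < m)%N -> k * l / 4 < `|xs i - xs j - z%:~R|) ->
  (\sum_(i < m) (`[< nm (cwin F l (xs i)) < (1 - k) * l >] : bool)%:R)
     * (k ^+ 2 * l / 8) <= pint (deficit F l).
Proof.
move=> l0 k0 k1 l1 sep.
have kl0 : 0 <= k * l / 4 by rewrite divr_ge0 // mulr_ge0 // ltW.
have kl1 : k * l / 4 < 1 by nra.
have bD := bmeas_deficit bF (ltW l0).
have D0 x : 0 <= deficit F l x by apply: deficit_ge0.
apply: le_trans (packing bD (@periodic1_deficit l) D0 kl0 kl1 sep).
rewrite mulr_suml; apply: ler_sum => i _.
case: asboolP => [h|_]; rewrite ?mul1r ?mul0r; first exact: deficit_bad.
by apply: wint_ge0 => v _.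
Qed.

End bad_windows.
End window_tools.

Section cocycle.
Variables (R : realType) (alpha beta : R) (omega chi : R[i]) (f : R -> R[i]).
Hypothesis Ha : irrational01 alpha.
Hypotheses (omega1 : nm omega = 1) (chi1 : nm chi = 1) (chiN1 : chi != 1).
Hypotheses (bf : cbm f) (pf : periodic1 f) (f1 : forall v, nm (f v) = 1).
Notation mu := (@lebesgue_measure R).
Notation Q := (cfQ alpha).
Notation d := (cfd alpha).

(** For [beta] in [0, 1[ this is the indicator of [0, beta[ at [x] modulo 1, in a
    form that makes sense for every real [beta]. *)
Definition ccount (x : R) : int := Num.floor x - Num.floor (x - beta).

Hypothesis Hf : {ae mu, forall x, f (x + alpha) = omega * chi ^ (ccount x) * f x}.

Definition csum (m : nat) (x : R) : int := \sum_(i < m) ccount (x + i%:R * alpha).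

Lemma cocycle_iter m :
  {ae mu, forall x, f (x + m%:R * alpha) = omega ^+ m * chi ^ (csum m x) * f x}.
Proof.
have chi0 : chi != 0.
  by apply/eqP => c0; move: chi1; rewrite c0 nm0 => /esym/eqP; rewrite oner_eq0.
elim: m => [|m [N [mN N0 sN]]].
  by apply: aeW => x; rewrite mul0r addr0 /csum big_ord0 expr0z !mul1r.
have [M [mM M0 sM]] := ae_shift (m%:R * alpha) Hf.
exists (N `|` M); split; [exact: measurableU|by rewrite measureU0|].
move=> x nx; apply: contrapT => /not_orP[nN nM]; apply: nx => /=.
have h1 : f (x + m%:R * alpha) = omega ^+ m * chi ^ csum m x * f x.
  by apply: contrapT => h; apply: nN; exact: sN.
have h2 : f (x + m%:R * alpha + alpha) =
    omega * chi ^ ccount (x + m%:R * alpha) * f (x + m%:R * alpha).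
  by apply: contrapT => h; apply: nM; exact: sM.
have -> : x + m.+1%:R * alpha = x + m%:R * alpha + alpha.
  by rewrite -(natr1 m) mulrDl mul1r addrA.
have -> : csum m.+1 x = csum m x + ccount (x + m%:R * alpha).
  by rewrite /csum big_ord_recr.
rewrite h2 h1; move: (csum m x) (ccount _) => k k'; rewrite expfzDr // exprS.
by move: (chi ^ k) (chi ^ k') (omega ^+ m) (f x) => A B C D; ring.
Qed.

Lemma nm_chiX (k : int) : nm (chi ^ k) = 1.
Proof.
case: k => n; first by rewrite -exprnP nmX chi1 expr1n.
by rewrite NegzE -exprnN nmV // nmX chi1 expr1n.
Qed.

Lemma nm_multiplier m (k : int) : nm (omega ^+ m * chi ^ k) = 1.
Proof. by rewrite nmM nm_chiX nmX omega1 expr1n mulr1. Qed.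

Let kap : R := nm (chi - 1) ^+ 2 / 256.

Let kap_gt0 : 0 < kap.
Proof.
rewrite divr_gt0 // exprn_gt0 // lt_neqAle nm_ge0 andbT eq_sym.
by apply: contra chiN1 => /eqP/nm_eq0/eqP; rewrite subr_eq0.
Qed.

Let kap_le1 : kap <= 1.
Proof.
have : nm (chi - 1) <= 2 by apply: le_trans (nmB _ _) _; rewrite chi1 nm1; lra.
rewrite /kap; have := nm_ge0 (chi - 1); nra.
Qed.

(** The jump of the Birkhoff sum at [- i * alpha] lies within [w] of the jump at
    [beta - i' * alpha]. *)
Definition paired (m i : nat) (w : R) : Prop :=
  exists i' : nat, (i' < m)%N /\
    exists z : int, `|beta + (i%:Z - i'%:Z)%:~R * alpha - z%:~R| <= w.

(** Over a window centred at a discontinuity that no other one comes close to,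
    the Birkhoff sum takes two consecutive values. *)
Lemma unpaired_bad n m i w : m%:Z <= Q n.+2 -> (i < m)%N -> 0 < w -> w < d n.+1 ->
  ~ paired m i w ->
  nm (cwin f (2 * w) (- (i%:R * alpha) - w)) < (1 - kap) * (2 * w) \/
  nm (cwin f (2 * w) (m%:R * alpha - i%:R * alpha - w)) < (1 - kap) * (2 * w).
Proof.
move=> mQ im w0 wd unp.
have w1 : w < 1 by apply: lt_le_trans wd _; exact: (cfd_le Ha (leq0n n.+1)).
pose c := - (i%:R * alpha).
have [K hK] : exists K : int, forall x, `|x - c| < w ->
    csum m x = K + Num.floor (x - c).
  exists (\sum_(i' < m) (if i' == i :> nat then - Num.floor (i'%:R * alpha + c - beta)
       else Num.floor (i'%:R * alpha + c) - Num.floor (i'%:R * alpha + c - beta))).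
  move=> x xc; have ltw : `|x - c| <= w by exact: ltW.
  rewrite /csum (bigD1 (Ordinal im)) //= [in RHS](bigD1 (Ordinal im)) //= eqxx.
  have hb (j : 'I_m) : Num.floor (x + j%:R * alpha - beta) =
      Num.floor (j%:R * alpha + c - beta).
    apply: (@floor_near _ _ _ w); last first.
      by rewrite (_ : _ - _ - _ = x - c) //; ring.
    move=> z; rewrite ltNge; apply/negP => h; apply: unp.
    exists j; split; first exact: ltn_ord.
    exists (- z); rewrite -normrN.
    rewrite (_ : - _ = j%:R * alpha + c - beta - z%:~R) //.
    by rewrite /c intrB mulrNz -!pmulrn; ring.
  have hbi := hb (Ordinal im); rewrite /= in hbi; rewrite /ccount hbi.
  have -> : Num.floor (x + i%:R * alpha) = Num.floor (x - c).
    by congr Num.floor; rewrite /c; ring.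
  set f1' := Num.floor (x - c); set f2 := Num.floor (i%:R * alpha + c - beta).
  rewrite [RHS]addrAC [f1' - f2]addrC; congr (_ + _).
  apply: eq_bigr => j ji; have ji' : (j != i :> nat) by [].
  rewrite (negbTE ji') hb; congr (_ - _).
  apply: (@floor_near _ _ _ w); last first.
    by rewrite (_ : _ - _ = x - c) //; ring.
  move=> z; apply: lt_le_trans wd _; rewrite /c.
  have hj := ltn_ord j; apply: (cf_sep Ha); first exact: ji'.
    by move: mQ hj; clear; lia.
  by have im' := im; move: mQ im'; clear; lia.
have fl0 x : x < c -> `|x - c| < w -> Num.floor (x - c) = -1.
  rewrite ltr_norml => xc /andP[h1 h2]; apply: floor_def.
  by rewrite mulrNz addrC subrr mulr0z; apply/andP; split; lra.
have fl1 x : c < x -> `|x - c| < w -> Num.floor (x - c) = 0.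
  rewrite ltr_norml => xc /andP[h1 h2]; apply: floor_def.
  by rewrite add0r mulr0z mulr1z; apply/andP; split; lra.
pose h := m%:R * alpha.
pose X := cint f (c - w) c; pose Y := cint f c (c + w).
have [N [mN N0 sN]] := cocycle_iter m.
have eX : cint f (c - w + h) (c + h) = omega ^+ m * chi ^ (K - 1) * X.
  apply: cint_transport => //; exists N; split=> // v nv; apply: sN => /= e.
  apply: nv => /= /andP[v1 v2].
  have vc : `|v - c| < w by rewrite ltr_norml; apply/andP; split; lra.
  by rewrite /h e hK // fl0.
have eY : cint f (c + h) (c + w + h) = omega ^+ m * chi ^ K * Y.
  apply: cint_transport => //; exists N; split=> // v nv; apply: sN => /= e.
  apply: nv => /= /andP[v1 v2].
  have vc : `|v - c| < w by rewrite ltr_norml; apply/andP; split; lra.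
  by rewrite /h e hK // fl1 // addr0.
have e1 : cwin f (2 * w) (c - w) = X + Y.
  rewrite /cwin (_ : c - w + 2 * w = c + w); last by ring.
  by rewrite (@cint_chasles _ _ _ c) //; lra.
have chi0 : chi != 0.
  by apply/eqP => c0; move: chi1; rewrite c0 nm0 => /esym/eqP; rewrite oner_eq0.
have e2 : cwin f (2 * w) (m%:R * alpha - i%:R * alpha - w) =
    omega ^+ m * chi ^ (K - 1) * (X + chi * Y).
  rewrite mulrDr -eX.
  have -> : omega ^+ m * chi ^ (K - 1) * (chi * Y) = omega ^+ m * chi ^ K * Y.
    have -> : chi ^ K = chi ^ (K - 1) * chi by rewrite -{1}(subrK 1 K) expfzDr // expr1z.
    by ring.
  rewrite -eY /cwin (_ : m%:R * alpha - i%:R * alpha - w = c - w + h); last first.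
    by rewrite /c /h; ring.
  rewrite (_ : _ + 2 * w = c + w + h); last by ring.
  by rewrite (@cint_chasles _ _ _ (c + h)) //; lra.
have bX : nm X <= w.
  have -> : w = c - (c - w) by ring.
  by apply: cint_bound => //; [lra|move=> v; rewrite f1].
have bY : nm Y <= w.
  have -> : w = c + w - c by ring.
  by apply: cint_bound => //; [lra|move=> v; rewrite f1].
rewrite e1 e2 nmM nm_multiplier mul1r.
case: (ltP (nm (X + Y)) ((1 - kap) * (2 * w))) => [|g1]; first by left.
case: (ltP (nm (X + chi * Y)) ((1 - kap) * (2 * w))) => [|g2]; first by right.
by case: (@parallelogram _ X Y chi w kap).
Qed.

(** When the windows are nearly constant at the scale [d n.+1], most
    discontinuities of the Birkhoff sum of length q/2 coming from 0 are close to
    one coming from [beta], with the same shift for all of them. *)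
Lemma approx_shift (c : R) : 0 < c -> c <= 4^-1 -> exists N : nat,
  forall n, (N <= n)%N -> exists j z : int,
    `|j|%:~R <= c * (Q n.+2)%:~R /\ `|beta - j%:~R * alpha - z%:~R| <= c * d n.+1.
Proof.
move=> c0 c1; pose eps := c ^+ 2 * kap ^+ 2 / 64.
have e0 : 0 < eps by rewrite divr_gt0 // mulr_gt0 // exprn_gt0.
have [l0 l00 hl0] := deficit_small bf f1 e0.
have [N0 hN0] : exists N0 : nat, forall n, (N0 <= n)%N -> d n.+1 <= l0.
  exists (Num.trunc l0^-1).+1 => n hn; apply: le_trans (cfd_le_inv Ha n) _.
  rewrite -[l0]invrK lef_pV2 ?posrE ?invr_gt0 //.
  by apply: ltW; apply: lt_trans (truncnS_gt _) _; rewrite ltr_nat ltnS.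
exists (N0 + 8)%N => n hn.
have dl0 := hN0 n (leq_trans (leq_addr _ _) hn).
have d0 := cfd_gt0 Ha n.+1.
pose w := c * d n.+1; have w0 : 0 < w by rewrite mulr_gt0.
have d1 : d n.+1 < 1 by apply: lt_le_trans (cfdS_lt Ha n) (cfd_le Ha (leq0n n)).
have wd : 2 * w < d n.+1.
  by rewrite /w mulrA -[ltRHS]mul1r ltr_pM2r //; lra.
pose q := `|Q n.+2|%N; have qE : q%:Z = Q n.+2.
  by rewrite /q gez0_abs // cfQ_ge0.
have qn : (n <= q)%N by have := cfQ_geid Ha n; rewrite -qE; clear; lia.
pose m := q./2.
have mq : (2 * m <= q)%N /\ (q <= 2 * m + 1)%N.
  by rewrite /m; have := odd_double_half q; clear; lia.
have m4 : (4 <= m)%N by move: mq qn hn; clear; lia.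
pose k := (Num.trunc (c * m%:R)).+1.
have cm0 : 0 <= c * m%:R by rewrite mulr_ge0 // ltW.
have /andP[k1 k2] := truncn_itv cm0; rewrite -/k in k2.
have m4r : 4 <= m%:R :> R by rewrite ler_nat.
have km : (k <= m)%N.
  rewrite -(ler_nat R) -(natr1 (Num.trunc _)); nra.
have md : 1 <= 6 * (m%:R * d n.+1).
  have := cfQd_ge Ha n.+1; have : (Q n.+2)%:~R <= 2 * m%:R + 1 :> R.
    by rewrite -qE -pmulrn -natrM natr1 ler_nat; move: mq; clear; lia.
  have m1 : 1 <= m%:R :> R by rewrite ler1n; move: m4; clear; lia.
  by move=> hq hd; nra.
have l2w : 0 < 2 * w <= l0 by rewrite mulr_gt0 //=; lra.
have hdef := hl0 _ l2w.
have block o : (o + k <= m)%N -> exists i, (i < k)%N /\ paired m (o + i) w.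
  move=> ok; apply: contrapT => H.
  have unp i : (i < k)%N -> ~ paired m (o + i) w by move=> ik p; apply: H; exists i.
  pose xs1 i : R := - ((o + i)%N%:R * alpha) - w.
  pose xs2 i : R := m%:R * alpha - (o + i)%N%:R * alpha - w.
  have sep i j (z : int) : (i < j < k)%N ->
      kap * (2 * w) / 4 < `|(o + j)%N%:R * alpha - (o + i)%N%:R * alpha - z%:~R|.
    move=> /andP[ij jk]; apply: (@lt_le_trans _ _ (d n.+1)).
      have := kap_le1; nra.
    by apply: (cf_sep Ha); rewrite -?qE; move: mq ij jk ok; clear; lia.
  have sep1 i j (z : int) : (i < j < k)%N ->
      kap * (2 * w) / 4 < `|xs1 i - xs1 j - z%:~R|.
    by move=> ijk; rewrite (_ : xs1 i - xs1 j = (o + j)%N%:R * alpha - (o + i)%N%:R * alpha);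
      [exact: sep|rewrite /xs1; ring].
  have sep2 i j (z : int) : (i < j < k)%N ->
      kap * (2 * w) / 4 < `|xs2 i - xs2 j - z%:~R|.
    by move=> ijk; rewrite (_ : xs2 i - xs2 j = (o + j)%N%:R * alpha - (o + i)%N%:R * alpha);
      [exact: sep|rewrite /xs2; ring].
  have w20 : 0 < 2 * w by lra.
  have w21 : 2 * w <= 1 by lra.
  have b1 := few_bad bf pf f1 w20 kap_gt0 kap_le1 w21 sep1.
  have b2 := few_bad bf pf f1 w20 kap_gt0 kap_le1 w21 sep2.
  have bk : k%:R <= \sum_(i < k) (`[< nm (cwin f (2 * w) (xs1 i)) < (1 - kap) * (2 * w) >] : bool)%:R
     + \sum_(i < k) (`[< nm (cwin f (2 * w) (xs2 i)) < (1 - kap) * (2 * w) >] : bool)%:R :> R.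
    rewrite -big_split /= -[k in leLHS]card_ord -sum1_card natr_sum.
    apply: ler_sum => i _; have ik := ltn_ord i.
    have mQ : m%:Z <= Q n.+2 by rewrite -qE; move: mq; clear; lia.
    have oim : (o + i < m)%N by move: ik ok; clear; lia.
    have wd' : w < d n.+1 by lra.
    have [h|h] := unpaired_bad mQ oim w0 wd' (unp _ ik).
      rewrite (_ : `[< nm (cwin f (2 * w) (xs1 i)) < (1 - kap) * (2 * w) >] = true).
        by rewrite lerDl ler0n.
      exact/asboolP.
    rewrite (_ : `[< nm (cwin f (2 * w) (xs2 i)) < (1 - kap) * (2 * w) >] = true).
      by rewrite lerDr ler0n.
    exact/asboolP.
  move: b1 b2 bk; set S1 := \sum_(i < k) _; set S2 := \sum_(i < k) _.
  move=> b1 b2 bk; clearbody S1 S2.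
  have kp := kap_gt0; have kp2 : 0 < kap ^+ 2 by rewrite exprn_gt0.
  have : k%:R * (kap ^+ 2 * (2 * w) / 8) <= 2 * eps.
    apply: le_trans (_ : (S1 + S2) * (kap ^+ 2 * (2 * w) / 8) <= _).
      rewrite ler_wpM2r // divr_ge0 // mulr_ge0 //; lra.
    by rewrite mulrDl; lra.
  apply/negP; rewrite -ltNge.
  apply: (@lt_le_trans _ _ (c * m%:R * (kap ^+ 2 * (2 * w) / 8))); last first.
    rewrite ler_wpM2r //; last exact: ltW.
    by rewrite divr_ge0 // mulr_ge0 //; lra.
  have -> : c * m%:R * (kap ^+ 2 * (2 * w) / 8) =
    (c ^+ 2 * kap ^+ 2) * (6 * (m%:R * d n.+1)) / 24 by rewrite /w; field.
  have : 0 < c ^+ 2 * kap ^+ 2 by rewrite mulr_gt0 // exprn_gt0.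
  rewrite /eps; set A := c ^+ 2 * kap ^+ 2; set B := 6 * _ in md *.
  by move=> A0; clearbody A B; nra.
have [i1 [i1k [i1' [i1m [z1 h1]]]]] := block 0%N km.
have ok2 : (m - k + k <= m)%N by move: km; clear; lia.
have [i2 [i2k [i2' [i2m [z2 h2]]]]] := block (m - k)%N ok2.
pose K1 : int := (0 + i1)%N%:Z - i1'%:Z; pose K2 : int := (m - k + i2)%N%:Z - i2'%:Z.
have K12 : K1 = K2.
  apply/eqP; rewrite -subr_eq0; apply: contraT => K0.
  have KQ : `|K1 - K2| < Q n.+2 by rewrite /K1 /K2 -qE; move: i1m i2m i1k i2k mq km; clear; lia.
  have := cf_best Ha (z1 - z2) K0 KQ.
  have -> : (K1 - K2)%:~R * alpha - (z1 - z2)%:~R =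
    (beta + K1%:~R * alpha - z1%:~R) - (beta + K2%:~R * alpha - z2%:~R).
    by rewrite !intrB; ring.
  move=> h; have := le_trans h (ler_normB _ _); rewrite -/w in h1 h2.
  move: h1 h2; rewrite -/K1 -/K2; lra.
exists (- K1), z1; split; last by rewrite mulrNz mulNr opprK.
have : `|- K1| <= (Num.trunc (c * m%:R))%:Z.
  have : K1 <= (Num.trunc (c * m%:R))%:Z by rewrite /K1; move: i1k; rewrite /k; clear; lia.
  have : - (Num.trunc (c * m%:R))%:Z <= K1 by rewrite K12 /K2; move: i2m i2k km; rewrite /k; clear; lia.
  by clear; lia.
rewrite -(ler_int R) => h; apply: le_trans h _; rewrite -pmulrn.
apply: le_trans k1 _; rewrite ler_wpM2l ?(ltW c0) // -qE -pmulrn ler_nat; move: mq; clear; lia.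
Qed.

End cocycle.
(** * Local analysis near the two discontinuities *)

Section local_estimates.
Variable R : realType.
Notation mu := (@lebesgue_measure R).

Lemma sqr_le_sum2 (a b c : R) : 0 <= c -> c <= a + b ->
  c ^+ 2 <= 2 * a ^+ 2 + 2 * b ^+ 2.
Proof.
move=> c0 cab; apply: (@le_trans _ _ ((a + b) ^+ 2)).
  by rewrite lerXn2r ?nnegrE // (le_trans c0).
have := sqr_ge0 (a - b); lra.
Qed.

Lemma wint_sub (g : R -> R) x y x' y' : bmeas g -> (forall v, 0 <= g v) ->
  x <= x' -> x' <= y' -> y' <= y -> wint g x' y' <= wint g x y.
Proof.
move=> bg g0 h1 h2 h3; rewrite (wint_chasles bg h1 (le_trans h2 h3)).
rewrite (wint_chasles bg h2 h3).
have p1 : 0 <= wint g x x' by apply: wint_ge0.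
have p2 : 0 <= wint g y' y by apply: wint_ge0.
by rewrite addrCA lerDl addr_ge0.
Qed.

Lemma wint_blocks (g : R -> R) u h r (b : nat) : bmeas g -> (forall v, 0 <= g v) ->
  0 <= r -> r <= h ->
  \sum_(i < b) wint g (u + i%:R * h) (u + i%:R * h + r) <= wint g u (u + b%:R * h).
Proof.
move=> bg g0 r0 rh; have h0 := le_trans r0 rh.
elim: b => [|b IH]; first by rewrite big_ord0; apply: wint_ge0.
rewrite big_ord_recr /=.
have e : u + b.+1%:R * h = u + b%:R * h + h by rewrite -(natr1 b) mulrDl mul1r addrA.
have ub : u <= u + b%:R * h by rewrite lerDl mulr_ge0.
have ub' : u + b%:R * h <= u + b%:R * h + h by rewrite lerDl.
rewrite e (wint_chasles bg ub ub'); apply: lerD => //.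
by apply: wint_sub => //; rewrite ?lerDl // lerD2l.
Qed.

Lemma bmeas_itv_indic (u u' : R) : bmeas (\1_(`[u, u'[) : R -> R).
Proof. by apply: bmeas_indic; exact: measurable_itv. Qed.

Lemma wint_itv_indic (u u' x y : R) : u <= u' ->
  wint (\1_(`[u, u'[) : R -> R) x y <= u' - u.
Proof.
move=> uu; rewrite /wint /Rintegral integral_indic //=.
have mle : (mu (`[u, u'[ `&` `[x, y]) <= (u' - u)%:E)%E.
  apply: (@le_trans _ _ (mu `[u, u'[)).
    by apply: le_measure; rewrite ?inE //; exact: measurableI.
  rewrite lebesgue_measure_itv /= lte_fin; case: ltP => h; rewrite ?lee_fin //.
  by rewrite subr_ge0.
rewrite -lee_fin fineK // ge0_fin_numE //; apply: le_lt_trans mle _; exact: ltry.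
Qed.

Variables (F : R -> R[i]) (dl l r : R) (zeta chi : R[i]) (K b : nat).
Hypotheses (bF : cbm F) (F1 : forall v, nm (F v) = 1).
Hypotheses (dl0 : 0 < dl) (lr : l <= r) (zeta1 : nm zeta = 1) (chi1 : nm chi = 1).
Hypothesis HF : {ae mu, forall v, l - 3 * K%:R * dl < v < l + 3 * K%:R * dl ->
  F (v + dl) = zeta * (if l <= v + dl < r then chi else 1) * F v}.

(** The number of steps [k < i] that land in the stretch. *)
Definition crossings i v : nat := \sum_(k < i) ((l <= v + k.+1%:R * dl < r)%R : nat).

Lemma local_iter i : {ae mu, forall v, l - 3 * K%:R * dl < v ->
  v + i%:R * dl < l + 3 * K%:R * dl ->
  F (v + i%:R * dl) = zeta ^+ i * chi ^+ crossings i v * F v}.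
Proof.
elim: i => [|i [N [mN N0 sN]]].
  by apply: aeW => v _ _; rewrite mul0r addr0 /crossings big_ord0 !expr0 !mul1r.
have [M [mM M0 sM]] := ae_shift (i%:R * dl) HF.
exists (N `|` M); split; [exact: measurableU|by rewrite measureU0|].
move=> v nv; apply: contrapT => /not_orP[nN nM]; apply: nv => /= lv vl.
have e : v + i.+1%:R * dl = v + i%:R * dl + dl.
  by rewrite -(natr1 i) mulrDl mul1r addrA.
have i0 : 0 <= i%:R * dl by rewrite mulr_ge0 // ltW.
have vl' : v + i%:R * dl < l + 3 * K%:R * dl by apply: lt_trans vl; rewrite e ltrDl.
have h1 : F (v + i%:R * dl) = zeta ^+ i * chi ^+ crossings i v * F v.
  by apply: contrapT => h; apply: nN; apply: sN => /= /(_ lv vl').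
have h2 : F (v + i%:R * dl + dl) = zeta *
    (if l <= v + i%:R * dl + dl < r then chi else 1) * F (v + i%:R * dl).
  apply: contrapT => h; apply: nM; apply: sM => /= h'; apply: h; apply: h'.
  by apply/andP; split=> //; lra.
have ec : crossings i.+1 v = (crossings i v + (l <= v + i%:R * dl + dl < r)%R)%N.
  by rewrite /crossings big_ord_recr /= e.
rewrite ec exprD e h2 h1 exprS; case: (_ <= _ < _); rewrite ?expr1 ?expr0.
  by move: (zeta ^+ i) (chi ^+ _) (F v) => X Y Z; ring.
by move: (zeta ^+ i) (chi ^+ _) (F v) => X Y Z; ring.
Qed.

Let A := cwin F dl.

Lemma crossings_before i (v : R) : v + i%:R * dl < l -> crossings i v = 0%N.
Proof.
move=> vl; rewrite /crossings big1 // => k _.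
have ki : k.+1%:R <= i%:R :> R by rewrite ler_nat.
have : v + k.+1%:R * dl < l by apply: le_lt_trans vl; rewrite lerD2l ler_wpM2r // ltW.
by rewrite ltNge => /negbTE ->.
Qed.

(** Windows that stay to the left of the stretch are only multiplied by [zeta]. *)
Lemma window_before i (y : R) : l - 3 * K%:R * dl <= y -> y + (i.+1)%:R * dl <= l ->
  A (y + i%:R * dl) = zeta ^+ i * A y.
Proof.
move=> ly yl; rewrite /A /cwin addrAC; apply: cint_transport => //.
have [N [mN N0 sN]] := local_iter i; exists N; split=> // v nv; apply: sN => /= h.
apply: nv => /= /andP[v1 v2]; rewrite -(natr1 i) mulrDl mul1r in yl.
have K0 : 0 <= 3 * K%:R * dl by rewrite !mulr_ge0 // ltW.
by rewrite h ?crossings_before ?expr0 ?mulr1 //; lra.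
Qed.

Hypothesis left : forall y : R, l - 2 * K%:R * dl <= y -> y <= l - dl ->
  15 * dl <= 16 * nm (A y).

Definition local_gap e : R :=
  wint (fun y => nm (A (y + e%:R * dl) - A y) ^+ 2) (l - 2 * K%:R * dl) (l + K%:R * dl).

Let bgap e : bmeas (fun y => nm (A (y + e%:R * dl) - A y) ^+ 2).
Proof. by apply: bmeas_nm_cwinB => //; exact: ltW. Qed.

(** Left of the stretch, [i] steps turn the windows by exactly [zeta ^+ i], and the
    windows have length close to [dl]. *)
Lemma zeta_gap i : (i <= K.+1)%N -> (4 <= K)%N ->
  nm (zeta ^+ i - 1) ^+ 2 * (K%:R * dl ^+ 3) <= 8 * (2 * local_gap i).
Proof.
move=> iK K4; have dl0' := dl0.
have K4r : 4 <= K%:R :> R by rewrite ler_nat.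
have iKr : i%:R <= K%:R + 1 :> R by rewrite natr1 ler_nat.
have iKd : i%:R * dl <= K%:R * dl + dl by rewrite -[X in _ + X]mul1r -mulrDl ler_wpM2r // ltW.
have K4d : 4 * dl <= K%:R * dl by rewrite ler_wpM2r // ltW.
have i0 : 0 <= i%:R * dl by rewrite mulr_ge0 // ltW.
have s1 : (l - K%:R * dl - 2 * dl) - (l - 2 * K%:R * dl) = (K%:R - 2) * dl by ring.
have step : nm (zeta ^+ i - 1) ^+ 2 * (dl ^+ 2 / 4) * ((K%:R - 2) * dl) <= local_gap i.
  rewrite -s1 -wint_cst; last by lra.
  apply: (@le_trans _ _ (wint (fun y => nm (A (y + i%:R * dl) - A y) ^+ 2)
      (l - 2 * K%:R * dl) (l - K%:R * dl - 2 * dl))); last first.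
    by apply: wint_sub => //; [move=> v; exact: sqr_ge0|lra|lra].
  apply: wint_le => //; first exact: bmeas_cst.
  move=> y /andP[y1 y2].
  have y3 : l - 3 * K%:R * dl <= y by lra.
  have y4 : y + i.+1%:R * dl <= l by rewrite -(natr1 i) mulrDl mul1r; lra.
  rewrite (window_before y3 y4).
  have -> : zeta ^+ i * A y - A y = (zeta ^+ i - 1) * A y by ring.
  rewrite nmM exprMn ler_wpM2l ?sqr_ge0 //.
  have y5 : y <= l - dl by lra.
  have h : dl / 2 <= nm (A y) by have := left y1 y5; lra.
  have -> : dl ^+ 2 / 4 = (dl / 2) ^+ 2 by field.
  by rewrite lerXn2r ?nnegrE ?nm_ge0 //; apply: divr_ge0 => //; exact: ltW.
have n0 := sqr_ge0 (nm (zeta ^+ i - 1)).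
apply: (@le_trans _ _ (8 * (2 * (nm (zeta ^+ i - 1) ^+ 2 * (dl ^+ 2 / 4) * ((K%:R - 2) * dl))))).
  have -> : 8 * (2 * (nm (zeta ^+ i - 1) ^+ 2 * (dl ^+ 2 / 4) * ((K%:R - 2) * dl))) =
    nm (zeta ^+ i - 1) ^+ 2 * ((4 * K%:R - 8) * dl ^+ 3) by field.
  rewrite ler_wpM2l // ler_wpM2r //; first by rewrite exprn_ge0 // ltW.
  lra.
by rewrite !ler_pM2l.
Qed.

Hypotheses (b1 : (0 < b)%N) (bK : (8 * b <= K)%N).
Let rho : R := `|r - l - b%:R * dl|.
Hypothesis rho_small : 16 * rho <= dl.

Let u : R := Num.min r (l + b%:R * dl).
Let u' : R := Num.max r (l + b%:R * dl).

Let uu' : u' - u = rho.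
Proof.
rewrite /u /u' /rho; case: (leP r (l + b%:R * dl)) => h.
  by rewrite distrC ger0_norm; [ring|lra].
by rewrite gtr0_norm; [ring|lra].
Qed.

(** The steps that fall in the discrepancy between the stretch and one of length
    exactly [b * dl]. *)
Definition strays i v : R := \sum_(k < i) \1_(`[u, u'[) (v + k.+1%:R * dl).

Lemma strays_ge0 i v : 0 <= strays i v.
Proof. by apply: sumr_ge0 => k _; rewrite indicE ler0n. Qed.

Lemma crossings_through i (v : R) : (b <= i)%N -> v < l ->
  l <= v + (i - b).+1%:R * dl -> strays i v < 1 -> crossings i v = b.
Proof.
move=> bi vl lv; have dl0' := dl0; move=> hE.
have nostray k : (k < i)%N -> (v + k.+1%:R * dl < r) = (v + k.+1%:R * dl < l + b%:R * dl).
  move=> ki; set w := v + _; apply/idP/idP => h; rewrite ltNge; apply/negP => h'.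
  - have : strays i v >= 1.
      rewrite /strays (bigD1 (Ordinal ki)) //= indicE mem_set /=.
        by rewrite lerDl; apply: sumr_ge0 => j _; rewrite indicE ler0n.
      by rewrite in_itv /= -/w /u /u' ge_min lt_max h' orbT h.
    by rewrite leNgt hE.
  - have : strays i v >= 1.
      rewrite /strays (bigD1 (Ordinal ki)) //= indicE mem_set /=.
        by rewrite lerDl; apply: sumr_ge0 => j _; rewrite indicE ler0n.
      by rewrite in_itv /= -/w /u /u' ge_min lt_max h' /= h orbT.
    by rewrite leNgt hE.
pose h (k : nat) : nat := (l <= v + k.+1%:R * dl)%R.
have hmono k k' : (k <= k')%N -> (h k <= h k')%N.
  rewrite /h => kk; case: (boolP (l <= v + k.+1%:R * dl)) => // h1.
  rewrite (le_trans h1) // lerD2l ler_wpM2r ?(ltW dl0') // ler_nat ltnS //.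
have e1 : crossings i v = (\sum_(0 <= k < i) ((l <= v + k.+1%:R * dl) &&
    (v + k.+1%:R * dl < l + b%:R * dl))%R)%N.
  rewrite /crossings big_mkord; apply: eq_bigr => k _.
  by rewrite nostray.
have e2 k : (k < b)%N -> v + k.+1%:R * dl < l + b%:R * dl.
  move=> kb; apply: ltr_leD => //.
  by rewrite ler_wpM2r ?(ltW dl0') // ler_nat.
have e3 k : (((l <= v + (k + b).+1%:R * dl) && (v + (k + b).+1%:R * dl < l + b%:R * dl))%R
     + h k = h (k + b))%N.
  have -> : (v + (k + b).+1%:R * dl < l + b%:R * dl) = ~~ (l <= v + k.+1%:R * dl).
    rewrite -addSn natrD mulrDl addrA ltrD2r -ltNge //.
  have := hmono k (k + b)%N (leq_addr _ _); rewrite /h.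
  by case: (l <= v + k.+1%:R * dl); case: (l <= v + _).
have e4 : (\sum_(0 <= k < i) ((l <= v + k.+1%:R * dl) &&
    (v + k.+1%:R * dl < l + b%:R * dl))%R + \sum_(0 <= k < i - b) h k =
    \sum_(0 <= k < i) h k)%N.
  rewrite (big_cat_nat (n := b)) //= [RHS](big_cat_nat (n := b)) //= -addnA.
  congr (_ + _)%N.
    rewrite big_nat [RHS]big_nat; apply: eq_bigr => k /andP[_ kb].
    by rewrite e2 // andbT.
  have sh (G : nat -> nat) : (\sum_(b <= k < i) G k = \sum_(0 <= k < i - b) G (k + b))%N.
    by rewrite -[in LHS](add0n b) big_addn.
  rewrite !sh -big_split /=.
  by apply: eq_bigr => k _; rewrite e3.
have e5 : (\sum_(0 <= k < i) h k = \sum_(0 <= k < i - b) h k + b)%N.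
  rewrite (big_cat_nat (n := (i - b)%N)) ?leq_subr //=; congr (_ + _)%N.
  rewrite (eq_big_nat _ _ (F2 := fun=> 1%N)).
    by rewrite sum_nat_const_nat muln1 subKn.
  move=> k /andP[k1 k2]; have : (h (i - b)%N <= h k)%N by exact: hmono.
  by rewrite /h lv; case: (_ <= _).
by apply/eqP; rewrite e1 -(eqn_add2r (\sum_(0 <= k < i - b) h k)) e4 e5 addnC.
Qed.

Let bstray : bmeas (\1_(`[u, u'[) : R -> R).
Proof. exact: bmeas_itv_indic. Qed.

Lemma bmeas_strays i : bmeas (strays i).
Proof. by apply: bmeas_sum => k; exact: (bmeas_shift _ bstray). Qed.

Lemma strays_int i y : wint (strays i) y (y + dl) <= rho.
Proof.
have dl0' := dl0.
have -> : wint (strays i) y (y + dl) =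
    \sum_(k < i) wint (\1_(`[u, u'[) : R -> R) (y + dl + k%:R * dl) (y + dl + k%:R * dl + dl).
  rewrite /strays; elim: i => [|i IH].
    rewrite big_ord0 (_ : (fun v => _) = (fun=> 0)).
      by rewrite wint_cst ?mul0r // lerDl ltW.
    by apply/funext => v; rewrite big_ord0.
  rewrite big_ord_recr /= -IH -[X in _ = _ + X](_ : wint (fun v => \1_(`[u, u'[) (v + i.+1%:R * dl)) y (y + dl) = _).
    rewrite -wintD; [|exact: bmeas_strays|exact: (bmeas_shift _ bstray)].
    by apply: eq_wint => v _; rewrite big_ord_recr.
  rewrite (wint_shift y (y + dl) (i.+1%:R * dl) bstray) -(natr1 i) mulrDl mul1r.
  have -> : y + (i%:R * dl + dl) = y + dl + i%:R * dl by rewrite addrA addrAC.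
  by have -> : y + dl + (i%:R * dl + dl) = y + dl + i%:R * dl + dl by rewrite addrA.
have i0 v : 0 <= \1_(`[u, u'[) v :> R by rewrite indicE ler0n.
apply: le_trans (wint_blocks (y + dl) i bstray i0 (ltW dl0') (lexx dl)) _.
rewrite -uu'; apply: wint_itv_indic.
by rewrite /u /u' ge_min le_max lexx.
Qed.

(** A window carried across the whole stretch picks up [chi ^+ b], apart from its
    strays; together with the left windows this isolates [chi ^+ b - 1]. *)
Lemma chi_gap i : (K <= 2 * i)%N -> (i <= K)%N -> (8 <= K)%N ->
  nm (chi ^+ b - 1) ^+ 2 * (K%:R * dl ^+ 3) <=
  96 * local_gap i + 256 * rho ^+ 2 * (K%:R * dl).
Proof.
move=> Ki iK K8; have dl0' := dl0; have rho_small' := rho_small.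
have rho0 : 0 <= rho by exact: normr_ge0.
have K8r : 8 <= K%:R :> R by rewrite ler_nat.
have K8d : 8 * dl <= K%:R * dl by rewrite ler_wpM2r // ltW.
have bKr : 8 * b%:R <= K%:R :> R by rewrite -natrM ler_nat.
have bKd : 8 * (b%:R * dl) <= K%:R * dl by rewrite mulrA ler_wpM2r // ltW.
have iKd : i%:R * dl <= K%:R * dl by rewrite ler_wpM2r ?(ltW dl0') // ler_nat.
have Kid : K%:R * dl <= 2 * (i%:R * dl).
  by rewrite mulrA ler_wpM2r ?(ltW dl0') // -natrM ler_nat.
have b1d : dl <= b%:R * dl by rewrite ler_peMl ?(ltW dl0') // ler1n.
have bi : (b <= i)%N by move: bK Ki; clear; lia.
set Z := zeta ^+ i; set X := chi ^+ b.
have Z1 : nm Z = 1 by rewrite nmX zeta1 expr1n.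
have X1 : nm X = 1 by rewrite nmX chi1 expr1n.
pose y0 := l - i%:R * dl + b%:R * dl.
have close y : y0 <= y -> y <= l - dl ->
    nm (A (y + i%:R * dl) - Z * X * A y) <= 2 * rho.
  move=> y1 y2.
  have [N [mN N0 sN]] := local_iter i.
  have bW : cbm (fun v => F (v + i%:R * dl) + (- (Z * X)) * F v).
    by apply: cbmD; [exact: cbm_shift|exact: cbmM (cbm_cst _) bF].
  have eA : A (y + i%:R * dl) - Z * X * A y =
      cint (fun v => F (v + i%:R * dl) + (- (Z * X)) * F v) y (y + dl).
    rewrite cintD; [|exact: cbm_shift|exact: cbmM (cbm_cst _) bF].
    by rewrite cintZ // cint_shift // mulNr /A /cwin addrAC.
  rewrite eA; apply: le_trans (_ : wint (fun v => 2 * strays i v) y (y + dl) <= _); last first.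
    rewrite wintZ; last exact: bmeas_strays.
    by rewrite ler_pM2l // strays_int.
  apply: cint_le_ae => //; first exact: bmeasZ (bmeas_strays i).
  exists N; split=> // v nv; apply: sN => /= h; apply: nv => /= /andP[v1 v2].
  have K0 : 0 <= 3 * K%:R * dl by rewrite !mulr_ge0 // ltW.
  rewrite h; [|rewrite /y0 in y1; lra|lra].
  have -> : Z * chi ^+ crossings i v * F v + - (Z * X) * F v =
    Z * (chi ^+ crossings i v - X) * F v by ring.
  rewrite !nmM Z1 F1 mul1r mulr1.
  case: (ltP (strays i v) 1) => hs.
    have -> : crossings i v = b.
      apply: crossings_through => //; first by lra.
      rewrite -(natr1 (i - b)%N) natrB //; rewrite /y0 in y1; lra.
    by rewrite subrr nm0 mulr_ge0 // strays_ge0.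
  apply: le_trans (nmB _ _) _; rewrite X1 nmX chi1 expr1n; lra.
have s1 : (l - dl) - y0 = i%:R * dl - b%:R * dl - dl by rewrite /y0; ring.
have len0 : K%:R * dl <= 4 * ((l - dl) - y0) by rewrite s1; lra.
have len1 : (l - dl) - y0 <= K%:R * dl by rewrite s1; lra.
have yl : y0 <= l - dl by lra.
have bdl : bmeas (fun y => 2 * nm (A (y + i%:R * dl) - A y) ^+ 2 + 8 * rho ^+ 2).
  by apply: bmeasD; [exact: bmeasZ|exact: bmeas_cst].
have step : nm (Z * X - 1) ^+ 2 * (dl ^+ 2 / 4) * ((l - dl) - y0) <=
    2 * local_gap i + 8 * rho ^+ 2 * (K%:R * dl).
  rewrite -wint_cst //.
  apply: (@le_trans _ _ (wint (fun y => 2 * nm (A (y + i%:R * dl) - A y) ^+ 2 +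
      8 * rho ^+ 2) y0 (l - dl))); last first.
    rewrite wintD; [|exact: bmeasZ|exact: bmeas_cst].
    rewrite wintZ // wint_cst //; apply: lerD.
      by rewrite ler_pM2l //; apply: wint_sub => //; [move=> v; exact: sqr_ge0|rewrite /y0; lra|lra].
    by rewrite ler_wpM2l // mulr_ge0 // sqr_ge0.
  apply: wint_le => //; first exact: bmeas_cst.
  move=> y /andP[y1 y2]; have cl := close _ y1 y2.
  have hA : 15 * dl <= 16 * nm (A y) by apply: left => //; rewrite /y0 in y1; lra.
  have hA2 : dl / 2 <= nm (A y) by lra.
  have tri : nm (Z * X - 1) * nm (A y) <= nm (A (y + i%:R * dl) - A y) + 2 * rho.
    rewrite -nmM mulrBl mul1r.
    apply: le_trans (nm_triangle (A (y + i%:R * dl)) _ _) _.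
    by rewrite addrC lerD2l nm_distC.
  set t := nm (A (y + i%:R * dl) - A y) in tri *.
  have t0 : 0 <= t by exact: nm_ge0.
  have n0 := nm_ge0 (Z * X - 1); set n := nm (Z * X - 1) in n0 tri *.
  have tri2 : n * (dl / 2) <= t + 2 * rho.
    by apply: le_trans tri; rewrite ler_wpM2l.
  have -> : n ^+ 2 * (dl ^+ 2 / 4) = (n * (dl / 2)) ^+ 2 by field.
  have p1 : 0 <= n * (dl / 2) by rewrite mulr_ge0 // divr_ge0 // ltW.
  apply: le_trans (sqr_le_sum2 p1 tri2) _.
  by rewrite exprMn; clearbody t n rho; lra.
have zg := zeta_gap (leqW iK) (leq_trans (isT : (4 <= 8)%N) K8); rewrite -/Z in zg.
have n0 := sqr_ge0 (nm (Z * X - 1)).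
have step2 : nm (Z * X - 1) ^+ 2 * (K%:R * dl ^+ 3) <=
    16 * (2 * local_gap i + 8 * rho ^+ 2 * (K%:R * dl)).
  have -> : nm (Z * X - 1) ^+ 2 * (K%:R * dl ^+ 3) =
     nm (Z * X - 1) ^+ 2 * (dl ^+ 2) * (K%:R * dl) by ring.
  apply: le_trans (_ : nm (Z * X - 1) ^+ 2 * (dl ^+ 2) * (4 * ((l - dl) - y0)) <= _).
    by rewrite ler_wpM2l // mulr_ge0 // sqr_ge0.
  by move: step; set V := (l - dl) - y0; set W := nm _ ^+ 2; lra.
have tri : nm (X - 1) ^+ 2 <= 2 * nm (Z * X - 1) ^+ 2 + 2 * nm (Z - 1) ^+ 2.
  apply: sqr_le_sum2; first exact: nm_ge0.
  rewrite -[nm (X - 1)]mul1r -Z1 -nmM (_ : Z * (X - 1) = (Z * X - 1) - (Z - 1)); last by ring.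
  exact: nmB.
have Kd0 : 0 <= K%:R * dl ^+ 3 by rewrite mulr_ge0 // exprn_ge0 // ltW.
apply: le_trans (ler_wpM2r Kd0 tri) _; rewrite mulrDl -!mulrA.
by move: zg step2; rewrite -!mulrA; lra.
Qed.

(** A window that starts just after one of the [b] blocks of the stretch
    [[l, r[] is turned almost entirely by [zeta * chi], against [zeta] outside. *)
Lemma stretch_step (k : nat) y : (k < b)%N -> (8 <= K)%N ->
  l - dl + k%:R * dl <= y -> y <= l - dl + k%:R * dl + dl / 8 ->
  nm (chi - 1) * (dl / 2) <= nm (A (y + dl) - A y) + nm (zeta - 1) * dl.
Proof.
move=> kb K8 y1 y2; have dl0' := dl0; have rho_small' := rho_small.
have rho0 : 0 <= rho by exact: normr_ge0.
have K8r : 8 <= K%:R :> R by rewrite ler_nat.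
have K8d : 8 * dl <= K%:R * dl by rewrite ler_wpM2r // ltW.
have bKr : 8 * b%:R <= K%:R :> R by rewrite -natrM ler_nat.
have bKd : 8 * (b%:R * dl) <= K%:R * dl by rewrite mulrA ler_wpM2r // ltW.
have kbr : k%:R + 1 <= b%:R :> R by rewrite natr1 ler_nat.
have kbd : k%:R * dl + dl <= b%:R * dl.
  by rewrite -[X in _ + X]mul1r -mulrDl ler_wpM2r // ltW.
have k0 : 0 <= k%:R * dl by rewrite mulr_ge0 // ltW.
have rb : l + b%:R * dl - rho <= r.
  by have := ler_norm (- (r - l - b%:R * dl)); rewrite normrN -/rho; lra.
pose tau := y - (l - dl + k%:R * dl).
have tau0 : 0 <= tau by rewrite /tau; lra.
have tau8 : 8 * tau <= dl by rewrite /tau; lra.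
pose J : R -> R[i] := fun v => ((\1_(`[l - dl, r - dl[) : R -> R) v)%:C%C.
have bJ : cbm J by apply: cbm_real; exact: bmeas_itv_indic.
have bJF : cbm (fun v => J v * F v) by exact: cbmM.
pose B := cint (fun v => J v * F v) y (y + dl).
have eA : A (y + dl) - A y = (zeta - 1) * A y + zeta * (chi - 1) * B.
  have -> : A (y + dl) = zeta * A y + zeta * (chi - 1) * B.
    rewrite /A /cwin /B -cint_shift // -cintZ // -[X in _ = _ + X]cintZ //.
    rewrite -cintD; [|exact: cbmM (cbm_cst _) bF|exact: cbmM (cbm_cst _) bJF].
    apply: cint_ae_open; first exact: cbm_shift.
      by apply: cbmD; [exact: cbmM (cbm_cst _) bF|exact: cbmM (cbm_cst _) bJF].
    have [N [mN N0 sN]] := HF; exists N; split=> // v nv; apply: sN => /= h.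
    apply: nv => /= /andP[v1 v2].
    rewrite h; last by apply/andP; split; lra.
    rewrite /J indicE; case: ifP => hv.
      rewrite mem_set ?rmorph1; first by ring.
      by rewrite /= in_itv /= lerBlDr ltrBrDr.
    rewrite memNset ?rmorph0; first by ring.
    by rewrite /= in_itv /= lerBlDr ltrBrDr hv.
  by ring.
have nJF v : nm (J v * F v) <= 1.
  rewrite nmM F1 mulr1 /J indicE; case: (_ \in _); rewrite ?rmorph1 ?nm1 //.
  by rewrite rmorph0 nm0.
pose e := y + dl - tau - rho.
have ye : y <= e by rewrite /e; lra.
have edl : e <= y + dl by rewrite /e; lra.
have BU : nm B >= nm (cint F y e) - (tau + rho).
  have eB : B = cint F y e + cint (fun v => J v * F v) e (y + dl).
    rewrite /B (cint_chasles bJF ye edl); congr (_ + _).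
    apply: cint_ae_open => //; apply: aeW => v /andP[v1 v2].
    rewrite /J indicE mem_set ?rmorph1 ?mul1r //= in_itv /=.
    by apply/andP; split; rewrite /e /tau in v2; lra.
  rewrite eB; apply: le_trans (nmB_ge _ _); rewrite lerD2l lerN2.
  apply: le_trans (cint_bound bJF edl nJF) _; rewrite /e; lra.
have UU : nm (cint F y e) = nm (cint F (l - dl + tau) (l - rho)).
  have -> : y = l - dl + tau + k%:R * dl by rewrite /tau; ring.
  have -> : e = l - rho + k%:R * dl by rewrite /e /tau; ring.
  rewrite (@cint_transport _ F _ _ _ (zeta ^+ k * chi ^+ k)) //.
    by rewrite !nmM !nmX zeta1 chi1 !expr1n !mul1r.
  have [N [mN N0 sN]] := local_iter k; exists N; split=> // v nv; apply: sN => /= h.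
  apply: nv => /= /andP[v1 v2]; rewrite h; [|lra|lra].
  congr (_ * _ ^+ _ * _); rewrite /crossings.
  rewrite (eq_bigr (fun=> 1%N)) ?sum1_card ?card_ord // => i _.
  have ik : i.+1%:R <= k%:R :> R by rewrite ler_nat.
  have ikd : i.+1%:R * dl <= k%:R * dl by rewrite ler_wpM2r // ltW.
  have i1 : dl <= i.+1%:R * dl by rewrite ler_peMl ?(ltW dl0') // ler1n.
  by rewrite (_ : _ && _ = true) //; apply/andP; split; lra.
have big : 15 * dl <= 16 * nm (A (l - dl)) by apply: left; lra.
have sub : nm (A (l - dl)) - (tau + rho) <= nm (cint F (l - dl + tau) (l - rho)).
  have F1' v : nm (F v) <= 1 by rewrite F1.
  have h1 : l - dl <= l - dl + tau by lra.
  have h2 : l - dl + tau <= l - rho by lra.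
  have h3 : l - rho <= l by lra.
  have -> : A (l - dl) = cint F (l - dl) (l - dl + tau) +
      cint F (l - dl + tau) (l - rho) + cint F (l - rho) l.
    rewrite /A /cwin subrK (cint_chasles bF h1 (le_trans h2 h3)).
    by rewrite (cint_chasles bF h2 h3) addrA.
  have c1 := cint_bound bF h1 F1'; have c3 := cint_bound bF h3 F1'.
  apply: le_trans (lerB (nmD _ _) (lexx _)) _.
  have := nmD (cint F (l - dl) (l - dl + tau)) (cint F (l - dl + tau) (l - rho)).
  lra.
have Bge : dl / 2 <= nm B by lra.
have Ay : nm (A y) <= dl by apply: nm_cwin_le => //; [exact: ltW|move=> v; rewrite F1].
have : nm (zeta * (chi - 1) * B) <= nm (A (y + dl) - A y) + nm ((zeta - 1) * A y).
  by rewrite (_ : _ * B = (A (y + dl) - A y) - (zeta - 1) * A y); [exact: nmB|rewrite eA; ring].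
rewrite !nmM zeta1 mul1r => h.
have h1 : nm (chi - 1) * (dl / 2) <= nm (chi - 1) * nm B by rewrite ler_wpM2l // nm_ge0.
by apply: le_trans h1 (le_trans h _); rewrite lerD2l ler_wpM2l // nm_ge0.
Qed.

(** The windows of [stretch_step] lie in disjoint blocks, one for each [k < b];
    [zeta] is close to 1 because [zeta ^+ i] and [zeta ^+ i.+1] are. *)
Lemma stretch_gap i : (i <= K)%N -> (8 <= K)%N ->
  nm (chi - 1) ^+ 2 * (b%:R * dl ^+ 3) <=
  64 * local_gap 1 + 32 * (local_gap i + local_gap i.+1).
Proof.
move=> iK K8; have dl0' := dl0.
have K4 : (4 <= K)%N by exact: leq_trans K8.
have K8r : 8 <= K%:R :> R by rewrite ler_nat.
have bKr : 8 * b%:R <= K%:R :> R by rewrite -natrM ler_nat.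
have bKd : 8 * (b%:R * dl) <= K%:R * dl by rewrite mulrA ler_wpM2r // ltW.
have K8d : 8 * dl <= K%:R * dl by rewrite ler_wpM2r // ltW.
have b0 : 0 <= b%:R * dl by rewrite mulr_ge0 // ltW.
set n := nm (chi - 1); set z := nm (zeta - 1).
have n0 : 0 <= n by exact: nm_ge0.
have z0 : 0 <= z by exact: nm_ge0.
pose g y := nm (A (y + 1%:R * dl) - A y) ^+ 2.
have bg : bmeas g by exact: bgap.
have g0 v : 0 <= g v by exact: sqr_ge0.
have block : b%:R * (n ^+ 2 * (dl ^+ 3 / 32) - z ^+ 2 * dl ^+ 2 * (dl / 4)) <=
    2 * local_gap 1.
  have -> (c : R) : b%:R * c = \sum_(k < b) c by rewrite sumr_const card_ord mulr_natl.
  apply: (@le_trans _ _ (\sum_(k < b) 2 * wint g (l - dl + k%:R * dl) (l - dl + k%:R * dl + dl / 8))).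
    apply: ler_sum => k _; set y0 := l - dl + k%:R * dl.
    have h8 : y0 <= y0 + dl / 8 by rewrite lerDl divr_ge0 // ltW.
    have -> : n ^+ 2 * (dl ^+ 3 / 32) - z ^+ 2 * dl ^+ 2 * (dl / 4) =
      wint (fun=> n ^+ 2 * dl ^+ 2 / 4 - 2 * (z ^+ 2 * dl ^+ 2)) y0 (y0 + dl / 8).
      by rewrite wint_cst //; field.
    rewrite -wintZ //; apply: wint_le; [exact: bmeas_cst|exact: bmeasZ|].
    move=> y /andP[y1 y2]; have h := stretch_step (ltn_ord k) K8 y1 y2.
    rewrite /g mul1r -/n -/z in h *; set t := nm (A (y + dl) - A y) in h *.
    have t0 : 0 <= t by exact: nm_ge0.
    have p1 : 0 <= n * (dl / 2) by rewrite mulr_ge0 // divr_ge0 // ltW.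
    have := sqr_le_sum2 p1 h.
    have -> : (n * (dl / 2)) ^+ 2 = n ^+ 2 * dl ^+ 2 / 4 by field.
    have -> : z ^+ 2 * dl ^+ 2 = (z * dl) ^+ 2 by ring.
    move: (z * dl) (n ^+ 2 * dl ^+ 2 / 4) => Z1 N1; clearbody t; lra.
  rewrite -mulr_sumr ler_pM2l //.
  have d8 : 0 <= dl / 8 by rewrite divr_ge0 // ltW.
  have d81 : dl / 8 <= dl by lra.
  apply: le_trans (wint_blocks (l - dl) b bg g0 d8 d81) _.
  by apply: wint_sub => //; lra.
have z2 : z ^+ 2 * (K%:R * dl ^+ 3) <= 32 * (local_gap i + local_gap i.+1).
  have z1 := zeta_gap (leqW iK) K4; have z2 := zeta_gap (iK : (i.+1 <= K.+1)%N) K4.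
  have tri : z ^+ 2 <= 2 * nm (zeta ^+ i.+1 - 1) ^+ 2 + 2 * nm (zeta ^+ i - 1) ^+ 2.
    apply: sqr_le_sum2 => //.
    have -> : z = nm ((zeta ^+ i.+1 - 1) - (zeta ^+ i - 1)).
      rewrite (_ : _ - _ = zeta ^+ i * (zeta - 1)); last by rewrite exprS; ring.
      by rewrite nmM nmX zeta1 expr1n mul1r.
    exact: nmB.
  have Kd0 : 0 <= K%:R * dl ^+ 3 by rewrite mulr_ge0 // exprn_ge0 // ltW.
  move: Kd0 z1 z2 tri; set W := K%:R * dl ^+ 3.
  move: (nm (zeta ^+ i.+1 - 1) ^+ 2) (nm (zeta ^+ i - 1) ^+ 2) W (z ^+ 2)
    (local_gap i) (local_gap i.+1) => U1 U2 W Z2 G1 G2 W0 h1 h2 h3.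
  by apply: le_trans (ler_wpM2r W0 h3) _; rewrite mulrDl -!mulrA; lra.
have hb : b%:R * (z ^+ 2 * dl ^+ 2 * (dl / 4)) <= z ^+ 2 * (K%:R * dl ^+ 3) / 32.
  have -> : b%:R * (z ^+ 2 * dl ^+ 2 * (dl / 4)) = (8 * b%:R) * (z ^+ 2 * dl ^+ 3 / 32) by field.
  have -> : z ^+ 2 * (K%:R * dl ^+ 3) / 32 = K%:R * (z ^+ 2 * dl ^+ 3 / 32) by ring.
  have dl3 : 0 <= dl ^+ 3 by rewrite exprn_ge0 // ltW.
  by rewrite ler_wpM2r // divr_ge0 // mulr_ge0 // sqr_ge0.
rewrite mulrBr in block.
have -> : n ^+ 2 * (b%:R * dl ^+ 3) = 32 * (b%:R * (n ^+ 2 * (dl ^+ 3 / 32))) by field.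
move: block hb z2; move: (local_gap 1) (local_gap i) (local_gap i.+1) => G1 G2 G3.
move: (b%:R * (n ^+ 2 * _)) (b%:R * (z ^+ 2 * _ * _)) (z ^+ 2 * (K%:R * _)) => X1 X2 X3.
by move=> h1 h2 h3; lra.
Qed.

End local_estimates.
(** * Digits of beta *)

Section digits.
Variables (R : realType) (alpha : R).
Hypothesis Ha : irrational01 alpha.
Notation Q := (cfQ alpha).
Notation d := (cfd alpha).

(** An integer much smaller than q_(n+1) that nearly annihilates [alpha] at the
    scale of q_n is a multiple of q_n. *)
Lemma digit n (k z : int) (c : R) : 0 <= c -> 8 * c <= 1 ->
  `|k|%:~R <= 2 * c * (Q n.+2)%:~R -> `|k%:~R * alpha - z%:~R| <= 2 * c * d n ->
  exists2 b : int, k = b * Q n.+1 &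
    k%:~R * alpha - z%:~R = (-1) ^+ n * (b%:~R * d n.+1).
Proof.
move=> c0 c8 hk hz; have [x [y [ek ez e]]] := cf_basis Ha n k z.
have d1 := cfd_gt0 Ha n.+1; have d2 := cfd_gt0 Ha n.+2; have d0 := cfd_gt0 Ha n.
have q1 := cfQS_ge1 Ha n; have q2 := cfQS_ge1 Ha n.+1.
suff y0 : y = 0.
  by exists x; [rewrite ek y0 mul0r addr0|rewrite e y0 mulr0z mul0r subr0].
apply/eqP; apply: contraT => y0.
have q1r : 0 < (Q n.+1)%:~R :> R by exact: cfQS_gtr0.
have q2r : 0 < (Q n.+2)%:~R :> R by exact: cfQS_gtr0.
have aq : (pq alpha n)%:~R * (Q n.+1)%:~R <= (Q n.+2)%:~R :> R.
  by rewrite cfQSS intrD intrM lerDl (cfQr_ge0 Ha).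
have hk2 : - (2 * c * (Q n.+2)%:~R) <= x%:~R * (Q n.+1)%:~R + y%:~R * (Q n.+2)%:~R <= 2 * c * (Q n.+2)%:~R.
  by rewrite -ler_norml -!intrM -intrD -ek -intr_norm.
case/andP: hk2 => hk1 hk2.
have key (x' y' : R) : 1 <= y' -> x' * (Q n.+1)%:~R + y' * (Q n.+2)%:~R <= 2 * c * (Q n.+2)%:~R ->
    2 * c * d n < y' * d n.+2 - x' * d n.+1.
  move=> y1 h; have a1 := pqr_ge1 Ha n; rewrite (cfd_rec Ha n).
  move: aq a1; move: ((pq alpha n)%:~R : R) => a aq a1.
  have a0 : 0 < a by exact: lt_le_trans a1.
  have c4 : 0 < 1 - 4 * c by lra.
  have hx : x' * (Q n.+1)%:~R <= - ((1 - 2 * c) * a) * (Q n.+1)%:~R.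
    have : (1 - 2 * c) * (a * (Q n.+1)%:~R) <= (1 - 2 * c) * (Q n.+2)%:~R.
      by rewrite ler_wpM2l //; lra.
    have : (Q n.+2)%:~R <= y' * (Q n.+2)%:~R by rewrite ler_peMl // ltW.
    lra.
  rewrite ler_pM2r // in hx.
  have hx1 : x' * d n.+1 <= - ((1 - 2 * c) * a) * d n.+1 by rewrite ler_wpM2r // ltW.
  have hy1 : d n.+2 <= y' * d n.+2 by rewrite ler_peMl // ltW.
  have h2 := mulr_gt0 c4 (mulr_gt0 a0 d1).
  have h3 : 0 <= (1 - 2 * c) * d n.+2 by rewrite mulr_ge0 ?(ltW d2) //; lra.
  lra.
move: hz; rewrite e normrM normrX normrN1 expr1n mul1r.
have [y1|y1] : 1 <= y \/ y <= -1 by move: y0; clear; lia.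
  have y1r : 1 <= y%:~R :> R by rewrite ler1z.
  have h := key _ _ y1r hk2.
  by rewrite -normrN => /(le_trans (ler_norm _)); lra.
have y1r : 1 <= - y%:~R :> R by rewrite -mulrNz ler1z; move: y1; clear; lia.
have h : 2 * c * d n < - y%:~R * d n.+2 - - x%:~R * d n.+1 by apply: key => //; lra.
by move=> /(le_trans (ler_norm _)); lra.
Qed.

End digits.

Section local_relation.
Variables (R : realType) (alpha beta : R) (omega chi : R[i]) (f : R -> R[i]).
Hypothesis Ha : irrational01 alpha.
Hypotheses (omega1 : nm omega = 1) (chi1 : nm chi = 1).
Hypothesis pf : periodic1 f.
Notation mu := (@lebesgue_measure R).
Notation Q := (cfQ alpha).
Notation d := (cfd alpha).
Hypothesis Hf : {ae mu, forall x, f (x + alpha) = omega * chi ^ (ccount beta x) * f x}.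

Variables (n : nat) (j z0 : int) (M q : nat).
Hypotheses (qE : q%:Z = Q n.+1) (M1 : (1 <= M)%N) (Mq : (M <= q)%N)
  (jM : j < M%:Z) (Mj : M%:Z <= q%:Z + j).
Let beta' : R := beta - j%:~R * alpha - z0%:~R.
Hypothesis beta'_small : 4 * `|beta'| <= d n.
Let D : R := (-1) ^+ n * d n.+1.

Let qalpha : q%:R * alpha = (cfP alpha n.+1)%:~R + D.
Proof.
have := cfD Ha n.+1; rewrite -qE -pmulrn => h.
have -> : D = (-1) ^+ n.+2 * d n.+1 by rewrite /D !exprS; ring.
by rewrite -h; ring.
Qed.

Lemma one_jump (a : nat -> R) (i0 : 'I_q) (m0 : int) (w : R) : a i0 = m0%:~R ->
  (forall i, (i < q)%N -> i != i0 :> nat -> forall z : int, w <= `|a i - z%:~R|) ->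
  exists K : int, forall u, `|u| < w -> \sum_(i < q) Num.floor (a i + u) = K + Num.floor u.
Proof.
move=> a0 sep; exists (m0 + \sum_(i < q | i != i0) Num.floor (a i)) => u uw.
rewrite (bigD1 i0) //= a0 floorDzr ?intr_int // intrKfloor addrAC; congr (_ + _ + _).
apply: eq_bigr => i ii; apply: (@floor_near _ _ _ `|u|).
  by move=> z; apply: lt_le_trans uw _; exact: sep.
by rewrite addrC addKr.
Qed.

Let sep (k : int) (z : int) : k != 0 -> `|k| < Q n.+1 -> d n <= `|k%:~R * alpha - z%:~R|.
Proof.
case: n qE => [|n'] qE' k0 kq; last exact: cf_best.
by move: kq; rewrite /= => kq; exfalso; move: k0 kq; clear; lia.
Qed.

(** Along the orbit of [M * alpha + y] with [y] small, exactly one point passes near 0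
    and one near [beta]. *)
Lemma csum_local : exists K : int, forall y,
  `|y + D| < d n -> `|y + D - beta'| < d n ->
  csum alpha beta q (M%:R * alpha + y) =
  K + (Num.floor (y + D) - Num.floor (y + D - beta')).
Proof.
have i0P : (q - M < q)%N by move: M1 Mq; clear; lia.
have i1P : (absz (q%:Z + j - M%:Z)%R < q)%N by move: jM Mj; clear; lia.
pose i1 := Ordinal i1P; pose i0 := Ordinal i0P.
pose P := cfP alpha n.+1.
pose a0 (i : nat) : R := M%:R * alpha + i%:R * alpha - D.
pose a1 (i : nat) : R := M%:R * alpha + i%:R * alpha - D - (beta - beta').
have a0E i : a0 i = (M%:Z + i%:Z - q%:Z)%:~R * alpha + P%:~R.
  rewrite /a0 (_ : D = q%:R * alpha - P%:~R); last by rewrite qalpha -/P; ring.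
  by rewrite intrB intrD; ring.
have a1E i : a1 i = (M%:Z + i%:Z - q%:Z - j)%:~R * alpha + (P - z0)%:~R.
  rewrite /a1 (_ : _ - _ - (beta - beta') = a0 i - (beta - beta')) // a0E.
  by rewrite /beta' !intrB intrD; ring.
have [K0 h0] : exists K : int, forall u, `|u| < d n ->
    \sum_(i < q) Num.floor (a0 i + u) = K + Num.floor u.
  apply: (@one_jump a0 i0 P) => [|i iq ii z]; rewrite a0E.
    rewrite (_ : (_ - q%:Z)%R = 0) ?mul0r ?add0r // /i0 /=; move: Mq; clear; lia.
  rewrite -addrA -intrB -[P - z]opprB mulrNz; apply: sep.
    by move: ii; rewrite /i0 /=; move: Mq; clear; lia.
  by rewrite -qE; move: ii iq Mq M1; rewrite /i0 /=; clear; lia.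
have [K1 h1] : exists K : int, forall u, `|u| < d n ->
    \sum_(i < q) Num.floor (a1 i + u) = K + Num.floor u.
  apply: (@one_jump a1 i1 (P - z0)) => [|i iq ii z]; rewrite a1E.
    rewrite (_ : (_ - j)%R = 0) ?mul0r ?add0r // /i1 /=; move: jM Mj; clear; lia.
  rewrite -addrA -intrB -[P - z0 - z]opprB mulrNz; apply: sep.
    by move: ii; rewrite /i1 /=; move: jM Mj; clear; lia.
  by rewrite -qE; move: ii iq jM Mj; rewrite /i1 /=; clear; lia.
exists (K0 - K1) => y y1 y2; rewrite /csum /ccount sumrB.
have -> : K0 - K1 + (Num.floor (y + D) - Num.floor (y + D - beta')) =
  (K0 + Num.floor (y + D)) - (K1 + Num.floor (y + D - beta')) by ring.
rewrite -h0 // -h1 //; congr (_ - _); apply: eq_bigr => i _; congr Num.floor.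
  by rewrite /a0; ring.
by rewrite /a1; ring.
Qed.

(** The equation iterated q_n times, in coordinates centred at [M * alpha]. *)
Lemma local_cocycle : exists (zeta chi' : R[i]) (l r : R),
  [/\ nm zeta = 1, chi' = chi \/ chi' = chi^-1, l <= r /\ r - l = `|beta'|,
      `|l| <= `|beta'| + d n.+1 &
  {ae mu, forall v, 2 * (`|v| + d n.+1) < d n ->
     f (M%:R * alpha + (v + d n.+1)) =
     zeta * (if l <= v + d n.+1 < r then chi' else 1) * f (M%:R * alpha + v)}].
Proof.
have chi0 : chi != 0.
  by apply/eqP => c0; move: chi1; rewrite c0 nm0 => /esym/eqP; rewrite oner_eq0.
have dn1 : d n <= 1 by exact: (cfd_le Ha (leq0n n)).
have d0 := cfd_gt0 Ha n; have d1 := cfd_gt0 Ha n.+1.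
have bs := beta'_small.
have [K hK] := csum_local.
pose zt := omega ^+ q * chi ^ K.
have zt1 : nm zt = 1 by exact: nm_multiplier.
have zt0 : zt != 0.
  by apply/eqP => c0; move: zt1; rewrite c0 nm0 => /esym/eqP; rewrite oner_eq0.
have fl (u : R) : `|u| < 1 -> Num.floor u = (if 0 <= u then 0 else -1).
  rewrite ltr_norml => /andP[u1 u2]; case: ifP => u0; apply: floor_def.
    by rewrite add0r u0.
  move/negbT: u0; rewrite -ltNge => u0; rewrite addNr mulr0z mulrNz u0 andbT.
  exact: ltW.
have base : {ae mu, forall y, `|y + D| < d n -> `|y + D - beta'| < d n ->
   f (M%:R * alpha + (y + D)) =
   zt * (if 0 <= y + D then (if beta' <= y + D then 1 else chi)
         else (if beta' <= y + D then chi^-1 else 1)) * f (M%:R * alpha + y)}.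
  have [N [mN N0 sN]] := ae_shift (M%:R * alpha) (cocycle_iter chi1 Hf q).
  exists N; split=> // y ny; apply: sN => /= h; apply: ny => y1 y2.
  rewrite -(periodic1_int (cfP alpha n.+1) (M%:R * alpha + (y + D)) pf).
  have -> : M%:R * alpha + (y + D) + (cfP alpha n.+1)%:~R = y + M%:R * alpha + q%:R * alpha.
    by rewrite qalpha; ring.
  rewrite h [y + _]addrC hK // expfzDr // /zt -!mulrA; congr (_ * (_ * (_ * _))).
  rewrite !fl ?(lt_le_trans _ dn1) // subr_ge0.
  by case: ifP => _; case: ifP => _; rewrite ?subrr ?sub0r ?opprK ?expr0z ?expr1z ?exprN1.
have bn := normr_ge0 beta'.
case: (boolP (odd n)) => on.
- (* the rotation by q_n moves to the left: use the inverse relation *)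
  have DE : D = - d n.+1 by rewrite /D -signr_odd on expr1 mulN1r.
  have [N [mN N0 sN]] := ae_shift (d n.+1) base.
  have rel (v : R) : ~ N v -> 2 * (`|v| + d n.+1) < d n ->
      f (M%:R * alpha + (v + d n.+1)) = zt^-1 *
      (if 0 <= v then (if beta' <= v then 1 else chi^-1)
       else (if beta' <= v then chi else 1)) * f (M%:R * alpha + v).
    move=> nN hv; have : f (M%:R * alpha + v) =
      zt * (if 0 <= v then (if beta' <= v then 1 else chi)
         else (if beta' <= v then chi^-1 else 1)) * f (M%:R * alpha + (v + d n.+1)).
      apply: contrapT => h; apply: nN; apply: sN => /=.
      rewrite DE addrK => h'; apply: h; apply: h'.
        by have := normr_ge0 v; lra.
      by apply: le_lt_trans (ler_normB _ _) _; lra.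
    move=> ->; move: (f _) => g.
    by case: ifP => _; case: ifP => _; field; rewrite ?zt0 ?chi0.
  case: (leP 0 beta') => b0.
    exists zt^-1, chi^-1, (d n.+1), (beta' + d n.+1); split.
    + exact: nmV.
    + by right.
    + by rewrite ger0_norm // lerDr b0; split=> //; ring.
    + by rewrite gtr0_norm // lerDr.
    exists N; split=> // v nv; apply: contrapT => nN; apply: nv => hv.
    rewrite rel // lerDr ltrD2r; congr (_ * _ * _).
    by case: (leP 0 v) => v0 /=; case: (leP beta' v) => v1 //=; exfalso;
    move: v0 v1 b0; move: (v : R) => w; lra.
  exists zt^-1, chi, (beta' + d n.+1), (d n.+1); split.
  + exact: nmV.
  + by left.
  + by rewrite ltr0_norm //; split; lra.
  + by apply: le_trans (ler_normD _ _) _; rewrite (gtr0_norm d1).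
  exists N; split=> // v nv; apply: contrapT => nN; apply: nv => hv.
  rewrite rel // lerD2r gtrDr; congr (_ * _ * _).
  by case: (leP 0 v) => v0 /=; case: (leP beta' v) => v1 //=; exfalso;
    move: v0 v1 b0; move: (v : R) => w; lra.
have DE : D = d n.+1 by rewrite /D -signr_odd (negbTE on) expr0 mul1r.
have [N [mN N0 sN]] := base.
have rel (v : R) : ~ N v -> 2 * (`|v| + d n.+1) < d n ->
    f (M%:R * alpha + (v + d n.+1)) = zt *
    (if 0 <= v + d n.+1 then (if beta' <= v + d n.+1 then 1 else chi)
     else (if beta' <= v + d n.+1 then chi^-1 else 1)) * f (M%:R * alpha + v).
  move=> nN hv; apply: contrapT => h; apply: nN; apply: sN => /=.
  rewrite DE => h'; apply: h; have h1 : `|v + d n.+1| <= `|v| + d n.+1.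
    by apply: le_trans (ler_normD _ _) _; rewrite (gtr0_norm d1).
  have nv := normr_ge0 v; apply: h'; first by lra.
  by apply: le_lt_trans (ler_normB _ _) _; lra.
case: (leP 0 beta') => b0.
  exists zt, chi, 0, beta'; split => //.
  + by left.
  + by rewrite ger0_norm // subr0.
  + by rewrite normr0 addr_ge0 // ltW.
  exists N; split=> // v nv; apply: contrapT => nN; apply: nv => hv.
  rewrite rel //; congr (_ * _ * _).
  by case: (leP 0 (v + d n.+1)) => v0 /=; case: (leP beta' (v + d n.+1)) => v1 //=; exfalso;
    move: v0 v1 b0; move: (v + d n.+1 : R) => w; lra.
exists zt, chi^-1, beta', 0; split => //.
+ by right.
+ by rewrite ltr0_norm // sub0r; split=> //; exact: ltW.
+ by rewrite lerDl ltW.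
exists N; split=> // v nv; apply: contrapT => nN; apply: nv => hv.
rewrite rel //; congr (_ * _ * _).
by case: (leP 0 (v + d n.+1)) => v0 /=; case: (leP beta' (v + d n.+1)) => v1 //=; exfalso;
    move: v0 v1 b0; move: (v + d n.+1 : R) => w; lra.
Qed.

End local_relation.

Section digit_cost.
Variables (R : realType) (alpha beta : R) (omega chi : R[i]) (f : R -> R[i]).
Hypothesis Ha : irrational01 alpha.
Hypotheses (omega1 : nm omega = 1) (chi1 : nm chi = 1) (chiN1 : chi != 1).
Hypotheses (bf : cbm f) (pf : periodic1 f) (f1 : forall v, nm (f v) = 1).
Notation mu := (@lebesgue_measure R).
Notation Q := (cfQ alpha).
Notation d := (cfd alpha).
Hypothesis Hf : {ae mu, forall x, f (x + alpha) = omega * chi ^ (ccount beta x) * f x}.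

Lemma cwin_translate (h l y : R) : cwin (fun v => f (v + h)) l y = cwin f l (y + h).
Proof. by rewrite /cwin cint_shift // addrAC. Qed.

Lemma nm_chiVX (k : nat) : nm (chi^-1 ^+ k - 1) = nm (chi ^+ k - 1).
Proof.
have chi0 : chi ^+ k != 0.
  by apply/eqP => c0; move: (nmX chi k); rewrite c0 nm0 chi1 expr1n => /esym/eqP; rewrite oner_eq0.
rewrite exprVn -[LHS]mul1r -(expr1n _ k) -chi1 -nmX -nmM mulrBr divff // mulr1.
by rewrite nm_distC.
Qed.

Definition gapfun (dl : R) (e : nat) (x : R) : R :=
  nm (cwin f dl (x + e%:R * dl) - cwin f dl x) ^+ 2.

Lemma bmeas_gapfun dl e : 0 <= dl -> bmeas (gapfun dl e).
Proof. by move=> dl0; exact: bmeas_nm_cwinB. Qed.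

(** On the segment around [M * alpha], either many windows oscillate, or the
    local estimates hold. *)
Lemma segment n (j z0 : int) (M q K i B : nat) (W : R) :
  let dl := d n.+1 in let b' := `|beta - j%:~R * alpha - z0%:~R| in
  let rho := `|b' - B%:R * dl| in let x0 := M%:R * alpha in
  q%:Z = Q n.+1 -> (1 <= M)%N -> (M <= q)%N -> j < M%:Z -> M%:Z <= q%:Z + j ->
  4 * b' <= d n -> W = b' + dl + 3 * K%:R * dl -> 2 * (W + dl) < d n ->
  (1 <= B)%N -> (8 * B <= K)%N -> (8 <= K)%N -> 16 * rho <= dl ->
  (K <= 2 * i)%N -> (i <= K)%N ->
  K%:R * (16^-1 ^+ 2 * dl / 8) <= wint (deficit f dl) (x0 - W) (x0 - W + 2 * W) \/
  (nm (chi - 1) ^+ 2 * (B%:R * dl ^+ 3) <=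
     64 * wint (gapfun dl 1) (x0 - W) (x0 - W + 2 * W) +
     32 * (wint (gapfun dl i) (x0 - W) (x0 - W + 2 * W) +
           wint (gapfun dl i.+1) (x0 - W) (x0 - W + 2 * W)) /\
   nm (chi ^+ B - 1) ^+ 2 * (K%:R * dl ^+ 3) <=
     96 * wint (gapfun dl i) (x0 - W) (x0 - W + 2 * W) +
     256 * rho ^+ 2 * (K%:R * dl)).
Proof.
move=> dl b' rho x0 qE M1 Mq jM Mj b'4 WE Wd B1 BK K8 rhos Ki iK.
have [zeta [chi' [l [r [z1 hchi [lr rl] lb HF]]]]] :=
  local_cocycle Ha omega1 chi1 pf Hf qE M1 Mq jM Mj b'4.
rewrite -/b' -/dl in rl lb HF.
have dl0 : 0 < dl by exact: cfd_gt0.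
have b'0 : 0 <= b' by exact: normr_ge0.
have K8r : 8 <= K%:R :> R by rewrite ler_nat.
have Kd : 8 * dl <= K%:R * dl by rewrite ler_wpM2r // ltW.
have chi'1 : nm chi' = 1 by case: hchi => ->; rewrite ?nmV.
have chi'X k : nm (chi' ^+ k - 1) = nm (chi ^+ k - 1).
  by case: hchi => -> //; exact: nm_chiVX.
have l1 : - (b' + dl) <= l by move: lb; rewrite ler_norml => /andP[].
have l2 : l <= b' + dl by move: lb; rewrite ler_norml => /andP[].
pose F v := f (v + x0).
have bF : cbm F by exact: cbm_shift.
have F1 v : nm (F v) = 1 by rewrite /F f1.
have HF' : {ae mu, forall v, l - 3 * K%:R * dl < v < l + 3 * K%:R * dl ->
    F (v + dl) = zeta * (if l <= v + dl < r then chi' else 1) * F v}.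
  case: HF => N [mN N0 sN]; exists N; split=> // v nv; apply: sN => /= h.
  apply: nv => /= /andP[v1 v2]; rewrite /F [v + dl + x0]addrC [v + x0]addrC; apply: h.
  have : `|v| <= W by rewrite ler_norml WE; apply/andP; split; lra.
  lra.
have x0W : x0 - W + 2 * W = x0 + W by ring.
case: (pselect (forall y, l - 2 * K%:R * dl <= y -> y <= l - dl ->
    15 * dl <= 16 * nm (cwin F dl y))) => [left|nleft].
  right; have gs e : local_gap F dl l K e <= wint (gapfun dl e) (x0 - W) (x0 - W + 2 * W).
    have bg := bmeas_gapfun e (ltW dl0).
    have -> : local_gap F dl l K e =
        wint (gapfun dl e) (l - 2 * K%:R * dl + x0) (l + K%:R * dl + x0).
      rewrite -(wint_shift (l - 2 * K%:R * dl) (l + K%:R * dl) x0 bg) /local_gap.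
      apply: eq_wint => v _.
      by rewrite /gapfun !cwin_translate [v + e%:R * dl + x0]addrAC.
    rewrite x0W; apply: wint_sub => //; first by move=> v; exact: sqr_ge0.
    - by rewrite WE; lra.
    - by lra.
    - by rewrite WE; lra.
  have rho2 : 16 * `|r - l - B%:R * dl| <= dl by rewrite rl.
  split.
    have := stretch_gap bF F1 dl0 z1 chi'1 HF' left BK rho2 iK K8.
    rewrite -[chi']expr1 chi'X expr1.
    move: (gs 1%N) (gs i) (gs i.+1); move: (local_gap F dl l K 1) (local_gap F dl l K i)
      (local_gap F dl l K i.+1) (wint (gapfun dl 1) _ _) (wint (gapfun dl i) _ _)
      (wint (gapfun dl i.+1) _ _) (nm (chi - 1) ^+ 2 * _) => X1 X2 X3 Y1 Y2 Y3 Z.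
    by move=> h1 h2 h3 h; lra.
  have := chi_gap bF F1 dl0 z1 chi'1 HF' left B1 BK rho2 Ki iK K8.
  rewrite chi'X rl; move: (gs i); move: (local_gap F dl l K i) (wint (gapfun dl i) _ _)
    (nm (chi ^+ B - 1) ^+ 2 * _) (256 * _ * _) => X1 Y1 Z1 Z2.
  by move=> h1 h; lra.
left; have [y0 [y1 y2 y3]] : exists y, [/\ l - 2 * K%:R * dl <= y, y <= l - dl &
    16 * nm (cwin F dl y) < 15 * dl].
  apply: contrapT => H; apply: nleft => y y1 y2; rewrite leNgt; apply/negP => y3.
  by apply: H; exists y; split.
have k16 : 0 < 16^-1 :> R by rewrite invr_gt0.
have k16' : 16^-1 <= 1 :> R by rewrite invf_le1 // ler1n.
have bD := bmeas_deficit bf (ltW dl0).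
have D0 x : 0 <= deficit f dl x by apply: deficit_ge0 => // v; rewrite f1.
pose u := x0 + y0 - (K%:R - 1) * dl.
have bad (k : 'I_K) : 16^-1 ^+ 2 * dl / 8 <=
    wint (deficit f dl) (u + k%:R * dl) (u + k%:R * dl + 16^-1 * dl / 4).
  apply: deficit_bad => //.
  have kK : k%:R + 1 <= K%:R :> R by rewrite natr1 ler_nat.
  have kd : k%:R * dl + dl <= K%:R * dl by rewrite -[X in _ + X]mul1r -mulrDl ler_wpM2r // ltW.
  have k0 : 0 <= k%:R * dl by rewrite mulr_ge0 // ltW.
  pose y := y0 - (K - k.+1)%N%:R * dl.
  have Kk : (K - k.+1)%N%:R = K%:R - 1 - k%:R :> R.
    by rewrite natrB // -natr1; ring.
  have e : u + k%:R * dl = y + x0 by rewrite /u /y Kk; ring.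
  have h1 : l - 3 * K%:R * dl <= y by rewrite /y Kk; lra.
  have h2 : y + (K - k.+1).+1%:R * dl <= l by rewrite -natr1 /y Kk; lra.
  have -> : nm (cwin f dl (u + k%:R * dl)) = nm (cwin F dl y0).
    rewrite e -cwin_translate -(subrK ((K - k.+1)%N%:R * dl) y0) -/y.
    by rewrite (window_before bF dl0 HF' h1 h2) nmM nmX z1 expr1n mul1r.
  have -> : (1 - 16^-1) * dl = 15 * dl / 16 by field.
  by rewrite ltr_pdivlMr // mulrC.
have -> (c : R) : K%:R * c = \sum_(k < K) c by rewrite sumr_const card_ord mulr_natl.
apply: le_trans (ler_sum _ (fun k _ => bad k)) _.
have kd0 : 0 <= 16^-1 * dl / 4 by rewrite divr_ge0 // mulr_ge0 // ltW.
have kd1 : 16^-1 * dl / 4 <= dl.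
  have : 16^-1 * dl <= dl by rewrite ler_piMl // ltW.
  by move: (16^-1 * dl) => t; lra.
apply: le_trans (wint_blocks u K bD D0 kd0 kd1) _.
rewrite x0W; apply: wint_sub => //.
- by rewrite /u WE; lra.
- by rewrite lerDl mulr_ge0 // ltW.
- by rewrite /u WE; lra.
Qed.

(** The part of the increment of the weighted sum of [energy_sum] that controls the
    first half of the shifts at scale [n]. *)
Definition energy n : R :=
  (Q n.+1)%:~R * ((pqn alpha n)./2)%:R / (2 * ((pqn alpha n)%:R * d n.+1)) *
  \sum_(0 <= k < (pqn alpha n)./2) cgap f (d n.+1) k.

Lemma energy_ge0 n : 0 <= energy n.
Proof.
apply: mulr_ge0; last by apply: sumr_ge0 => k _; exact: cgap_ge0.
apply: divr_ge0; first by rewrite mulr_ge0 // (cfQr_ge0 Ha).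
by have d1 := ltW (cfd_gt0 Ha n.+1); rewrite mulr_ge0 // mulr_ge0.
Qed.

Lemma energy_summable N : \sum_(0 <= n < N) energy n <= 2.
Proof.
have [bR bI] := bf.
have hR v : `|complex.Re (f v)| <= 1.
  have := f1 v; have := sqr_nm (f v) => e1 e2; rewrite e2 expr1n in e1.
  rewrite -(ler_sqr (normr_ge0 _)) ?nnegrE // real_normK ?num_real // expr1n.
  by rewrite e1 lerDl sqr_ge0.
have hI v : `|complex.Im (f v)| <= 1.
  have := f1 v; have := sqr_nm (f v) => e1 e2; rewrite e2 expr1n in e1.
  rewrite -(ler_sqr (normr_ge0 _)) ?nnegrE // real_normK ?num_real // expr1n.
  by rewrite e1 lerDr sqr_ge0.
have pR : periodic1 (@complex.Re R \o f) by move=> v /=; rewrite pf.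
have pI : periodic1 (@complex.Im R \o f) by move=> v /=; rewrite pf.
have sR := energy_sum Ha N bR pR hR; have sI := energy_sum Ha N bI pI hI.
apply: (le_trans _ (lerD sR sI)); rewrite -big_split /=.
apply: ler_sum => n _; rewrite /energy -mulrDr -big_split /=.
rewrite le_eqVlt; apply/orP; left; apply/eqP; congr (_ * _).
by apply: eq_bigr => k _; rewrite cgapE //; exact: ltW (cfd_gt0 Ha n.+1).
Qed.

(** Average over the pairs [i, i + 1] with [i] in the upper half of [0, K[. *)
Lemma pigeon (g : nat -> R) (K h : nat) : (forall k, 0 <= g k) -> (8 <= K)%N ->
  (K < h)%N -> exists i, [/\ (K <= 2 * i)%N, (i < K)%N &
    (g i + g i.+1) * K%:R <= 6 * \sum_(0 <= k < h) g k].
Proof.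
move=> g0 K8 Kh; set S := \sum_(0 <= k < h) _.
have S0 : 0 <= S by exact: sumr_ge0.
apply: contrapT => H.
have low i : (K - K./2 <= i < K)%N -> 6 * S <= (g i + g i.+1) * K%:R.
  move=> /andP[i1 i2]; rewrite leNgt; apply/negP => lt; apply: H; exists i.
  by split; [move: i1 (odd_double_half K); clear; lia|done|exact: ltW].
have part o : (o <= 1)%N -> \sum_(K - K./2 <= i < K) g (i + o)%N <= S.
  move=> o1; rewrite /S [leRHS](big_cat_nat (n := (K - K./2 + o)%N)) //=; last first.
    by move: o1 Kh (odd_double_half K) K8; clear; lia.
  rewrite [X in _ <= _ + X](big_cat_nat (n := (K + o)%N)) //=; last 2 first.
  - by rewrite leq_add2r leq_subr.
  - by move: o1 Kh; clear; lia.
  rewrite [X in _ <= _ + (X + _)]big_addn addnK ler_wpDl ?sumr_ge0 //.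
  by rewrite lerDl sumr_ge0.
have tot : (K./2)%:R * (6 * S) <= 2 * S * K%:R.
  have -> : (K./2)%:R * (6 * S) = \sum_(K - K./2 <= i < K) 6 * S.
    rewrite sumr_const_nat mulr_natl; congr (_ *+ _).
    by move: (odd_double_half K); clear; lia.
  apply: (@le_trans _ _ (\sum_(K - K./2 <= i < K) (g (i + 0)%N + g (i + 1)%N) * K%:R)).
    rewrite big_nat [leRHS]big_nat; apply: ler_sum => i hi.
    by rewrite addn0 addn1; exact: low.
  rewrite -mulr_suml big_split /= ler_wpM2r // mulr2n mulrDl mul1r.
  by apply: lerD; exact: part.
have K2 : K%:R <= 2 * (K./2)%:R + 1 :> R.
  by rewrite -natrM natr1 ler_nat; move: (odd_double_half K); clear; lia.
have K8r : 8 <= K%:R :> R by rewrite ler_nat.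
have Sle0 : S <= 0.
  rewrite leNgt; apply/negP => Sp; move: tot; apply/negP; rewrite -ltNge.
  have -> : 2 * S * K%:R = S * (2 * K%:R) by ring.
  have -> : K./2%:R * (6 * S) = S * (6 * K./2%:R) by ring.
  by rewrite ltr_pM2l //; move: (K%:R : R) (K./2%:R : R) K2 K8r => u v; lra.
apply: H; exists K.-1; split; [by move: K8; clear; lia|by move: K8; clear; lia|].
have gz k : (k < h)%N -> g k = 0.
  move=> kh; apply/eqP; rewrite eq_le g0 andbT; apply: le_trans Sle0.
  rewrite /S [leRHS](big_cat_nat (n := k)) ?(ltnW kh) //= [X in _ <= _ + X]big_ltn //.
  by rewrite ler_wpDl ?sumr_ge0 // lerDl sumr_ge0.
rewrite !gz ?addr0 ?mul0r ?mulr_ge0 //; move: K8 Kh; clear; lia.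
Qed.

Lemma cost1 (y X K a E c : R) : 0 <= y -> 0 < a -> 0 <= K ->
  1 <= 2 * (a * X) -> a <= 32 * K -> y * (X ^+ 2 * K) <= c * E ->
  y <= 128 * c * (a * E).
Proof.
move=> y0 a0 K0 aX aK h.
have s : 1 <= 4 * (a * X) ^+ 2.
  have -> : 4 * (a * X) ^+ 2 = (2 * (a * X)) ^+ 2 by ring.
  by rewrite exprn_ege1.
rewrite -(ler_pM2r a0).
apply: le_trans (_ : y * (32 * K) <= _); first by rewrite ler_wpM2l.
apply: le_trans (_ : y * (32 * K) * (4 * (a * X) ^+ 2) <= _).
  by rewrite ler_peMr // mulr_ge0 // mulr_ge0.
have -> : y * (32 * K) * (4 * (a * X) ^+ 2) = (128 * a ^+ 2) * (y * (X ^+ 2 * K)) by ring.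
have -> : 128 * c * (a * E) * a = 128 * a ^+ 2 * (c * E) by ring.
by rewrite ler_wpM2l // mulr_ge0 // sqr_ge0.
Qed.

Lemma cost2 (V P E c : R) : 0 <= E -> 0 <= c -> 1 <= 64 * P -> V * P ^+ 2 <= c * E ->
  V <= 64 ^+ 2 * (c * E).
Proof.
move=> E0 c0 P1 h; have cE : 0 <= 64 ^+ 2 * (c * E) by rewrite !mulr_ge0 // exprn_ge0.
case: (leP V 0) => V0; first exact: le_trans cE.
have s : 1 <= (64 * P) ^+ 2 by rewrite exprn_ege1.
apply: le_trans (_ : V * (64 * P) ^+ 2 <= _); first by rewrite ler_peMr // ltW.
by rewrite exprMn mulrCA ler_wpM2l // exprn_ge0.
Qed.

Lemma digit_geometry (dl dn d2 b' : R) (a B : nat) : 0 < dl -> 0 <= d2 -> d2 < dl ->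
  dn = a%:R * dl + d2 -> 0 <= b' -> 256 * b' <= dn ->
  256 * (B%:R * dl) <= 256 * b' + dl -> (1 <= B)%N ->
  let K := (a %/ 16)%N in
  [/\ (15 <= K)%N, (8 * B <= K)%N, (K < a./2)%N, a%:R <= 32 * K%:R :> R &
    dn <= 32 * (K%:R * dl) /\ 2 * (b' + dl + 3 * K%:R * dl + dl) < dn].
Proof.
move=> dl0 d20 d2dl dnE b'0 hb hB B1 K.
have aB : (256 * B < a + 2)%N.
  rewrite -(ltr_nat R) natrM natrD -(ltr_pM2r dl0) -mulrA (mulrDl a%:R).
  apply: le_lt_trans hB _; apply: le_lt_trans (_ : dn + dl < _); last first.
    have -> : a%:R * dl + 2 * dl = a%:R * dl + dl + dl by ring.
    by rewrite dnE ltrD2r ltrD2l.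
  by rewrite lerD2r.
have a254 : (254 < a)%N by move: aB B1; clear; lia.
have [aK aK2] : (16 * K <= a)%N /\ (a <= 16 * K + 15)%N.
  by rewrite /K; have := divn_eq a 16; have := ltn_pmod a (isT : (0 < 16)%N); clear; lia.
have K15 : (15 <= K)%N by move: aK2 a254; clear; lia.
have aKr : 16 * K%:R <= a%:R :> R by rewrite -natrM ler_nat.
have aKr2 : a%:R <= 16 * K%:R + 15 :> R by rewrite -natrM -natrD ler_nat.
have K15r : 15 <= K%:R :> R by rewrite ler_nat.
split=> //.
- by move: aK2 aB a254; clear; lia.
- by move: aK K15 (odd_double_half a); clear; lia.
- by move: (K%:R : R) (a%:R : R) K15r aKr2 => u v; lra.
have h64 : 64 * b' <= dn.
  have : (64%N)%:R * b' <= (256%N)%:R * b' by rewrite ler_wpM2r // ler_nat.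
  by move=> h; apply: le_trans h hb.
have KD : 16 * (K%:R * dl) <= a%:R * dl by rewrite mulrA ler_wpM2r // ltW.
have KD2 : a%:R * dl <= 16 * (K%:R * dl) + 15 * dl.
  have -> : 16 * (K%:R * dl) + 15 * dl = (16 * K%:R + 15) * dl by ring.
  by rewrite ler_wpM2r // ltW.
have KD3 : 15 * dl <= K%:R * dl by rewrite ler_wpM2r // ltW.
rewrite -!mulrA {hb hB aB a254 aKr aKr2}.
move: (K%:R * dl) (a%:R * dl) dnE KD KD2 KD3 => u v -> KD KD2 KD3 in h64 *.
by split; lra.
Qed.

(** A shift by one step is a shift by [i.+1] steps undone by one of [i] steps. *)
Lemma cgap1_le dl i : 0 <= dl -> cgap f dl 1 <= 2 * cgap f dl i + 2 * cgap f dl i.+1.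
Proof.
move=> dl0; have b1 := bmeas_gapfun 1 dl0.
have bi := bmeas_gapfun i dl0; have bi1 := bmeas_gapfun i.+1 dl0.
have p1 : periodic1 (gapfun dl 1).
  by move=> x; rewrite /gapfun addrAC !periodic1_cwin.
have e : cgap f dl 1 = pint (fun x => gapfun dl 1 (x + i%:R * dl)).
  by rewrite (pint_shift (i%:R * dl) b1 p1).
have -> : 2 * cgap f dl i + 2 * cgap f dl i.+1 =
    pint (fun x => 2 * gapfun dl i x + 2 * gapfun dl i.+1 x).
  by rewrite pintD; [rewrite !pintZ|exact: bmeasZ|exact: bmeasZ].
rewrite e; apply: pint_le.
- exact: (bmeas_shift _ b1).
- by apply: bmeasD; exact: bmeasZ.
move=> x; rewrite /gapfun; apply: sqr_le_sum2; first exact: nm_ge0.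
have -> : x + i%:R * dl + 1%:R * dl = x + i.+1%:R * dl.
  by rewrite -(natr1 i) mul1r mulrDl mul1r addrA.
rewrite [leRHS]addrC; apply: le_trans (nm_triangle (cwin f dl x) _ _) _.
by rewrite [X in _ + X <= _]nm_distC.
Qed.

(** Sum over the segments; the bad ones are few, since each of them has a large
    deficit. *)
Lemma counting (m : nat) (bad : pred 'I_m) (Dk G1 Gi Gj : 'I_m -> R)
    (badv Y Z r2 e T1 Ti Tj : R) :
  (forall k, 0 <= Dk k) -> (forall k, 0 <= G1 k) -> (forall k, 0 <= Gi k) ->
  (forall k, 0 <= Gj k) -> (forall k, bad k -> badv <= Dk k) ->
  (forall k, ~~ bad k -> Y <= 64 * G1 k + 32 * (Gi k + Gj k) /\ Z <= 96 * Gi k + r2) ->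
  \sum_k Dk k <= e -> \sum_k G1 k <= T1 -> \sum_k Gi k <= Ti -> \sum_k Gj k <= Tj ->
  exists nb ng : R, [/\ nb + ng = m%:R, 0 <= nb, nb * badv <= e &
    ng * Y <= 64 * T1 + 32 * (Ti + Tj) /\ ng * (Z - r2) <= 96 * Ti].
Proof.
move=> D0 G10 Gi0 Gj0 hb hg sD s1 si sj.
exists (\sum_k (bad k)%:R), (\sum_k (~~ bad k)%:R); split.
- rewrite -big_split /= -[m in RHS]card_ord -sum1_card natr_sum.
  by apply: eq_bigr => k _; case: (bad k); rewrite ?addr0 ?add0r.
- by apply: sumr_ge0 => k _; rewrite ler0n.
- apply: le_trans sD; rewrite mulr_suml; apply: ler_sum => k _.
  by case: (boolP (bad k)) => [/hb|_]; rewrite ?mul1r ?mul0r.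
split.
  apply: (@le_trans _ _ (\sum_k (64 * G1 k + 32 * (Gi k + Gj k)))).
    rewrite mulr_suml; apply: ler_sum => k _.
    case: (boolP (bad k)) => [_|/hg[]]; rewrite ?mul1r // mul0r.
    by apply: addr_ge0; apply: mulr_ge0 => //; exact: addr_ge0.
  rewrite big_split /= -!mulr_sumr big_split /=.
  by apply: lerD; rewrite ler_pM2l //; exact: lerD.
apply: (@le_trans _ _ (\sum_k (96 * Gi k))).
  rewrite mulr_suml; apply: ler_sum => k _.
  case: (boolP (bad k)) => [_|/hg[_]]; rewrite ?mul1r ?mul0r ?mulr_ge0 //.
  by rewrite lerBlDr.
by rewrite -mulr_sumr ler_pM2l.
Qed.

(** The bookkeeping of constants: [X] stands for q_n d_n, which is about 1/a. *)
Lemma cost_final (q dl a K B Z x2 T T1 E rho ng : R) :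
  0 < q -> 0 < dl -> 0 < a -> 0 < K -> 0 <= B -> 0 <= x2 -> 0 <= T -> 0 <= E ->
  q <= 4 * ng -> 1 <= 2 * (a * (q * dl)) -> a <= 32 * K ->
  q * (T * K) <= 36 * (dl * E) -> T1 <= 2 * T ->
  ng * (x2 * (B * dl ^+ 3)) <= 64 * T1 + 32 * T ->
  ng * (Z * (K * dl ^+ 3) - 256 * rho ^+ 2 * (K * dl)) <= 96 * T ->
  x2 * B <= 128 * (640 * 36) * (a * E) /\
  Z - 256 * (rho / dl) ^+ 2 <= 64 ^+ 2 * ((384 * 36) * E).
Proof.
move=> q0 dl0 a0 K0 B0 x20 T0 E0 qng aX aK qT T1T hY hZ.
have n0 n : 0 <= n%:R :> R by exact: ler0n.
have qK : 0 <= q * K by rewrite mulr_ge0 // ltW.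
have dl3 : 0 < dl ^+ 3 by rewrite exprn_gt0.
split.
  have y0 : 0 <= x2 * B by exact: mulr_ge0.
  apply: (@cost1 (x2 * B) (q * dl) K a E (640 * 36)) => //; first exact: ltW.
  have h1 : q * (x2 * (B * dl ^+ 3)) <= 640 * T.
    have p : 0 <= x2 * (B * dl ^+ 3) by rewrite mulr_ge0 // mulr_ge0 // ltW.
    apply: le_trans (ler_wpM2r p qng) _; rewrite -mulrA.
    by move: (ng * _) hY => u hY; lra.
  have h2 : q * K * (q * (x2 * (B * dl ^+ 3))) <= 640 * (36 * (dl * E)).
    apply: le_trans (ler_wpM2l qK h1) _.
    have -> : q * K * (640 * T) = 640 * (q * (T * K)) by ring.
    by apply: ler_wpM2l => //; exact: n0.
  rewrite -(ler_pM2r dl0).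
  have -> : x2 * B * ((q * dl) ^+ 2 * K) * dl = q * K * (q * (x2 * (B * dl ^+ 3))) by ring.
  have -> : 640 * 36 * E * dl = 640 * (36 * (dl * E)) by ring.
  exact: h2.
have c0 : 0 <= 384 * 36 :> R by apply: mulr_ge0; exact: n0.
apply: (@cost2 _ (q * dl * K) E (384 * 36) E0 c0).
- apply: le_trans aX _.
  have -> : 64 * (q * dl * K) = 2 * ((32 * K) * (q * dl)) by ring.
  by rewrite ler_pM2l // ler_wpM2r // mulr_ge0 // ltW.
pose V := Z * (K * dl ^+ 3) - 256 * rho ^+ 2 * (K * dl); rewrite -/V in hZ.
have h1 : q * V <= 384 * T.
  case: (leP V 0) => V0.
    apply: (@le_trans _ _ 0); first by rewrite mulr_ge0_le0 // ltW.
    by apply: mulr_ge0 => //; exact: n0.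
  apply: le_trans (ler_wpM2r (ltW V0) qng) _; rewrite -mulrA.
  by move: (ng * _) hZ => u hZ; lra.
have h2 : q * K * (q * V) <= 384 * (36 * (dl * E)).
  apply: le_trans (ler_wpM2l qK h1) _.
  have -> : q * K * (384 * T) = 384 * (q * (T * K)) by ring.
  by apply: ler_wpM2l => //; exact: n0.
rewrite -(ler_pM2r dl0).
have -> : (Z - 256 * (rho / dl) ^+ 2) * (q * dl * K) ^+ 2 * dl = q * K * (q * V).
  by rewrite /V; field; rewrite gt_eqF.
have -> : 384 * 36 * E * dl = 384 * (36 * (dl * E)) by ring.
exact: h2.
Qed.

(** The local estimates are summed over about [q / 2] disjoint segments; the window
    variations they produce are paid for by the energy at scale [n]. *)
Lemma digit_cost : exists (C : R) (N : nat), 0 <= C /\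
  forall n, (N <= n)%N -> forall (j z0 b : int),
  `|j|%:~R <= 256^-1 * (Q n.+1)%:~R :> R ->
  `|beta - j%:~R * alpha - z0%:~R| <= 256^-1 * d n ->
  `|beta - j%:~R * alpha - z0%:~R - (-1) ^+ n * (b%:~R * d n.+1)| <= 256^-1 * d n.+1 ->
  b != 0 ->
  (absz b)%:R <= C * ((pqn alpha n)%:R * energy n) /\
  nm (chi ^+ absz b - 1) ^+ 2 <= C * (energy n +
   (`|beta - j%:~R * alpha - z0%:~R - (-1) ^+ n * (b%:~R * d n.+1)| / d n.+1) ^+ 2).
Proof.
have ar1 (u v : R) : u <= 6 * v -> 6 * u <= 36 * v by lra.
have ar2 (u : R) : u <= 1 / 32 -> 32 * u <= 1 by lra.
have ar3 (x y m q : R) : x + y = m -> 16 * x <= q -> q <= 2 * m + 1 -> 16 <= q ->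
    q <= 4 * y by lra.
have ar4 (u : R) : 2 <= u -> u + 2 <= 2 * u by lra.
have chi10 : 0 < nm (chi - 1) ^+ 2.
  rewrite exprn_gt0 // lt_neqAle nm_ge0 andbT eq_sym.
  by apply: contra chiN1 => /eqP/nm_eq0/eqP; rewrite subr_eq0.
pose t : R := 16^-1 ^+ 4.
have t0 : 0 < t by rewrite exprn_gt0 // invr_gt0.
have [l0 l00 hl0] := deficit_small bf f1 (divr_gt0 t0 (ltr0Sn R 31)).
have [N0 hN0] : exists N0 : nat, forall n, (N0 <= n)%N -> d n.+1 <= l0.
  exists (Num.trunc l0^-1).+1 => n hn; apply: le_trans (cfd_le_inv Ha n) _.
  rewrite -[l0]invrK lef_pV2 ?posrE ?invr_gt0 //.
  by apply: ltW; apply: lt_trans (truncnS_gt _) _; rewrite ltr_nat ltnS.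
pose c1 : R := 640 * 36; pose c2 : R := 384 * 36.
have c10 : 0 <= c1 by apply: mulr_ge0; exact: ler0n.
have c20 : 0 <= c2 by apply: mulr_ge0; exact: ler0n.
pose C := 128 * c1 / nm (chi - 1) ^+ 2 + 64 ^+ 2 * c2 + 256.
have C1 : 0 <= 128 * c1 / nm (chi - 1) ^+ 2 
  by apply: divr_ge0; [exact: mulr_ge0 (ler0n _ _) c10|exact: ltW].
have C2 : 0 <= 64 ^+ 2 * c2 :> R.
  by apply: mulr_ge0 => //; apply: exprn_ge0; exact: ler0n.
have C0 : 0 <= C by apply: addr_ge0 (addr_ge0 C1 C2) (ler0n _ _).
have [CC1 CC2] : 128 * c1 / nm (chi - 1) ^+ 2 <= C /\ 64 ^+ 2 * c2 <= C.
  have h256 : 0 <= 256 :> R by exact: ler0n.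
  rewrite /C; split; first by rewrite -addrA lerDl addr_ge0.
  by rewrite addrAC lerDr addr_ge0.
have CC3 : 256 <= C by rewrite /C lerDr addr_ge0.
clearbody C; exists C, (N0 + 17)%N; split=> //.
have e256 : 256 * 256^-1 = 1 :> R by apply: divff; exact: lt0r_neq0 (ltr0Sn R 255).
move=> n hn j z0 b hj hb' hr b0.
set b' := `|beta - j%:~R * alpha - z0%:~R| in hb' *.
set r' := `|_ - _ * (b%:~R * _)| in hr *.
set dl := d n.+1 in hr *; set dn := d n in hb'.
have dl0 : 0 < dl by exact: cfd_gt0.
have dn0 : 0 < dn by exact: cfd_gt0.
have dn1 : dn <= 1 by exact: (cfd_le Ha (leq0n n)).
pose q := absz (Q n.+1); have qE : q%:Z = Q n.+1.
  by rewrite /q gez0_abs // cfQ_ge0.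
have qrE : (Q n.+1)%:~R = q%:R :> R by rewrite -qE.
have n1 : (0 < n)%N by move: hn; clear; lia.
have q16 : (16 <= q)%N.
  by have := cfQ_geid Ha n.-1; rewrite prednK // -qE; move: hn; clear; lia.
clearbody q.
set a := pqn alpha n.
have dnE : dn = a%:R * dl + d n.+2 by rewrite /dn (cfd_rec Ha n) -pqnrE.
have d2 := cfd_gt0 Ha n.+2; have d21 := cfdS_lt Ha n.+1; rewrite -/dl in d21.
pose B := absz b; have B1 : (1 <= B)%N by rewrite /B; move: b0; clear; lia.
have bB : `|(-1) ^+ n * (b%:~R * dl)| = B%:R * dl.
  rewrite normrM normrX normrN1 expr1n mul1r normrM (gtr0_norm dl0); congr (_ * _).
  by rewrite -intr_norm -abszE.
have hBb : B%:R * dl <= b' + 256^-1 * dl.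
  rewrite -bB; apply: le_trans (_ : _ <= b' + r') _; last by rewrite lerD2l.
  rewrite /b' /r'; set u := beta - _ - _; set v := _ * (_ * _).
  by rewrite -[v in leLHS](subKr u) ; apply: ler_normB.
have hrho : `|b' - B%:R * dl| <= r'.
  by rewrite /b' /r' -bB; exact: ler_dist_dist.
have b'0 : 0 <= b' by exact: normr_ge0.
have p256 : 0 < 256 :> R by exact: ltr0Sn.
have hB256 : 256 * (B%:R * dl) <= 256 * b' + dl.
  have h : 256 * (B%:R * dl) <= 256 * (b' + 256^-1 * dl) by rewrite (ler_pM2l p256).
  by apply: le_trans h _; rewrite mulrDr [256 * (256^-1 * dl)]mulrA e256 mul1r.
have hb256 : 256 * b' <= dn.
  have e : 256 * (256^-1 * dn) = dn by rewrite mulrA e256 mul1r.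
  by rewrite -e (ler_pM2l p256).
have [] := digit_geometry dl0 (ltW d2) d21 dnE b'0 hb256 hB256 B1.
set K := (a %/ 16)%N => K15 BK Kh aK32 [KD2 Wd'].
clearbody K.
have K8 : (8 <= K)%N by exact: leq_trans K15.
pose h := a./2.
pose W := b' + dl + 3 * K%:R * dl.
have Wd : 2 * (W + dl) < dn by [].
have W0 : 0 <= W.
  apply: addr_ge0; first exact: addr_ge0 b'0 (ltW dl0).
  by apply: mulr_ge0; [exact: mulr_ge0 (ler0n _ _) (ler0n _ _)|exact: ltW].
have b'4 : 4 * b' <= dn.
  apply: le_trans hb256; rewrite ler_wpM2r // ler_nat.
  by [].
have rho16 : 16 * `|b' - B%:R * dl| <= dl.
  apply: le_trans (_ : 16 * (256^-1 * dl) <= _).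
    by rewrite ler_pM2l //; exact: le_trans hrho hr.
  have e : 256 * (256^-1 * dl) = dl by rewrite mulrA e256 mul1r.
  rewrite -[leRHS]e; apply: ler_wpM2r; last by rewrite ler_nat.
  by apply: (mulr_ge0 _ (ltW dl0)); rewrite invr_ge0 ler0n.
have j8 : (8 * `|j| <= q%:Z).
  rewrite -(ler_int R) intrM -pmulrn; apply: le_trans (_ : 8 * (256^-1 * q%:R) <= _).
    by rewrite ler_pM2l // -qrE.
  have e : 256 * (256^-1 * q%:R) = q%:R :> R by rewrite mulrA e256 mul1r.
  rewrite -[leRHS]e; apply: ler_wpM2r; last by rewrite ler_nat.
  by apply: (mulr_ge0 _ (ler0n _ _)); rewrite invr_ge0 ler0n.
pose m := (q %/ 2)%N; pose M0 := ((q %/ 4).+1)%N.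
have mE : (2 * m <= q)%N /\ (q <= 2 * m + 1)%N.
  by rewrite /m; have := divn_eq q 2; have := ltn_pmod q (isT : (0 < 2)%N); clear; lia.
have M0E : (q < 4 * M0)%N /\ (4 * M0 <= q + 4)%N.
  by rewrite /M0; have := divn_eq q 4; have := ltn_pmod q (isT : (0 < 4)%N); clear; lia.
clearbody m M0.
pose xs (k : nat) : R := (M0 + k)%N%:R * alpha - W.
have sep k k' (z : int) : (k < k' < m)%N -> 2 * W < `|xs k - xs k' - z%:~R|.
  move=> /andP[kk k'm]; apply: (@lt_le_trans _ _ dn).
    by apply: le_lt_trans Wd; rewrite ler_pM2l // lerDl ltW.
  have -> : xs k - xs k' = (M0 + k)%N%:R * alpha - (M0 + k')%N%:R * alpha by rewrite /xs; ring.
  have [n' en] : exists n', n = n'.+1 by exists n.-1; rewrite prednK.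
  have mi : (M0 + k)%N != (M0 + k')%N by move: kk; clear; lia.
  have mk : (M0 + k)%N%:Z < Q n.+1.
    by rewrite -qE; move: kk k'm mE M0E q16; clear; lia.
  have mk' : (M0 + k')%N%:Z < Q n.+1.
    by rewrite -qE; move: kk k'm mE M0E q16; clear; lia.
  rewrite /dn en; rewrite en in mk mk'; exact: (cf_sep Ha z mi mk mk').
have W20 : 0 <= 2 * W by rewrite mulr_ge0.
have W21 : 2 * W < 1.
  apply: lt_le_trans dn1; apply: le_lt_trans Wd; rewrite ler_pM2l // lerDl; exact: ltW.
have pack g : bmeas g -> periodic1 g -> (forall x, 0 <= g x) ->
    \sum_(k < m) wint g (xs k) (xs k + 2 * W) <= pint g.
  by move=> bg pg gx; exact: packing bg pg gx W20 W21 sep.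
have packg e : \sum_(k < m) wint (gapfun dl e) (xs k) (xs k + 2 * W) <= cgap f dl e.
  apply: pack; first by apply: bmeas_gapfun; exact: ltW.
    by move=> x; rewrite /gapfun addrAC !periodic1_cwin.
  by move=> x; exact: sqr_ge0.
have l0dl : 0 < dl <= l0.
  by rewrite dl0 hN0 //; move: hn; clear; lia.
have packD : \sum_(k < m) wint (deficit f dl) (xs k) (xs k + 2 * W) <= t / 32.
  apply: le_trans (hl0 _ l0dl); apply: pack.
  - by apply: bmeas_deficit => //; exact: ltW.
  - exact: periodic1_deficit.
  - by move=> x; apply: deficit_ge0 => // v; rewrite f1.
have g0 k : 0 <= cgap f dl k by exact: cgap_ge0.
have [i [Ki iK hT]] := pigeon g0 K8 Kh.
set S := \sum_(0 <= k < h) _ in hT.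
have S0 : 0 <= S by exact: sumr_ge0.
have seg (k : 'I_m) : K%:R * (16^-1 ^+ 2 * dl / 8) <=
      wint (deficit f dl) (xs k) (xs k + 2 * W) \/
    (nm (chi - 1) ^+ 2 * (B%:R * dl ^+ 3) <=
     64 * wint (gapfun dl 1) (xs k) (xs k + 2 * W) +
     32 * (wint (gapfun dl i) (xs k) (xs k + 2 * W) +
           wint (gapfun dl i.+1) (xs k) (xs k + 2 * W)) /\
   nm (chi ^+ B - 1) ^+ 2 * (K%:R * dl ^+ 3) <=
     96 * wint (gapfun dl i) (xs k) (xs k + 2 * W) +
     256 * `|b' - B%:R * dl| ^+ 2 * (K%:R * dl)).
  have km := ltn_ord k.
  apply: (@segment n j z0 (M0 + k)%N q K i B W qE) => //; last exact: ltnW.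
  - by move: M0E q16; clear; lia.
  - by move: M0E mE q16 km; clear; lia.
  - by move: M0E j8; clear; lia.
  - by move: M0E mE q16 km j8; clear; lia.
pose badv : R := K%:R * (16^-1 ^+ 2 * dl / 8).
pose bad (k : 'I_m) : bool := `[< badv <= wint (deficit f dl) (xs k) (xs k + 2 * W) >].
have [nb [ng [nbg nb0 hnb [hY hZ]]]] : exists nb ng : R, [/\ nb + ng = m%:R, 0 <= nb, nb * badv <= t / 32 &
    ng * (nm (chi - 1) ^+ 2 * (B%:R * dl ^+ 3)) <=
      64 * cgap f dl 1 + 32 * (cgap f dl i + cgap f dl i.+1) /\
    ng * (nm (chi ^+ B - 1) ^+ 2 * (K%:R * dl ^+ 3) -
      256 * `|b' - B%:R * dl| ^+ 2 * (K%:R * dl)) <= 96 * cgap f dl i].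
  have w0 e (k : 'I_m) : 0 <= wint (gapfun dl e) (xs k) (xs k + 2 * W).
    by apply: wint_ge0 => v _; exact: sqr_ge0.
  apply: (@counting m bad (fun k => wint (deficit f dl) (xs k) (xs k + 2 * W))
    (fun k => wint (gapfun dl 1) (xs k) (xs k + 2 * W))
    (fun k => wint (gapfun dl i) (xs k) (xs k + 2 * W))
    (fun k => wint (gapfun dl i.+1) (xs k) (xs k + 2 * W))
    badv _ _ _ _ _ _ _ _ (w0 1%N) (w0 i) (w0 i.+1) _ _ packD (packg 1%N) (packg i) (packg i.+1)).
  - by move=> k; apply: wint_ge0 => v _; apply: deficit_ge0 => // w; rewrite f1.
  - by move=> k /asboolP.
  - by move=> k /asboolPn nk; case: (seg k).
have c1T := cgap1_le i (ltW dl0).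
have ci0 := g0 i; have ci1 := g0 i.+1.
have qrp : 0 < q%:R :> R by rewrite ltr0n; move: q16; clear; lia.
have h3 : a%:R <= 3 * h%:R :> R.
  rewrite -natrM ler_nat /h; move: (odd_double_half a) Kh K15; rewrite -/a; clear.
  by move: (a./2) => u; lia.
have a0 : 0 < a%:R :> R by rewrite ltr0n; exact: pqn_gt0.
have EE : energy n = q%:R * h%:R / (2 * (a%:R * dl)) * S.
  by rewrite /energy qrE.
have qS : q%:R * S <= 6 * (dl * energy n).
  have -> : 6 * (dl * energy n) = q%:R * S * (3 * h%:R / a%:R).
    by rewrite EE; field; rewrite !gt_eqF.
  rewrite ler_peMr //; first by rewrite mulr_ge0 // ltW.
  by rewrite ler_pdivlMr // mul1r.
have qT : q%:R * ((cgap f dl i + cgap f dl i.+1) * K%:R) <= 36 * (dl * energy n).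
  apply: le_trans (ler_wpM2l (ltW qrp) hT) _; rewrite mulrCA.
  exact: ar1 qS.
have nbq : 16 * nb <= q%:R.
  have bt : dn * t <= badv.
    have -> : badv = 32 * (K%:R * dl) * t by rewrite /badv /t; field.
    by rewrite ler_wpM2r // ltW.
  have h1 : nb * (dn * t) <= t / 32 by apply: le_trans hnb; rewrite ler_wpM2l.
  have h2 : nb * dn <= 1 / 32.
    by rewrite -(ler_pM2r t0) -mulrA [leRHS]mulrAC mul1r; exact: h1.
  have qd := cfQd_ge Ha n; rewrite qrE -/dn in qd.
  apply: le_trans (_ : 16 * nb * (2 * (q%:R * dn)) <= _).
    by rewrite ler_peMr // mulr_ge0.
  have -> : 16 * nb * (2 * (q%:R * dn)) = q%:R * (32 * (nb * dn)) by ring.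
  by apply: ler_piMr (ltW qrp) (ar2 _ h2).
have qng : q%:R <= 4 * ng.
  have q16r : 16 <= q%:R :> R by rewrite ler_nat.
  have mr : q%:R <= 2 * m%:R + 1 :> R by rewrite -natrM natr1 ler_nat; move: mE; clear; lia.
  exact: ar3 nbg nbq mr q16r.
have aX : 1 <= 2 * (a%:R * (q%:R * dl)).
  have := cfQdS_ge Ha n; rewrite qrE -/dl -(pqnrE Ha) -/a => h1; apply: le_trans h1 _.
  rewrite (mulrA 2); apply: ler_wpM2r; first exact: mulr_ge0 (ltW qrp) (ltW dl0).
  have : 2 <= a%:R :> R.
    have K15r : 15 <= K%:R :> R by rewrite ler_nat.
    rewrite ler_nat; move: Kh K15 (odd_double_half a); clear; lia.
  exact: ar4.
have K0r : 0 < K%:R :> R by rewrite ltr0n; move: K15; clear; lia.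
have T1T : cgap f dl 1 <= 2 * (cgap f dl i + cgap f dl i.+1) by rewrite mulrDr.
have hZ' : ng * (nm (chi ^+ B - 1) ^+ 2 * (K%:R * dl ^+ 3) -
      256 * `|b' - B%:R * dl| ^+ 2 * (K%:R * dl)) <= 96 * (cgap f dl i + cgap f dl i.+1).
  by apply: le_trans hZ _; rewrite ler_pM2l // lerDl.
have E0 := energy_ge0 n.
have [r1 r2] := cost_final qrp dl0 a0 K0r (ler0n _ B) (ltW chi10)
  (addr_ge0 ci0 ci1) E0 qng aX aK32 qT T1T hY hZ'.
split.
  have : B%:R <= 128 * (640 * 36) / nm (chi - 1) ^+ 2 * (a%:R * energy n).
    by rewrite mulrAC ler_pdivlMr // mulrC.
  move=> h1; apply: le_trans h1 _; rewrite ler_wpM2r // mulr_ge0 // ltW //.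
have r3 : nm (chi ^+ B - 1) ^+ 2 <= 64 ^+ 2 * c2 * energy n + 256 * (r' / dl) ^+ 2.
  rewrite -lerBlDr; apply: le_trans (_ : _ <= nm (chi ^+ B - 1) ^+ 2 -
     256 * (`|b' - B%:R * dl| / dl) ^+ 2) _; last first.
    by apply: le_trans r2 _; rewrite mulrA.
  rewrite lerD2l lerN2; apply: ler_wpM2l; first exact: ler0n.
  rewrite ler_sqr ?nnegrE ?(divr_ge0 (normr_ge0 _) (ltW dl0)) //.
  by rewrite ler_pM2r ?invr_gt0.
apply: le_trans r3 _; rewrite mulrDr; apply: lerD; apply: ler_wpM2r => //.
exact: sqr_ge0.
Qed.

End digit_cost.

(** * Summable sequences of nonnegative reals *)

Section bounded_series.
Variable R : realType.
Implicit Types g h : nat -> R.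

(** Convergence of a series of nonnegative terms, without limits. *)
Definition bsum g := exists C, forall N, \sum_(0 <= n < N) g n <= C.

Lemma bsum_le g h : (forall n, g n <= h n) -> bsum h -> bsum g.
Proof.
move=> gh [C hC]; exists C => N; apply: le_trans (hC N).
by apply: ler_sum => n _; exact: gh.
Qed.

Lemma bsumZ c g : 0 <= c -> bsum g -> bsum (fun n => c * g n).
Proof.
by move=> c0 [C hC]; exists (c * C) => N; rewrite -mulr_sumr ler_wpM2l.
Qed.

Lemma bsumD g h : bsum g -> bsum h -> bsum (fun n => g n + h n).
Proof. by move=> [C hC] [D hD]; exists (C + D) => N; rewrite big_split lerD. Qed.

Lemma sum_shift (V : nmodType) (M N : nat) (g : nat -> V) : \sum_(0 <= n < M + N) g n =
  \sum_(0 <= n < M) g n + \sum_(0 <= n < N) g (M + n)%N.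
Proof.
elim: N => [|N IH]; first by rewrite addn0 [X in _ + X]big_geq // addr0.
by rewrite addnS !big_nat_recr //= IH addrA.
Qed.

Lemma bsum_shift M g : (forall n, 0 <= g n) -> bsum (fun n => g (M + n)%N) -> bsum g.
Proof.
move=> g0 [C hC]; exists (\sum_(0 <= n < M) g n + C) => N.
apply: le_trans (_ : \sum_(0 <= n < M + N) g n <= _).
  by rewrite addnC sum_shift lerDl sumr_ge0.
by rewrite sum_shift lerD2l.
Qed.

Lemma bsum_unshift M g : (forall n, 0 <= g n) -> bsum g -> bsum (fun n => g (M + n)%N).
Proof.
move=> g0 [C hC]; exists C => N; apply: le_trans (hC (M + N)%N).
by rewrite sum_shift lerDr sumr_ge0.
Qed.

(** A bounded sequence dominated by summable terms plus half of its value two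
    steps later is summable: sum the inequality and absorb. *)
Lemma bsum_contraction (r u : nat -> R) : (forall n, 0 <= r n <= 1) -> bsum u ->
  (forall n, r n <= u n + r n.+2 / 2) -> bsum r.
Proof.
move=> r01 [C hC] h; exists (2 * C + 2) => N.
have e : \sum_(0 <= n < N) r n.+2 <= \sum_(0 <= n < N) r n + 2.
  elim: N => [|N IH]; first by rewrite !big_geq // add0r.
  have -> : \sum_(0 <= n < N.+1) r n.+2 = \sum_(2 <= n < N.+3) r n.
    by rewrite [RHS]big_add1 big_add1.
  have : \sum_(0 <= n < N.+3) r n = r 0%N + (r 1%N + \sum_(2 <= n < N.+3) r n).
    by rewrite big_ltn // big_ltn.
  rewrite (big_nat_recr N.+2) //= (big_nat_recr N.+1) //=.
  have /andP[a0 _] := r01 0%N; have /andP[a1 _] := r01 1%N.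
  have /andP[_ a2] := r01 N.+1; have /andP[_ a3] := r01 N.+2.
  move: (\sum_(2 <= _ < _) _) (\sum_(0 <= _ < _) _) => x y; lra.
have : \sum_(0 <= n < N) r n <= \sum_(0 <= n < N) (u n + r n.+2 / 2).
  by apply: ler_sum => n _; exact: h.
rewrite big_split /= -mulr_suml; move: (hC N) e.
move: (\sum_(0 <= n < N) r n) (\sum_(0 <= n < N) r n.+2) (\sum_(0 <= n < N) u n) => x y z.
lra.
Qed.

End bounded_series.

(** * The expansion of [beta] *)

Section expansion.
Variables (R : realType) (alpha beta : R) (omega chi : R[i]) (f : R -> R[i]).
Hypothesis Ha : irrational01 alpha.
Hypotheses (omega1 : nm omega = 1) (chi1 : nm chi = 1) (chiN1 : chi != 1).
Hypotheses (bf : cbm f) (pf : periodic1 f) (f1 : forall v, nm (f v) = 1).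
Notation Q := (cfQ alpha).
Notation d := (cfd alpha).
Hypothesis Hf : {ae (@lebesgue_measure R), forall x, f (x + alpha) =
  omega * chi ^ ccount beta x * f x}.

(** The integers j_n approximating [beta] at the scale of q_n differ by
    multiples of q_n; the cost of the digits is controlled by the energies. *)
Lemma digits : exists (M : nat) (jj zz : nat -> int) (b : nat -> int) (C : R),
  [/\ (0 < M)%N, 0 <= C,
   forall n, (M <= n)%N -> `|beta - (jj n)%:~R * alpha - (zz n)%:~R| <= d n,
   forall n, (M <= n)%N -> jj n.+1 - jj n = b n * Q n.+1 /\
     beta - (jj n.+1)%:~R * alpha - (zz n.+1)%:~R =
     beta - (jj n)%:~R * alpha - (zz n)%:~R - (-1) ^+ n * ((b n)%:~R * d n.+1)
   & forall n, (M <= n)%N ->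
     (absz (b n))%:R / (pqn alpha n)%:R <= C * energy alpha f n /\
     nm (chi ^+ absz (b n) - 1) ^+ 2 <= C * (energy alpha f n +
       (`|beta - (jj n.+1)%:~R * alpha - (zz n.+1)%:~R| / d n.+1) ^+ 2)].
Proof.
have ar1 (x : R) : 8 * x <= 1 -> x <= 4^-1 by lra.
have ar2 (x : R) : x <= 4^-1 -> x <= 1 by lra.
have [C [N2 [C0 cost]]] := digit_cost Ha omega1 chi1 chiN1 bf pf f1 Hf.
have e256 : 256 * 256^-1 = 1 :> R by apply: divff; exact: lt0r_neq0 (ltr0Sn R 255).
pose c : R := 256^-1; have c0 : 0 < c by rewrite invr_gt0; exact: ltr0Sn.
have c8 : 8 * c <= 1.
  have h : 8 <= 256 :> R by rewrite ler_nat.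
  by have := ler_wpM2r (ltW c0) h; rewrite [X in _ <= X]e256.
have c4 : c <= 4^-1 by exact: ar1.
have c1 : c <= 1 by exact: ar2.
rewrite -/c in cost e256; clearbody c.
have [N1 hN1] := approx_shift Ha omega1 chi1 chiN1 bf pf f1 Hf c0 c4.
have [jz hjz] : exists jz : nat -> int * int, forall n, (N1 <= n)%N ->
    `|(jz n).1|%:~R <= c * (Q n.+2)%:~R /\
    `|beta - (jz n).1%:~R * alpha - (jz n).2%:~R| <= c * d n.+1.
  have /choice[jz hjz] n : exists p : int * int, (N1 <= n)%N ->
      `|p.1|%:~R <= c * (Q n.+2)%:~R /\
      `|beta - p.1%:~R * alpha - p.2%:~R| <= c * d n.+1.
    case: (leqP N1 n) => [/hN1[j [z h]]|_]; first by exists (j, z).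
    by exists (0, 0).
  by exists jz.
pose jj n := (jz n.-1).1; pose zz n := (jz n.-1).2.
pose M := (N1 + N2).+1.
have hjj n : (M <= n)%N -> `|jj n|%:~R <= c * (Q n.+1)%:~R /\
    `|beta - (jj n)%:~R * alpha - (zz n)%:~R| <= c * d n.
  case: n => // n; rewrite ltnS => hn; apply: hjz; exact: leq_trans (leq_addr _ _) hn.
have hb n : exists b : int, (M <= n)%N -> jj n.+1 - jj n = b * Q n.+1 /\
     (jj n.+1 - jj n)%:~R * alpha - (zz n - zz n.+1)%:~R = (-1) ^+ n * (b%:~R * d n.+1).
  case: (leqP M n) => [hn|_]; last by exists 0.
  have [h1 h2] := hjj n hn; have [h3 h4] := hjj n.+1 (leqW hn).
  have [b e1 e2] : exists2 b : int, jj n.+1 - jj n = b * Q n.+1 &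
     (jj n.+1 - jj n)%:~R * alpha - (zz n - zz n.+1)%:~R = (-1) ^+ n * (b%:~R * d n.+1).
    apply: (digit Ha (ltW c0) c8).
    - apply: le_trans (_ : (`|jj n.+1| + `|jj n|)%:~R <= _).
        by rewrite ler_int; exact: ler_normB.
      rewrite intrD -[2]/(1 + 1) mulrDl mul1r mulrDl; apply: lerD => //.
      apply: le_trans h1 _; rewrite ler_wpM2l ?(ltW c0) // ler_int.
      exact: cfQ_leS.
    - have -> : (jj n.+1 - jj n)%:~R * alpha - (zz n - zz n.+1)%:~R =
          (beta - (jj n)%:~R * alpha - (zz n)%:~R) -
          (beta - (jj n.+1)%:~R * alpha - (zz n.+1)%:~R).
        by rewrite !intrB; ring.
      rewrite -[2]/(1 + 1) mulrDl mul1r mulrDl.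
      apply: le_trans (ler_normB _ _) _; apply: lerD => //.
      apply: le_trans h4 _; rewrite ler_wpM2l ?(ltW c0) //.
      exact: ltW (cfdS_lt Ha n).
  by exists b.
have [b hb'] := choice hb.
exists M, jj, zz, b, C; split=> //.
- move=> n hn; have [_ h] := hjj n hn; apply: le_trans h _.
  by rewrite ler_piMl // ltW // (cfd_gt0 Ha).
- move=> n hn; have [e1 e2] := hb' n hn; split=> //.
  by rewrite -e2 !intrB; ring.
move=> n hn; have [e1 e2] := hb' n hn.
have E0 := energy_ge0 f Ha n.
have p0 : 0 < (pqn alpha n)%:R :> R by rewrite ltr0n pqn_gt0.
have [->|b0] := eqVneq (b n) 0.
  rewrite absz0 expr0 subrr nm0 mul0r expr0n /=; split; first exact: mulr_ge0.
  by rewrite mulr_ge0 // addr_ge0 // sqr_ge0.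
have e3 : beta - (jj n.+1)%:~R * alpha - (zz n.+1)%:~R =
    beta - (jj n)%:~R * alpha - (zz n)%:~R - (-1) ^+ n * ((b n)%:~R * d n.+1).
  by rewrite -e2 !intrB; ring.
have [h1 h2] := hjj n hn; have [h3 h4] := hjj n.+1 (leqW hn).
have nN : (N2 <= n)%N by apply: leq_trans hn; rewrite leqW // leq_addl.
rewrite e3 in h4 *.
have [r1 r2] := cost n nN (jj n) (zz n) (b n) h1 h2 h4 b0.
by split=> //; rewrite ler_pdivrMr // -mulrA [energy _ _ _ * _]mulrC.
Qed.

(** The costs of the digits are summable with the energies; the relative remainders
    |beta - j_n alpha| / d_n inherit summability by [bsum_contraction]. *)
Lemma expansion : exists (b : nat -> int) (z : nat -> int),
  [/\ forall e : R, 0 < e -> exists N0 : nat, forall N, (N0 <= N)%N ->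
       `|beta - (\sum_(0 <= n < N) b n * cf_den alpha n)%:~R * alpha - (z N)%:~R| < e,
   bsum (fun n => (absz (b n))%:R / (pqn alpha n)%:R : R)
   & bsum (fun n => nm (chi ^+ absz (b n) - 1) ^+ 2)].
Proof.
have [M [jj [zz [b [C [M0 C0 hd hb hc]]]]]] := digits.
pose bb n := if (n < M)%N then (if n == 0%N then jj M else 0) else b n.
have hJ N : (M <= N)%N -> \sum_(0 <= n < N) bb n * cf_den alpha n = jj N.
  move=> /subnK <-; elim: (N - M)%N => [|k IH].
    rewrite add0n big_ltn // big_nat big1 => [|i /andP[i0 iM]].
      by rewrite addr0 /bb M0 /= mulr1.
    by rewrite /bb iM gtn_eqF // mul0r.
  rewrite addSn big_nat_recr //= IH /bb ltnNge leq_addl /=.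
  have [e _] := hb (k + M)%N (leq_addl _ _).
  by rewrite cf_den_cfQ -e addrC subrK.
exists bb, zz.
have bbE n : (M <= n)%N -> bb n = b n by rewrite /bb ltnNge => ->.
have Esum : bsum (energy alpha f) by exists 2; exact: energy_summable.
have E0 n := energy_ge0 f Ha n.
have sU : bsum (fun n => (absz (bb (M + n)%N))%:R / (pqn alpha (M + n))%:R : R).
  apply: bsum_le (bsumZ C0 (bsum_unshift M E0 Esum)) => n.
  by rewrite bbE ?leq_addr //; have [] := hc (M + n)%N (leq_addr _ _).
have u0 n : 0 <= (absz (bb n))%:R / (pqn alpha n)%:R :> R by rewrite divr_ge0.
have sU' := bsum_shift u0 sU.
pose g n := beta - (jj n)%:~R * alpha - (zz n)%:~R.
split=> //.
  move=> e e0; exists (M + (Num.trunc e^-1).+2)%N => N hN.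
  have MN : (M <= N)%N by apply: leq_trans hN; exact: leq_addr.
  rewrite hJ //; apply: le_lt_trans (hd N MN) _.
  have [N' eN] : exists N', N = N'.+1 by exists N.-1; rewrite (prednK (leq_trans M0 MN)).
  rewrite eN; apply: le_lt_trans (cfd_le_inv Ha N') _.
  rewrite -[e]invrK ltf_pV2 ?posrE ?invr_gt0 //.
  apply: lt_le_trans (truncnS_gt _) _; rewrite ler_nat -eN.
  by apply: leq_trans hN; exact: leq_trans (leqnSn _) (leq_addl _ _).
pose r n := `|g (M + n)%N| / d (M + n)%N.
pose u n := (absz (b (M + n)%N))%:R / (pqn alpha (M + n))%:R : R.
have su : bsum u by apply: bsum_le sU => n; rewrite /u bbE ?leq_addr.
have uP n : (absz (b (M + n)%N))%:R * d (M + n).+1 <= u n * d (M + n)%N.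
  have p0 : 0 < (pqn alpha (M + n))%:R :> R by rewrite ltr0n pqn_gt0.
  rewrite /u mulrAC ler_pdivlMr // -mulrA ler_wpM2l // (cfd_rec Ha (M + n)) pqnrE //.
  by rewrite mulrC lerDl ltW // (cfd_gt0 Ha).
have gP n : `|g (M + n)%N| <= (absz (b (M + n)%N))%:R * d (M + n).+1 + `|g (M + n).+1|.
  have [_ e] := hb (M + n)%N (leq_addr _ _); rewrite -/(g _) -/(g _) in e.
  have -> : g (M + n)%N = (-1) ^+ (M + n) * ((b (M + n)%N)%:~R * d (M + n).+1) +
      g (M + n).+1 by rewrite e addrC subrK.
  apply: le_trans (ler_normD _ _) _; rewrite lerD2r normrM normrX normrN1 expr1n mul1r.
  by rewrite normrM (gtr0_norm (cfd_gt0 Ha _)) -intr_norm -abszE.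
have sr : bsum r.
  apply: (bsum_contraction (u := fun n => u n + u n.+1)).
  - move=> n; have d0 := cfd_gt0 Ha (M + n).
    by rewrite /r divr_ge0 ?(ltW d0) //= ler_pdivrMr // mul1r hd // leq_addr.
  - by apply: bsumD => //; apply: (bsum_unshift 1 _ su) => n; rewrite /u divr_ge0.
  move=> n; have d0 := cfd_gt0 Ha (M + n).
  have d2 := cfd_gt0 Ha (M + n).+2.
  rewrite {1}/r ler_pdivrMr //; apply: le_trans (gP n) _.
  have h2 := gP n.+1; rewrite addnS in h2.
  have h3 := uP n.+1; rewrite addnS in h3.
  have h4 : u n.+1 * d (M + n).+1 <= u n.+1 * d (M + n)%N.
    by rewrite ler_wpM2l ?(ltW (cfdS_lt Ha _)) // /u divr_ge0.
  have h5 : `|g (M + n).+2| <= r n.+2 / 2 * d (M + n)%N.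
    rewrite /r !addnS; have h := cfdSS_le Ha (M + n).
    have -> : `|g (M + n).+2| / d (M + n).+2 / 2 * d (M + n)%N =
        `|g (M + n).+2| * (d (M + n)%N / (2 * d (M + n).+2)).
      by field; rewrite gt_eqF.
    have p2 : 0 < 2 * d (M + n).+2 by exact: mulr_gt0.
    by apply: ler_peMr => //; rewrite ler_pdivlMr // mul1r.
  rewrite !mulrDl; have h1 := uP n.
  apply: le_trans (lerD h1 h2) _; rewrite -addrA; apply: lerD => //.
  by apply: lerD h5; exact: le_trans h3 h4.
have sr2 : bsum (fun n => r n.+1 ^+ 2).
  apply: (@bsum_le _ _ (fun n => r n.+1)).
    move=> n; have d0 := cfd_gt0 Ha (M + n.+1); rewrite expr2 ler_piMl //.
      by rewrite /r divr_ge0 // ltW.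
    by rewrite /r ler_pdivrMr // mul1r hd // leq_addr.
  by apply: (bsum_unshift 1 _ sr) => n; rewrite /r divr_ge0 // (ltW (cfd_gt0 Ha _)).
apply: (bsum_shift (M := M)) => [n|]; first exact: sqr_ge0.
apply: bsum_le (bsumZ C0 (bsumD (bsum_unshift M E0 Esum) sr2)) => n.
rewrite bbE ?leq_addr //; have [_] := hc (M + n)%N (leq_addr _ _).
by rewrite /r addnS.
Qed.

End expansion.

(** * Transfer functions *)

Section hermite.
Variable R : realType.
Implicit Types x y h : R.

Lemma floor_addz y (k : int) : Num.floor (y + k%:~R) = Num.floor y + k.
Proof. by rewrite floorDrz ?intr_int // intrKfloor. Qed.

Lemma count_wrap (q c : nat) : (c <= q)%N -> (\sum_(r < q) (q <= c + r)%N)%N = c.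
Proof.
move=> cq; rewrite -(big_mkord xpredT (fun r => (q <= c + r)%N : nat)).
rewrite (big_cat_nat (n := (q - c)%N)) ?leq_subr //=.
rewrite big_nat big1 => [|i /andP[_ h]]; last first.
  by apply/eqP; rewrite eqb0 -ltnNge; move: h; clear; lia.
rewrite add0n big_nat (eq_bigr (fun=> 1%N)) => [|i /andP[h _]]; last first.
  by rewrite (_ : (q <= c + i)%N = true) //; move: h; clear; lia.
by rewrite -big_nat sum_nat_const_nat muln1; move: cq; clear; lia.
Qed.

Lemma hermite (q : nat) y : (0 < q)%N ->
  \sum_(r < q) Num.floor (y + r%:R / q%:R) = Num.floor (q%:R * y).
Proof.
move=> q0; have qp : 0 < q%:R :> R by rewrite ltr0n.
set N := Num.floor (q%:R * y).
have /andP[N1 N2] := floor_itv (q%:R * y); rewrite -/N in N1 N2.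
pose A := (N %/ q%:Z)%Z; pose c := `|(N %% q%:Z)%Z|%N.
have qz : (q%:Z != 0)%R by move: q0; clear; lia.
have cE : c%:Z = (N %% q%:Z)%Z by rewrite /c gez0_abs // modz_ge0.
have cq : (c < q)%N by have := ltz_pmod N (_ : 0 < q%:Z); rewrite -cE; move: q0; clear; lia.
have NE : N = A * q%:Z + c%:Z by rewrite cE /A; exact: divz_eq.
have E (r : 'I_q) : Num.floor (y + r%:R / q%:R) = A + (q <= c + r)%N.
  have rq := ltn_ord r.
  have yE : y + r%:R / q%:R = (q%:R * y + r%:R) / q%:R by field; rewrite gt_eqF.
  have [h1 h2] : ((A + (q <= c + r)%N) * q%:Z <= N + r%:Z) /\
      (N + r%:Z + 1 <= (A + (q <= c + r)%N + 1) * q%:Z).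
    by rewrite NE; case: leqP; move: cq rq; clear; nia.
  apply: floor_def; rewrite yE ler_pdivlMr // ltr_pdivrMr //.
  rewrite -(ler_int R) !intrD !intrM in h1; rewrite -(ler_int R) in h2.
  rewrite [X in X <= _]intrD [X in _ <= X]intrM in h2.
  apply/andP; split.
    by apply: le_trans h1 _; rewrite lerD2r.
  apply: lt_le_trans h2; rewrite intrD -addrA [r%:~R + _]addrC addrA ltrD2r.
  by move: N2; rewrite intrD.
rewrite (eq_bigr _ (fun r _ => E r)) big_split /= sumr_const card_ord.
rewrite -mulr_natr natz NE; congr (_ + _).
rewrite -[in RHS](count_wrap (ltnW cq)) (big_morph Posz PoszD (erefl (Posz 0))).
by apply: eq_bigr.
Qed.

Lemma hermite_perm (q : nat) (e o : int) : (0 < q)%N -> coprimez q e ->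
  exists K : int, forall y,
  \sum_(r < q) Num.floor (y + (e * r%:Z + o)%:~R / q%:R) = Num.floor (q%:R * y) + K.
Proof.
move=> q0 cop; have qp : 0 < q%:R :> R by rewrite ltr0n.
have qz : (q%:Z != 0)%R by move: q0; clear; lia.
pose v (r : nat) := e * r%:Z + o.
have gP (r : 'I_q) : (`|(v r %% q%:Z)%Z| < q)%N.
  have := ltz_pmod (v r) (_ : 0 < q%:Z); have := modz_ge0 (v r) qz.
  by move: q0; clear; lia.
pose g r := Ordinal (gP r).
have gE r : ((g r : nat)%:Z = v r %% q%:Z)%Z by rewrite /= gez0_abs // modz_ge0.
have gI : injective g.
  move=> r r' /(congr1 (fun i : 'I_q => (i : nat)%:Z)); rewrite /= !gE => h.
  have : (q%:Z %| v r - v r')%Z by rewrite -eqz_mod_dvd h.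
  have -> : v r - v r' = e * (r%:Z - r'%:Z) by rewrite /v; ring.
  rewrite Gauss_dvdzr // => /dvdzP[k hk].
  have rq := ltn_ord r; have rq' := ltn_ord r'.
  apply/val_inj => /=; move: hk rq rq'; move: (r : nat) (r' : nat) => x x'.
  case: k => [[|k]|k]; [clear; lia|have := leq_pmull q (ltn0Sn k)|
    have := leq_pmull q (ltn0Sn k); rewrite NegzE]; move: (k.+1) => l;
    rewrite ?mulNr -?PoszM; move: (l * q)%N => w; clear; lia.
exists (\sum_(r < q) (v r %/ q%:Z)%Z) => y; rewrite -hermite // [X in _ = X + _](reindex_inj gI).
rewrite -big_split /=; apply: eq_bigr => r _.
rewrite -floor_addz; congr Num.floor.
rewrite -[in LHS]/(v r) {1}(divz_eq (v r) q%:Z) -gE intrD intrM -!pmulrn.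
by rewrite mulrDl mulfK ?gt_eqF // addrCA addrC.
Qed.

(** The points [y + c / q] stay at distance at least [rho / q] from the integers. *)
Lemma floor_no_cross (q : nat) y h rho (c : int) : (0 < q)%N -> q%:R * `|h| <= rho ->
  rho <= frac (q%:R * y) < 1 - rho ->
  Num.floor (y + c%:~R / q%:R + h) = Num.floor (y + c%:~R / q%:R).
Proof.
move=> q0 hrho /andP[r1 r2]; have qp : 0 < q%:R :> R by rewrite ltr0n.
set A := Num.floor (y + _).
have yE : y + c%:~R / q%:R = (q%:R * y + c%:~R) / q%:R by field; rewrite gt_eqF.
have /andP[A1 A2] := floor_itv (y + c%:~R / q%:R); rewrite -/A in A1 A2.
rewrite yE ler_pdivlMr // in A1; rewrite yE ltr_pdivrMr // in A2.
rewrite /frac in r1 r2; set N := Num.floor (q%:R * y) in r1 r2.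
have /andP[N1 N2] := floor_itv (q%:R * y); rewrite -/N in N1 N2.
have h1 : A * q%:Z <= N + c.
  rewrite -ltzD1 -(ltr_int R) intrM !intrD; apply: le_lt_trans A1 _.
  by rewrite addrAC ltrD2r; move: N2; rewrite intrD.
have h2 : N + c + 1 <= (A + 1) * q%:Z.
  rewrite lezD1 -(ltr_int R) intrM intrD; apply: le_lt_trans A2.
  by rewrite lerD2r.
rewrite -(ler_int R) !intrM !intrD in h1; rewrite -(ler_int R) !intrM !intrD in h2.
have h3 : - rho <= q%:R * h <= rho.
  by rewrite -ler_norml normrM (ger0_norm (ltW qp)).
have /andP[h4 h5] := h3.
apply: floor_def; have -> : y + c%:~R / q%:R + h = (q%:R * y + c%:~R + q%:R * h) / q%:R.
  by field; rewrite gt_eqF.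
rewrite ler_pdivlMr // ltr_pdivrMr // !intrD.
move: (q%:R * y) (q%:R * h) h1 h2 h4 h5 r1 r2 => u v; rewrite -!pmulrn.
move: (A%:~R * q%:R) => w; rewrite !mulrDl !mul1r; move: ((A%:~R : R) * q%:R) => w'.
by move=> *; apply/andP; split; lra.
Qed.

(** The fractional parts of [q * y + v] and [q * y] have the same mean. *)
Lemma floor_shift_mean (q : nat) (v : R) : (0 < q)%N ->
  bmeas (fun y => (Num.floor (q%:R * y + v))%:~R - (Num.floor (q%:R * y))%:~R : R) /\
  pint (fun y => (Num.floor (q%:R * y + v))%:~R - (Num.floor (q%:R * y))%:~R) = v.
Proof.
move=> q0; have qp : 0 < q%:R :> R by rewrite ltr0n.
pose g y := frac (q%:R * y).
have bg : bmeas g.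
  have [m [M hM]] := bmeas_frac R; split; last by exists M => y; exact: hM.
  by apply: measurableT_comp m _; apply: measurable_funM.
have pg : periodic1 g by move=> y; rewrite /g mulrDr mulr1 pmulrn frac_int.
have E y : (Num.floor (q%:R * y + v))%:~R - (Num.floor (q%:R * y))%:~R =
    v + (g y - g (y + v / q%:R)).
  rewrite /g /frac mulrDr mulrCA divff ?gt_eqF // mulr1; ring.
rewrite (_ : (fun y => _) = (fun y => v + (g y - g (y + v / q%:R)))); last first.
  by apply/funext => y; rewrite E.
have bs := bmeas_shift (v / q%:R) bg; have bB := bmeasB bg bs.
split; first exact: bmeasD (bmeas_cst v) bB.
rewrite pintD //; last exact: bmeas_cst.
rewrite pint_cst; have -> : pint (fun y => g y - g (y + v / q%:R)) = 0; last by rewrite addr0.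
rewrite (_ : (fun y => _) = (fun y => g y + (-1) * g (y + v / q%:R))); last first.
  by apply/funext => y; rewrite mulN1r.
by rewrite pintD ?pintZ ?pint_shift ?mulN1r ?subrr //; exact: bmeasZ.
Qed.

End hermite.

Section transfer.
Variables (R : realType) (alpha : R) (q : nat) (p b : int).
Hypotheses (q0 : (0 < q)%N) (cop : coprimez q p).
Let D := q%:R * alpha - p%:~R.

Definition offset (i : nat) : int := if 0 < b then - i.+1%:Z else i%:Z.

(** A sum over the orbit of length |b| q, taken backwards or forwards according to the
    sign of [b]: its coboundary telescopes. *)
Definition transfer (y : R) : R := (sgz b)%:~R *
  \sum_(0 <= i < absz b * q) frac (y + (offset i)%:~R * alpha).

Lemma transfer_shift y :
  transfer (y + alpha) - transfer y = frac y - frac (y - b%:~R * D).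
Proof.
have qa : q%:R * alpha = D + p%:~R by rewrite /D subrK.
rewrite /transfer /offset -mulrBr -sumrB; case: b => [[|B]|B].
- by rewrite /= !mul0r subr0 subrr.
- rewrite sgz_def /= mul1r.
  pose g i : R := - frac (y - i%:R * alpha).
  rewrite (eq_bigr (fun i => g i.+1 - g i)) => [|i _]; last first.
    rewrite /g opprK [RHS]addrC; congr (frac _ - frac _).
      by rewrite mulrNz -pmulrn -(natr1 i); ring.
    by rewrite mulrNz -pmulrn mulNr.
  rewrite telescope_sumr // /g opprK mul0r subr0 [LHS]addrC; congr (_ - _).
  rewrite natrM -mulrA qa -[RHS](frac_int _ (- (B.+1%:Z * p))); congr frac.
  by rewrite mulrNz intrM -!pmulrn; ring.
rewrite sgz_def /= mulN1r.
pose g i : R := frac (y + i%:R * alpha).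
rewrite (eq_bigr (fun i => g i.+1 - g i)) => [|i _]; last first.
  by rewrite /g; congr (frac _ - _); rewrite -natr1 -pmulrn; ring.
rewrite telescope_sumr // /g opprB mul0r addr0; congr (_ - _).
rewrite natrM -mulrA qa -[RHS](frac_int _ (B.+1%:Z * p)); congr frac.
by rewrite NegzE mulrNz intrM -!pmulrn; ring.
Qed.

Lemma floor_blocks (e o : int) (B : nat) : coprimez q e -> exists K : int, forall y : R,
  \sum_(0 <= i < B * q) Num.floor (y + (e * i%:Z + o)%:~R / q%:R) =
  B%:Z * Num.floor (q%:R * y) + K.
Proof.
move=> ce; elim: B => [|B [K hK]]; first by exists 0 => y; rewrite big_geq // mul0r.
have [K' hK'] := hermite_perm R (e * (B * q)%N%:Z + o) q0 ce.
exists (K + K') => y; rewrite mulSn addnC sum_shift hK big_mkord.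
rewrite (eq_bigr (fun i : 'I_q => Num.floor (y +
    (e * i%:Z + (e * (B * q)%N%:Z + o))%:~R / q%:R))) => [|i _]; last first.
  by congr (Num.floor (_ + _%:~R / _)); rewrite PoszD mulrDr addrCA addrA.
by rewrite hK' -[B.+1]addn1 PoszD mulrDl mul1r addrACA.
Qed.

(** Away from the jumps of [frac (q y)], the fractional parts that make up the
    transfer function have the same integer parts as if [alpha] were [p / q], and
    Hermite's identity sums them. *)
Lemma transfer_good : exists C : R, forall y,
  (absz b)%:R * (q%:R * `|D|) <= frac (q%:R * y) < 1 - (absz b)%:R * (q%:R * `|D|) ->
  transfer y = b%:~R * frac (q%:R * y) + C.
Proof.
have qp : 0 < q%:R :> R by rewrite ltr0n.
have aE : alpha = (p%:~R + D) / q%:R by rewrite /D addrC subrK mulrAC divff ?mul1r // gt_eqF.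
pose e := if 0 < b then - p else p; pose o := if 0 < b then - p else 0.
have ce : coprimez q e by rewrite /e; case: ifP => // _; rewrite /coprimez gcdzN.
have offE i : offset i * p = e * i%:Z + o.
  by rewrite /offset /e /o; case: ifP => _; [rewrite -addn1 PoszD|]; ring.
have [K hK] := floor_blocks o (absz b) ce.
pose N := (absz b * q)%N.
pose C0 : R := \sum_(0 <= i < N) (offset i)%:~R * alpha.
exists ((sgz b)%:~R * (C0 - K%:~R)) => y hy; rewrite /transfer -/N.
have E : \sum_(0 <= i < N) frac (y + (offset i)%:~R * alpha) =
    (absz b)%:R * frac (q%:R * y) + (C0 - K%:~R).
  rewrite /frac sumrB big_split /= -/C0 sumr_const_nat subn0.
  have -> : \sum_(0 <= i < N) (Num.floor (y + (offset i)%:~R * alpha))%:~R =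
      ((absz b)%:Z * Num.floor (q%:R * y) + K)%:~R :> R.
    rewrite -hK rmorph_sum /= big_nat [RHS]big_nat; apply: eq_bigr => i /andP[_ iN].
    congr (_%:~R); rewrite -offE.
    have -> : y + (offset i)%:~R * alpha =
        y + (offset i * p)%:~R / q%:R + (offset i)%:~R * D / q%:R.
      by rewrite {1}aE intrM; field; rewrite gt_eqF.
    apply: floor_no_cross hy => //.
    rewrite normrM normfV (ger0_norm (ltW qp)) mulrCA divff ?gt_eqF // mulr1.
    rewrite normrM mulrA ler_wpM2r // -natrM.
    have : `|offset i| <= N%:Z by rewrite /offset; case: ifP; move: iN; clear; lia.
    by rewrite -(ler_int R) intr_norm.
  by rewrite intrD intrM -[y *+ N]mulr_natl /N natrM -pmulrn; ring.
rewrite E mulrDr mulrA; congr (_ * _ + _).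
by rewrite pmulrn -intrM -intEsg.
Qed.

End transfer.

Section phase.
Variables (R : realType) (alpha : R) (q : nat) (p b : int).
Hypotheses (q0 : (0 < q)%N) (cop : coprimez q p).
Let D := q%:R * alpha - p%:~R.
Let rho : R := (absz b)%:R * (q%:R * `|D|).

Definition sawtooth (y : R) : R := frac (q%:R * y) - 2^-1.

Lemma bmeas_fracq : bmeas (fun y : R => frac (q%:R * y)).
Proof.
have [m [M hM]] := bmeas_frac R; split; last by exists M => y; exact: hM.
by apply: measurableT_comp m _; apply: measurable_funM.
Qed.

Lemma bmeas_sawtooth : bmeas sawtooth.
Proof. by apply: bmeasB bmeas_fracq _; exact: bmeas_cst. Qed.

Lemma periodic1_sawtooth : periodic1 sawtooth.
Proof. by move=> y; rewrite /sawtooth mulrDr mulr1 pmulrn frac_int. Qed.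

Lemma sawtooth_le y : `|sawtooth y| <= 2^-1.
Proof. by have := frac_itv (q%:R * y); rewrite /sawtooth ler_norml; lra. Qed.

(** One digit changes the multiplicative cocycle by a coboundary whose phase is,
    outside a small set, a small multiple of a sawtooth of period [1 / q]. *)
Lemma digit_phase (s : R) (m : int) (x0 : R) : `|s * b%:~R - m%:~R| <= 1 ->
  exists psi : R -> R, [/\ bmeas psi, periodic1 psi,
   forall x, exists z : int, psi (x + alpha) - psi x =
     - s * (frac (x - x0 - b%:~R * D) - frac (x - x0)) - m%:~R * D + z%:~R
   & pint (fun x => `|psi x - (s * b%:~R - m%:~R) * sawtooth (x - x0)|) <= 4 * rho].
Proof.
set eps := s * _ - _ => eps1.
have qp : 0 < q%:R :> R by rewrite ltr0n.
have rho0 : 0 <= rho by rewrite !mulr_ge0.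
have [C hC] := transfer_good alpha b q0 cop; rewrite -/D -/rho in hC.
pose c := - s * C - eps / 2.
pose ph y := s * transfer alpha q b y - m%:~R * (q%:R * y) + c.
have phE y : rho <= frac (q%:R * y) < 1 - rho ->
    ph y = eps * sawtooth y - (m * Num.floor (q%:R * y))%:~R.
  move=> /hC; rewrite /ph => ->; rewrite /c /sawtooth intrM.
  have -> : q%:R * y = frac (q%:R * y) + (Num.floor (q%:R * y))%:~R by rewrite subrK.
  rewrite frac_int floor_addz (_ : Num.floor (frac _) = 0); last first.
    by apply: floor_def; rewrite add0r; exact: frac_itv.
  rewrite add0r; have -> : frac (frac (q%:R * y)) = frac (q%:R * y) by apply/frac_id/frac_itv.
  by rewrite /eps; field.
pose A := [set y : R | rho <= frac (q%:R * y) < 1 - rho].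
have mA : measurable A.
  have := bmeas_fracq.1 measurableT _ (measurable_itv `[rho, (1 - rho)[).
  by rewrite setTI; congr measurable; apply/seteqP; split=> y /=; rewrite in_itv.
pose g y := \1_A y * (eps * sawtooth y) + (1 - \1_A y) * frac (ph y).
have bph : bmeas (fun y => frac (ph y)).
  split; last first.
    by exists 1 => y; have /andP[h1 h2] := frac_itv (ph y); rewrite ger0_norm // ltW.
  apply: measurableT_comp (bmeas_frac R).1 _.
  apply: measurable_funD; last exact: measurable_cst.
  apply: measurable_funB; last by apply: measurable_funM => //; exact: measurable_funM.
  apply: (bmeasZ _ _).1; apply: bmeasZ; apply: bmeas_sum => i.
  exact: bmeas_shift (bmeas_frac R).
have bA := bmeas_indic mA.
have bg : bmeas g.
  apply: bmeasD.
    by apply: bmeasM bA _; apply: bmeasZ; exact: bmeas_sawtooth.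
  by apply: bmeasM bph; apply: bmeasB bA; exact: bmeas_cst.
have A1 y : \1_A (y + 1) = \1_A y :> R.
  rewrite !indicE; congr (nat_of_bool _)%:R; apply/idP/idP; rewrite !inE /A /=.
    by rewrite mulrDr mulr1 pmulrn frac_int.
  by rewrite mulrDr mulr1 pmulrn frac_int.
have ph1 y : frac (ph (y + 1)) = frac (ph y).
  rewrite -[RHS](frac_int _ (- (m * q%:Z))); congr frac; rewrite /ph.
  have -> : transfer alpha q b (y + 1) = transfer alpha q b y.
    rewrite /transfer; congr (_ * _); apply: eq_bigr => i _.
    by rewrite addrAC periodic1_frac.
  by rewrite mulrNz intrM -pmulrn; ring.
have pg : periodic1 g by move=> y; rewrite /g A1 ph1 periodic1_sawtooth.
have gph y : exists z : int, g y = ph y + z%:~R.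
  case: (boolP (rho <= frac (q%:R * y) < 1 - rho)) => h; rewrite /g indicE.
    rewrite mem_set // subrr mul0r addr0 mul1r; exists (m * Num.floor (q%:R * y)).
    by rewrite phE // subrK.
  rewrite memNset; last exact/negP.
  by rewrite mul0r add0r subr0 mul1r; exists (- Num.floor (ph y)); rewrite mulrNz.
exists (fun x => g (x - x0)); split.
- exact: (bmeas_shift (- x0) bg).
- by move=> x; rewrite addrAC pg.
- move=> x; rewrite (addrAC x alpha); have [z1 ->] := gph (x - x0 + alpha).
  have [z2 ->] := gph (x - x0); exists (z1 - z2 - m * p).
  have h := transfer_shift alpha q p b (x - x0); rewrite -/D in h.
  have -> : frac (x - x0 - b%:~R * D) = frac (x - x0) - (transfer alpha q b (x - x0 + alpha) -
     transfer alpha q b (x - x0)) by rewrite h; ring.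
  by rewrite /ph !intrB intrM /D; ring.
pose w (v y : R) : R := (Num.floor (q%:R * y + v))%:~R - (Num.floor (q%:R * y))%:~R.
have [b1 w1] := floor_shift_mean rho q0.
have [b2 w2] := floor_shift_mean (- rho) q0.
rewrite -/(w _) in b1 w1; rewrite -/(w _) in b2 w2.
have pw v : periodic1 (w v).
  move=> y; rewrite /w mulrDr mulr1 addrAC !(pmulrn _ q) !floor_addz !intrD; ring.
have bw : bmeas (fun y => 2 * w rho y + (-2) * w (- rho) y).
  by apply: bmeasD; apply: bmeasZ.
apply: (@le_trans _ _ (pint (fun x => 2 * w rho (x - x0) + (-2) * w (- rho) (x - x0)))).
  apply: pint_le.
  - apply: bmeas_norm; apply: bmeasB; first exact: (bmeas_shift (- x0) bg).
    by apply: bmeasZ; exact: (bmeas_shift (- x0) bmeas_sawtooth).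
  - exact: (bmeas_shift (- x0) bw).
  move=> x; move: (x - x0) => y.
  have -> : 2 * w rho y + (-2) * w (- rho) y =
     2 * (Num.floor (q%:R * y + rho) - Num.floor (q%:R * y - rho))%:~R :> R.
    by rewrite /w intrB; ring.
  case: (boolP (rho <= frac (q%:R * y) < 1 - rho)) => h; rewrite /g indicE.
    rewrite mem_set // subrr mul0r addr0 mul1r subrr normr0.
    by rewrite mulr_ge0 // ler0z subr_ge0; apply: le_floor; rewrite lerD2l; lra.
  rewrite memNset; last exact/negP.
  rewrite mul0r add0r subr0 mul1r.
  have f1 : 1 <= Num.floor (q%:R * y + rho) - Num.floor (q%:R * y - rho).
    have /andP[N1 N2] := floor_itv (q%:R * y); rewrite intrD in N2.
    move: h; rewrite negb_and -ltNge -leNgt /frac; set N := Num.floor (q%:R * y) in N1 N2 *.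
    have e1 (k : int) (v : R) : k%:~R <= v -> k <= Num.floor v by move=> h; rewrite floor_ge_int.
    have e2 (k : int) (v : R) : v < k%:~R -> Num.floor v < k by move=> h; rewrite floor_lt_int.
    case/orP => h.
      have a1 : N <= Num.floor (q%:R * y + rho) by apply: e1; lra.
      have a2 : Num.floor (q%:R * y - rho) < N by apply: e2; lra.
      by move: a1 a2; clear; lia.
    have a1 : N + 1 <= Num.floor (q%:R * y + rho) by apply: e1; rewrite intrD; lra.
    have a2 : Num.floor (q%:R * y - rho) < N + 1 by apply: e2; rewrite intrD; lra.
    by move: a1 a2; clear; lia.
  apply: (@le_trans _ _ 2); last by rewrite ler_peMr // ler1z.
  apply: le_trans (ler_normB _ _) _.
  have /andP[h1 h2] := frac_itv (ph y); rewrite (ger0_norm h1).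
  have : `|eps * sawtooth y| <= 1.
    rewrite normrM -[leRHS]mul1r; apply: ler_pM => //.
    by apply: le_trans (sawtooth_le y) _; rewrite invf_le1 // ler1n.
  by move: h2; clear; move: (frac _) `|_| => u v; lra.
rewrite (pint_shift (- x0) bw); last by move=> y; rewrite !pw.
rewrite pintD; [rewrite !pintZ // w1 w2; lra|exact: bmeasZ|exact: bmeasZ].
Qed.

End phase.

(** * Near orthogonality of sawtooth functions *)

Section correlation.
Variable R : realType.

Lemma pint_norm (g : R -> R) : bmeas g -> `|pint g| <= pint (fun x => `|g x|).
Proof. by move=> bg; exact: wint_norm. Qed.

Lemma pint_norm_le (g : R -> R) M : bmeas g -> (forall x, `|g x| <= M) -> `|pint g| <= M.
Proof.
move=> bg h; apply: le_trans (pint_norm bg) _; rewrite -[leRHS]pint_cst.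
by apply: pint_le => //; [exact: bmeas_norm|exact: bmeas_cst].
Qed.

Lemma pint_sqr_norm (g : R -> R) : bmeas g ->
  pint (fun x => `|g x|) ^+ 2 <= pint (fun x => g x ^+ 2).
Proof.
move=> bg; set c := pint _; have bn := bmeas_norm bg.
have b2 := bmeas_sqr bg.
have : 0 <= pint (fun x => g x ^+ 2 + ((- 2 * c) * `|g x| + c ^+ 2)).
  apply: pint_ge0 => x; rewrite -(real_normK (num_real (g x))).
  by have := sqr_ge0 (`|g x| - c); rewrite sqrrB; move: `|g x| => u; lra.
rewrite pintD //; last by apply: bmeasD; [exact: (bmeasZ (- 2 * c) bn)|exact: bmeas_cst].
rewrite pintD; [|exact: (bmeasZ (- 2 * c) bn)|exact: bmeas_cst]; rewrite pintZ //.
by rewrite pint_cst -/c; lra.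
Qed.

(** The jumps contribute to the mean variation as much as the slope does. *)
Lemma sawtooth_gap (q : nat) (h x0 : R) : (0 < q)%N -> 0 <= h ->
  pint (fun x => `|sawtooth q (x - h - x0) - sawtooth q (x - x0)|) <= 2 * (q%:R * h).
Proof.
move=> q0 h0; have qh : 0 <= q%:R * h by exact: mulr_ge0.
have [bw w] := floor_shift_mean (- (q%:R * h)) q0.
pose g (y : R) : R := (Num.floor (q%:R * y + - (q%:R * h)))%:~R - (Num.floor (q%:R * y))%:~R.
rewrite -/g in bw w.
have pg : periodic1 g.
  by move=> y; rewrite /g mulrDr mulr1 addrAC !(pmulrn _ q) !floor_addz !intrD; ring.
have bs := bmeas_shift (- x0) bw.
apply: (@le_trans _ _ (pint (fun x => (-1) * g (x - x0) + q%:R * h))).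
  apply: pint_le.
  - apply: bmeas_norm; apply: bmeasB; last exact: (bmeas_shift (- x0) (bmeas_sawtooth R q)).
    have := bmeas_shift (- h) (bmeas_shift (- x0) (bmeas_sawtooth R q)).
    exact.
  - by apply: bmeasD (bmeas_cst _); exact: (bmeasZ (-1) bs).
  move=> x; rewrite (addrAC x (- h)); move: (x - x0) => y.
  have g0 : g y <= 0.
    by rewrite /g subr_le0 ler_int; apply: le_floor; rewrite gerDl oppr_le0.
  have -> : sawtooth q (y - h) - sawtooth q y = - (q%:R * h) - g y.
    by rewrite /sawtooth /frac /g mulrDr mulrN; ring.
  by rewrite ler_norml; move: (q%:R * h) (g y) qh g0 => u v u0 v0; lra.
rewrite pintD; [|exact: (bmeasZ (-1) bs)|exact: bmeas_cst].
rewrite (pintZ (-1) bs) pint_cst (pint_shift (- x0) bw pg) w.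
by move: (q%:R * h) => u; lra.
Qed.

(** Averaging the shorter sawtooth over the translates by [k / Q ^ 2] kills it by
    Hermite's identity, while these translations barely move the longer one. *)
Lemma sawtooth_corr (q Q : nat) (x0 x1 : R) : (0 < q)%N -> (q <= Q)%N ->
  `|pint (fun x => sawtooth q (x - x0) * sawtooth Q (x - x1))| <= 2 * (q%:R / Q%:R).
Proof.
move=> q0 qQ; have Q0 : (0 < Q)%N by exact: leq_trans q0 qQ.
have Qp : 0 < Q%:R :> R by rewrite ltr0n.
pose u x := sawtooth q (x - x0); pose v x := sawtooth Q (x - x1).
pose h (k : nat) : R := k%:R / Q%:R / Q%:R.
have bu : bmeas u := bmeas_shift (- x0) (bmeas_sawtooth R q).
have bv : bmeas v := bmeas_shift (- x1) (bmeas_sawtooth R Q).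
have pu : periodic1 u by move=> x; rewrite /u addrAC periodic1_sawtooth.
have pv : periodic1 v by move=> x; rewrite /v addrAC periodic1_sawtooth.
have v2 x : `|v x| <= 2^-1 by exact: sawtooth_le.
have u2 x : `|u x| <= 2^-1 by exact: sawtooth_le.
set I := pint _; rewrite -/(u _) in I *.
pose J k := pint (fun x => u x * v (x + h k)).
have buv : bmeas (fun x => u x * v x) by exact: bmeasM.
have IJ k : (k < Q)%N -> `|I - J k| <= q%:R / Q%:R.
  move=> kQ; have h0 : 0 <= h k by rewrite /h !divr_ge0.
  have hQ : h k <= Q%:R^-1.
    by rewrite /h ler_piMl ?invr_ge0 // ler_pdivrMr // mul1r ler_nat ltnW.
  have bsu := bmeas_shift (- h k) bu; have bsv := bmeas_shift (h k) bv.
  have -> : J k = pint (fun x => u (x - h k) * v x).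
    rewrite /J -(pint_shift (- h k) (bmeasM bu bsv)).
      by congr pint; apply/funext => x; rewrite subrK.
    by move=> x; rewrite pu addrAC pv.
  have bD : bmeas (fun x => (u (x - h k) - u x) * v x).
    by apply: bmeasM bv; apply: bmeasB.
  have -> : I - pint (fun x => u (x - h k) * v x) = - pint (fun x => (u (x - h k) - u x) * v x).
    rewrite (_ : (fun x => (u (x - h k) - u x) * v x) = (fun x => u (x - h k) * v x + (-1) * (u x * v x))).
      rewrite pintD; [|exact: bmeasM|exact: (bmeasZ (-1) buv)].
      by rewrite (pintZ (-1) buv) mulN1r [RHS]opprB.
    by apply/funext => x; ring.
  rewrite normrN; apply: le_trans (pint_norm bD) _.
  have bn : bmeas (fun x => `|u (x - h k) - u x|) by apply: bmeas_norm; exact: bmeasB.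
  apply: (@le_trans _ _ (pint (fun x => 2^-1 * `|u (x - h k) - u x|))).
    apply: pint_le; [exact: bmeas_norm|exact: bmeasZ|move=> x].
    by rewrite normrM mulrC ler_wpM2r.
  rewrite pintZ // ler_pdivrMl //; apply: le_trans (sawtooth_gap x0 q0 h0) _.
  by rewrite ler_pM2l // ler_wpM2l.
have SJ : `|\sum_(k < Q) J k| <= 1.
  rewrite /J -pint_sum => [|k]; last exact: bmeasM bu (bmeas_shift _ bv).
  apply: pint_norm_le.
    by apply: bmeas_sum => k; exact: bmeasM bu (bmeas_shift _ bv).
  move=> x; rewrite -mulr_sumr normrM.
  have -> : \sum_(k < Q) v (x + h k) = frac (Q%:R * (Q%:R * (x - x1))) - 2^-1.
    pose y := Q%:R * (x - x1).
    rewrite (eq_bigr (fun k : 'I_Q => (y - 2^-1) + k%:R / Q%:R -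
      (Num.floor (y + k%:R / Q%:R))%:~R)) => [|k _]; last first.
      rewrite /v /sawtooth /frac /h.
      have -> : Q%:R * (x + k%:R / Q%:R / Q%:R - x1) = y + k%:R / Q%:R.
        by rewrite /y; field; rewrite gt_eqF.
      ring.
    rewrite sumrB big_split /= -(rmorph_sum (intmul 1)) /= hermite // sumr_const card_ord.
    rewrite -mulr_suml -[(y - 2^-1) *+ Q]mulr_natl -/y /frac.
    have -> n : \sum_(i < n) i%:R = (n%:R - 1) * n%:R / 2 :> R.
      elim: n => [|n IH]; first by rewrite big_ord0 mulr0 mul0r.
      by rewrite big_ord_recr /= IH -(natr1 n); field.
    by field; rewrite gt_eqF.
  rewrite -[leRHS]mul1r; apply: ler_pM => //.
    by apply: le_trans (u2 x) _; rewrite invf_le1 // ler1n.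
  by have := frac_itv (Q%:R * (Q%:R * (x - x1))); rewrite ler_norml; lra.
have E : Q%:R * I = \sum_(k < Q) (I - J k) + \sum_(k < Q) J k.
  by rewrite sumrB subrK sumr_const card_ord mulr_natl.
rewrite -(ler_pM2l Qp) -[X in X * `|_|](ger0_norm (ltW Qp)) -normrM E.
apply: le_trans (ler_normD _ _) _.
have -> : Q%:R * (2 * (q%:R / Q%:R)) = q%:R + q%:R :> R by field; rewrite gt_eqF.
apply: lerD; last by apply: le_trans SJ _; rewrite ler1n.
apply: le_trans (ler_norm_sum _ _ _) _.
apply: (@le_trans _ _ (\sum_(k < Q) q%:R / Q%:R)).
  by apply: ler_sum => k _; exact: IJ.
by rewrite sumr_const card_ord -[_ *+ Q]mulr_natl mulrC divfK // gt_eqF.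
Qed.

End correlation.

Section square_sum.
Variables (R : realType) (alpha : R).
Hypothesis Ha : irrational01 alpha.
Notation Q := (cfQ alpha).

Definition cfq (n : nat) : nat := absz (Q n.+1).

Lemma cfqE n : (cfq n)%:Z = Q n.+1.
Proof. by rewrite /cfq gez0_abs // cfQ_ge0. Qed.

Lemma cfq_gt0 n : (0 < cfq n)%N.
Proof. by have := cfQS_ge1 Ha n; rewrite -cfqE; clear; lia. Qed.

Lemma cfq_le n m : (n <= m)%N -> (cfq n <= cfq m)%N.
Proof.
move=> /subnK <-; elim: (m - n)%N => // k IH; apply: leq_trans IH _.
by rewrite addSn; have := @cfQ_leS _ _ Ha (k + n).+1 isT; rewrite -!cfqE; clear; lia.
Qed.

Lemma sum_cfq n : (\sum_(0 <= m < n.+1) cfq m <= 3 * cfq n)%N.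
Proof.
suff: (\sum_(0 <= m < n.+1) cfq m <= 3 * cfq n)%N /\
  (\sum_(0 <= m < n.+2) cfq m <= 3 * cfq n.+1)%N by case.
have l k := cfq_le (leqnSn k).
elim: n => [|n [IH1 IH2]].
  split; first by rewrite big_nat1; have := cfq_gt0 0; clear; lia.
  rewrite big_nat_recr // big_nat1 /=; have := l 0%N.
  by move: (cfq 0%N) (cfq 1%N) => u v; clear; lia.
split=> //; rewrite big_nat_recr // big_nat_recr //=.
have h := cfQS_leSS Ha n.+1; rewrite -!cfqE in h.
by move: h IH1 (l n); move: (\sum_(_ <= _ < _) _)%N => u; clear; lia.
Qed.

Lemma sum_cfqV n k :
  \sum_(n <= m < n + k) (cfq m)%:R^-1 <= 4 / (cfq n)%:R :> R.
Proof.
have p j : 0 < (cfq j)%:R :> R by rewrite ltr0n cfq_gt0.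
have h1 j : (cfq j.+1)%:R^-1 <= (cfq j)%:R^-1 :> R.
  by rewrite lef_pV2 ?posrE // ler_nat cfq_le.
have h2 j : 2 * (cfq j.+2)%:R^-1 <= (cfq j)%:R^-1 :> R.
  rewrite -[2]invrK -invfM lef_pV2 ?posrE ?mulr_gt0 ?invr_gt0 // mulrC ler_pdivlMr //.
  by rewrite -natrM ler_nat; have := cfQ_leSS Ha j; rewrite -!cfqE; clear; lia.
have : \sum_(n <= m < n + k) (cfq m)%:R^-1 <=
    2 * (cfq n)%:R^-1 + 2 * (cfq n.+1)%:R^-1 :> R.
  elim: k n => [|k IH] n.
    rewrite addn0 big_geq // addr_ge0 // mulr_ge0 // invr_ge0 // ltW //.
  rewrite big_ltn ?addnS ?ltnS ?leq_addr // -addSn.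
  have := IH n.+1; have := h2 n.
  move: (\sum_(_ <= _ < _) _) => u; lra.
by have := h1 n; move: (\sum_(_ <= _ < _) _) => u; lra.
Qed.

Let weight (n m : nat) : R := if (n <= m)%N then (cfq n)%:R / (cfq m)%:R
  else (cfq m)%:R / (cfq n)%:R.

Lemma weight_sym n m : weight n m = weight m n.
Proof.
by rewrite /weight; case: ltngtP => // ->.
Qed.

Lemma sum_weight n M N : (n < N)%N -> \sum_(M <= m < N) weight n m <= 7.
Proof.
move=> nN; have p j : 0 < (cfq j)%:R :> R by rewrite ltr0n cfq_gt0.
have w0 j : 0 <= weight n j by rewrite /weight; case: ifP => _; rewrite divr_ge0.
apply: (@le_trans _ _ (\sum_(0 <= m < N) weight n m)).
  case: (leqP M N) => MN; last by rewrite big_geq ?(ltnW MN) // sumr_ge0.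
  by rewrite [leRHS](big_cat_nat (n := M)) //= lerDr sumr_ge0.
rewrite (big_cat_nat (n := n)) ?(ltnW nN) //=.
have -> : 7 = 3 + 4 :> R by lra.
apply: lerD.
  apply: (@le_trans _ _ (\sum_(0 <= m < n) (cfq m)%:R / (cfq n)%:R)).
    rewrite big_nat [leRHS]big_nat; apply: ler_sum => m /andP[_ mn].
    by rewrite /weight leqNgt mn.
  rewrite -mulr_suml ler_pdivrMr // -natr_sum -natrM ler_nat.
  by apply: leq_trans (sum_cfq n); rewrite big_nat_recr //= leq_addr.
rewrite -[N](subnKC (ltnW nN)).
apply: (@le_trans _ _ ((cfq n)%:R * (4 / (cfq n)%:R))); last first.
  by rewrite mulrCA divff ?mulr1 // gt_eqF.
apply: le_trans (ler_wpM2l (ltW (p n)) (sum_cfqV n (N - n))).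
rewrite mulr_sumr big_nat [leRHS]big_nat; apply: ler_sum => m /andP[nm _].
by rewrite /weight nm.
Qed.

(** Schur's test for the Gram matrix of the sawtooth functions. *)
Lemma sawtooth_square (e xs : nat -> R) M N :
  pint (fun x => (\sum_(M <= n < N) e n * sawtooth (cfq n) (x - xs n)) ^+ 2) <=
  14 * \sum_(M <= n < N) e n ^+ 2.
Proof.
pose u n x := sawtooth (cfq n) (x - xs n).
have bu n : bmeas (u n) := bmeas_shift (- xs n) (bmeas_sawtooth R (cfq n)).
have buu n m : bmeas (fun x => u n x * u m x) by exact: bmeasM.
have corr n m : `|pint (fun x => u n x * u m x)| <= 2 * weight n m.
  rewrite /weight; case: leqP => h; first exact: sawtooth_corr (cfq_gt0 n) (cfq_le h).
  rewrite (_ : (fun x => _) = (fun x => u m x * u n x)).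
    exact: sawtooth_corr (cfq_gt0 m) (cfq_le (ltnW h)).
  by apply/funext => x; rewrite mulrC.
have -> : pint (fun x => (\sum_(M <= n < N) e n * u n x) ^+ 2) =
    \sum_(M <= n < N) \sum_(M <= m < N) e n * e m * pint (fun x => u n x * u m x).
  rewrite (_ : (fun x => _) = (fun x => \sum_(M <= n < N) \sum_(M <= m < N)
      (e n * e m) * (u n x * u m x))); last first.
    apply/funext => x; rewrite expr2 mulr_suml; apply: eq_bigr => n _.
    by rewrite mulr_sumr; apply: eq_bigr => m _; ring.
  have bz n m : bmeas (fun x => (e n * e m) * (u n x * u m x)) by exact: bmeasZ.
  rewrite pint_sum => [|n]; last exact: bmeas_sum (bz n).
  apply: eq_bigr => n _; rewrite pint_sum => [|m]; last exact: bz.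
  by apply: eq_bigr => m _; rewrite pintZ.
pose W := \sum_(M <= n < N) \sum_(M <= m < N) (e n ^+ 2 + e m ^+ 2) * weight n m.
apply: (@le_trans _ _ W).
  apply: ler_sum => n _; apply: ler_sum => m _; apply: le_trans (ler_norm _) _.
  rewrite normrM; apply: le_trans (ler_wpM2l (normr_ge0 _) (corr n m)) _.
  rewrite mulrA; apply: ler_wpM2r.
    by rewrite /weight; case: ifP => _; rewrite divr_ge0.
  rewrite normrM -(real_normK (num_real (e n))) -(real_normK (num_real (e m))).
  have := sqr_ge0 (`|e n| - `|e m|); rewrite sqrrB.
  by move: `|e n| `|e m| => a b; lra.
have W1 : \sum_(M <= n < N) \sum_(M <= m < N) e n ^+ 2 * weight n m <=
    7 * \sum_(M <= n < N) e n ^+ 2.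
  rewrite mulr_sumr big_nat [leRHS]big_nat; apply: ler_sum => n /andP[_ nN].
  by rewrite -mulr_sumr mulrC ler_wpM2r ?sqr_ge0 // sum_weight.
have -> : W = 2 * \sum_(M <= n < N) \sum_(M <= m < N) e n ^+ 2 * weight n m.
  rewrite /W mulr2n mulrDl mul1r [X in _ = _ + X]exchange_big /= -big_split.
  apply: eq_bigr => n _; rewrite -big_split; apply: eq_bigr => m _ /=.
  by rewrite mulrDl (weight_sym m n).
by move: W1; move: (\sum_(_ <= _ < _) _) (\sum_(_ <= _ < _) _) => a b; lra.
Qed.

End square_sum.

(** * Almost everywhere convergence *)

Section series.
Variable R : realType.
Implicit Types g : nat -> R.
Notation mu := (@lebesgue_measure R).

Lemma bsum_lty g : (forall n, 0 <= g n) ->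
  (\sum_(0 <= n <oo) (g n)%:E < +oo)%E <-> bsum g.
Proof.
move=> g0; split=> [|[C hC]].
  move=> fin; exists (fine (\sum_(0 <= n <oo) (g n)%:E)%E) => N.
  have ge0 : (0 <= \sum_(0 <= n <oo) (g n)%:E)%E.
    by apply: nneseries_ge0 => n _ _; rewrite lee_fin.
  rewrite -lee_fin fineK ?ge0_fin_numE // -sumEFin.
  by apply: nneseries_lim_ge => n _; rewrite lee_fin.
apply: (@le_lt_trans _ _ C%:E); last exact: ltry.
apply: lime_le.
  by apply: is_cvg_nneseries => n _ _; rewrite lee_fin.
by apply: nearW => N; rewrite sumEFin lee_fin.
Qed.

Lemma bsum_cvg g : bsum (fun n => `|g n|) -> cvgn (series g).
Proof.
move=> h; apply: normed_cvg; apply: nnseries_is_cvg; first by move=> n; exact: normr_ge0.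
exact: (proj2 (@bsum_lty (fun n => `|g n|) (fun n => normr_ge0 _)) h).
Qed.

Lemma bsum_tail g e : (forall n, 0 <= g n) -> bsum g -> 0 < e ->
  exists N0, forall M N, (N0 <= M)%N -> \sum_(M <= n < N) g n <= e.
Proof.
move=> g0 [C hC] e0; pose E := [set x | exists N, x = \sum_(0 <= n < N) g n].
have hE : has_sup E.
  split; first by exists (\sum_(0 <= n < 0) g n), 0%N.
  by exists C => _ [N ->].
have [_ [N0 ->] h] := sup_adherent e0 hE.
exists N0 => M N hM; case: (leqP M N) => MN; last first.
  by rewrite big_geq ?(ltnW MN) // ltW.
have : \sum_(0 <= n < N) g n <= sup E by apply: ub_le_sup; [exact: hE.2|exists N].
rewrite (big_cat_nat (n := M)) //= (big_cat_nat (n := N0)) //=.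
have : 0 <= \sum_(N0 <= n < M) g n by exact: sumr_ge0.
by move: h; move: (\sum_(0 <= _ < _) _) (\sum_(N0 <= _ < _) _) (\sum_(M <= _ < _) _) => *; lra.
Qed.

Lemma ae_and (P P' : R -> Prop) : {ae mu, forall x, P x} -> {ae mu, forall x, P' x} ->
  {ae mu, forall x, P x /\ P' x}.
Proof.
move=> h1 h2; apply: (negligibleS _ (negligibleU h1 h2)) => x /= h.
by apply: contrapT => /not_orP[/contrapT p1 /contrapT p2]; exact: h.
Qed.

Lemma ae_mono (P P' : R -> Prop) : (forall x, P x -> P' x) ->
  {ae mu, forall x, P x} -> {ae mu, forall x, P' x}.
Proof. by move=> PP'; apply: negligibleS => x /= h /PP'. Qed.

Lemma ae_periodic (P : R -> Prop) : (forall x, P x -> P (x + 1)) ->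
  (forall x, P (x + 1) -> P x) ->
  {ae mu, forall x, 0 <= x <= 1 -> P x} -> {ae mu, forall x, P x}.
Proof.
move=> p1 p2 h.
have p1n (n : nat) x : P x -> P (x + n%:R).
  by move=> Px; elim: n => [|n IH]; rewrite ?addr0 // -natr1 addrA; exact: p1.
have p2n (n : nat) x : P (x + n%:R) -> P x.
  by elim: n x => [|n IH] x; rewrite ?addr0 // -natr1 addrA => /p2 /IH.
have a1 := @ae_foralln _ _ _ mu (fun n x => 0 <= x + n%:R <= 1 -> P (x + n%:R))
  (fun n => ae_shift n%:R h).
have a2 := @ae_foralln _ _ _ mu (fun n x => 0 <= x - n%:R <= 1 -> P (x - n%:R))
  (fun n => ae_shift (- n%:R) h).
apply: filterS2 a1 a2 => x h1 h2.
have /andP[f1 f2] := frac_itv x; rewrite /frac in f1 f2.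
case E : (Num.floor x) f1 f2 => [n|n] f1 f2.
  by rewrite -(subrK n%:R x); apply: p1n; apply: h2; rewrite f1 ltW.
rewrite NegzE mulrNz opprK in f1 f2.
by apply: (p2n n.+1); apply: h1; rewrite f1 ltW.
Qed.

(** The sum of the absolute values has a finite integral, hence is finite almost
    everywhere. *)
Lemma ae_series_cvg (g : nat -> R -> R) : (forall k, bmeas (g k)) ->
  (forall k, periodic1 (g k)) -> bsum (fun k => pint (fun x => `|g k x|)) ->
  {ae mu, forall x, cvgn (series (fun k => g k x))}.
Proof.
move=> bg pg hs.
apply: ae_periodic => [x|x|].
- by rewrite (_ : (fun k => g k (x + 1)) = (fun k => g k x)) //; apply/funext => k; exact: pg.
- by rewrite (_ : (fun k => g k (x + 1)) = (fun k => g k x)) //; apply/funext => k; exact: pg.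
pose f k x : \bar R := `|g k x|%:E.
have mD : measurable (`[0, 1] : set R) by exact: measurable_itv.
have mf n : measurable_fun (`[0, 1] : set R) (f n).
  by apply/measurable_EFinP; apply: measurable_funTS; have [] := bmeas_norm (bg n).
have f0 n x : [set` `[0, 1]] x -> (0 <= f n x)%E by move=> _; rewrite lee_fin.
have e := integral_nneseries mu mD mf f0.
have fint : mu.-integrable `[0, 1] (fun x => (\sum_(0 <= n <oo) f n x)%E).
  apply/integrableP; split.
    by apply: ge0_emeasurable_sum => [n x h _|n _]; [exact: f0 h|exact: mf].
  rewrite (_ : (fun x => _) = (fun x => (\sum_(0 <= n <oo) f n x)%E)); last first.
    apply/funext => x; by rewrite gee0_abs // nneseries_ge0 // => n _ _; rewrite lee_fin.
  rewrite e; have -> : (\sum_(0 <= n <oo) \int[mu]_(x in `[0%R, 1%R]) f n x)%E =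
      (\sum_(0 <= n <oo) (pint (fun x => `|g n x|))%:E)%E.
    apply: eq_eseriesr => n _; rewrite /pint /wint /Rintegral fineK //.
    apply: integrable_fin_num => //.
    by have := bmeas_int 0 1 (bmeas_norm (bg n)).
  by apply: (proj2 (bsum_lty _)) => // n; apply: pint_ge0.
have hfin : {ae mu, forall x : R, [set` `[0, 1]] x ->
    (\sum_(0 <= n <oo) f n x)%E \is a fin_num}.
  by apply: (integrable_ae _ fint); exact: measurable_itv.
case: hfin => N [mN N0 sN]; exists N; split=> // x nx; apply: sN => /= h.
apply: nx => x01; have := h; rewrite in_itv /= => /(_ x01) fin.
apply: normed_cvg; apply: nnseries_is_cvg; first by move=> n; exact: normr_ge0.
by move: fin; rewrite ge0_fin_numE //; apply: nneseries_ge0 => n _ _; rewrite lee_fin.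
Qed.

Lemma cvg_int (u : nat -> R) (k : nat -> int) l : (forall n, u n = (k n)%:~R) ->
  u @ \oo --> l -> exists z : int, l = z%:~R.
Proof.
move=> uk /cvgrPdist_lt h.
have /h[N _ hN] : 0 < 4^-1 :> R by rewrite invr_gt0.
have kc n : (N <= n)%N -> k n = k N.
  move=> Nn; have := hN n Nn; have := hN N (leqnn N); rewrite /= !uk => h1 h2.
  have : `|(k n - k N)%:~R| < 1 :> R.
    move: h1 h2; rewrite intrB !ltr_norml; move: (k n)%:~R (k N)%:~R => x y; lra.
  by rewrite -intr_norm -[1]/(1%:~R) ltr_int; lia.
exists (k N); apply/eqP; rewrite -subr_eq0 -normr_le0; apply/ler_addgt0Pr => e e0.
have [M _ hM] := h e e0.
have := hM (maxn M N) (leq_maxl _ _); rewrite /= uk kc ?leq_maxr // => /ltW.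
by rewrite add0r.
Qed.

End series.

(** * The coboundary built from the digits *)

Section sufficiency.
Variables (R : realType) (alpha s : R) (b : nat -> int).
Hypothesis Ha : irrational01 alpha.
Hypothesis hb : bsum (fun n => (absz (b n))%:R / (pqn alpha n)%:R : R).
Hypothesis hs : bsum (fun n => dist_int ((b n)%:~R * s) ^+ 2).
Notation d := (cfd alpha).
Notation Q := (cfQ alpha).
Notation mu := (@lebesgue_measure R).

Definition sgap (n : nat) : R := (-1) ^+ n * d n.+1.

(** The integers written [b_n s] in the expansion of t. *)
Definition rounded (n : nat) : int := nearest ((b n)%:~R * s).

Lemma sgapE n : sgap n = (cfq alpha n)%:R * alpha - (cfP alpha n.+1)%:~R.
Proof.
have := cfD Ha n.+1; rewrite -(cfqE Ha) /sgap -pmulrn => ->.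
by rewrite !exprS !mulN1r opprK.
Qed.

Lemma sgap_norm n : `|sgap n| = d n.+1.
Proof. by rewrite normrM normrX normrN1 expr1n mul1r gtr0_norm // (cfd_gt0 Ha). Qed.

Lemma cfq_coprime n : coprimez (cfq alpha n) (cfP alpha n.+1).
Proof.
have := cfdet alpha n; rewrite -(cfqE Ha) => h.
have e1 : (-1) ^+ n * ((cfq alpha n)%:Z * cfP alpha n - Q n * cfP alpha n.+1) = 1.
  by rewrite h -exprMn mulN1r opprK expr1n.
have : (gcdz (cfq alpha n) (cfP alpha n.+1) %|
    ((-1) ^+ n * ((cfq alpha n)%:Z * cfP alpha n - Q n * cfP alpha n.+1))%R)%Z.
  apply: dvdz_mull; apply: rpredB; first by apply: dvdz_mulr; exact: dvdz_gcdl.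
  by apply: dvdz_mull; exact: dvdz_gcdr.
by rewrite e1 dvdz1 /coprimez.
Qed.

Lemma digit_sgap_le n : `|(b n)%:~R * sgap n| <= (absz (b n))%:R / (pqn alpha n)%:R.
Proof.
have p0 : 0 < (pqn alpha n)%:R :> R by rewrite ltr0n pqn_gt0.
rewrite normrM sgap_norm -intr_norm -abszE; apply: ler_wpM2l => //.
rewrite -[leRHS]mul1r ler_pdivlMr //.
have := cfd_le Ha (leq0n n); rewrite (cfd_rec Ha n) -pqnrE // => h.
by rewrite mulrC; apply: le_trans h; rewrite lerDl ltW // (cfd_gt0 Ha).
Qed.

Lemma dist_int_half (x : R) : dist_int x <= 2^-1.
Proof. by have := floor_itv (x + 2^-1); rewrite /dist_int /nearest intrD ler_norml; lra. Qed.

Lemma rounded_le n : `|(rounded n)%:~R| <= (`|s| + 1) * (absz (b n))%:R :> R.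
Proof.
have nb : `|(b n)%:~R| = (absz (b n))%:R :> R by rewrite -intr_norm -abszE.
have [b0|b0] := eqVneq (b n) 0.
  rewrite /rounded b0 mul0r /nearest add0r (_ : Num.floor _ = 0) ?normr0 ?mulr0 //.
  by apply: floor_def; rewrite add0r invr_ge0 ler0n invf_lt1 // ltr1n.
have b1 : 1 <= (absz (b n))%:R :> R by rewrite ler1n absz_gt0.
have := dist_int_half ((b n)%:~R * s); rewrite /dist_int -/(rounded n) => h.
have -> : (rounded n)%:~R = (b n)%:~R * s - ((b n)%:~R * s - (rounded n)%:~R) :> R by ring.
apply: le_trans (ler_normB _ _) _; rewrite normrM nb mulrDl mul1r [`|s| * _]mulrC lerD2l.
by apply: le_trans h _; apply: le_trans b1; rewrite invf_le1 // ler1n.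
Qed.

Lemma digit_series_cvg : cvgn (series (fun n => (b n)%:~R * sgap n)).
Proof. by apply: bsum_cvg; apply: bsum_le hb => n; exact: digit_sgap_le. Qed.

Lemma rounded_series_cvg : cvgn (series (fun n => (rounded n)%:~R * sgap n)).
Proof.
apply: bsum_cvg; have s0 : 0 <= `|s| + 1 by rewrite addr_ge0.
apply: bsum_le (bsumZ s0 hb) => n.
rewrite normrM; apply: le_trans (ler_wpM2r (normr_ge0 _) (rounded_le n)) _.
rewrite -mulrA; apply: ler_wpM2l => //; have := digit_sgap_le n.
by rewrite normrM -intr_norm -abszE.
Qed.

Let xB := series (fun n => (b n)%:~R * sgap n).
Let eps n : R := s * (b n)%:~R - (rounded n)%:~R.

Let psi_spec n (psi : R -> R) := [/\ bmeas psi, periodic1 psi,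
   forall x, exists z : int, psi (x + alpha) - psi x =
     - s * (frac (x - xB n - (b n)%:~R * sgap n) - frac (x - xB n))
       - (rounded n)%:~R * sgap n + z%:~R
   & pint (fun x => `|psi x - eps n * sawtooth (cfq alpha n) (x - xB n)|) <=
     4 * ((absz (b n))%:R / (pqn alpha n)%:R)].

Lemma digit_phases : exists psi : nat -> R -> R, forall n, psi_spec n (psi n).
Proof.
suff h n : exists psi, psi_spec n psi by have [psi hp] := choice h; exists psi.
have e1 : `|eps n| <= 1.
  by rewrite /eps mulrC; apply: le_trans (dist_int_half _) _; rewrite invf_le1 // ler1n.
have [psi [h1 h2 h3 h4]] := digit_phase alpha (cfq_gt0 Ha n) (cfq_coprime n) (xB n) e1.
exists psi; split=> //; first by move=> x; have [z hz] := h3 x; exists z; rewrite sgapE.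
apply: le_trans h4 _; rewrite ler_pM2l //.
have p0 : 0 < (pqn alpha n)%:R :> R by rewrite ltr0n pqn_gt0.
apply: ler_wpM2l => //; rewrite -sgapE sgap_norm -[leRHS]mul1r ler_pdivlMr //.
have := cfaQdS_le Ha n; rewrite -pqnrE // -(cfqE Ha) -pmulrn mulrC; exact: le_trans.
Qed.

(** Outside small sets the phases are small multiples of nearly orthogonal
    functions, so their sums are Cauchy in mean. *)
Lemma phases_cauchy (psi : nat -> R -> R) e : (forall n, psi_spec n (psi n)) -> 0 < e ->
  exists N0, forall M N, (N0 <= M)%N ->
    pint (fun x => `|\sum_(M <= n < N) psi n x|) <= e.
Proof.
move=> hpsi e0.
have e2 : 0 < e / 2 by rewrite divr_gt0.
have e8 : 0 < (e / 2) ^+ 2 / 14 by rewrite divr_gt0 // exprn_gt0.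
have [N1 hN1] := bsum_tail (fun n => sqr_ge0 _) hs e8.
have u0 n : 0 <= (absz (b n))%:R / (pqn alpha n)%:R :> R by rewrite divr_ge0.
have e3 : 0 < e / 8 by rewrite divr_gt0.
have [N2 hN2] := bsum_tail u0 hb e3.
exists (maxn N1 N2) => M N; rewrite geq_max => /andP[M1 M2].
pose v n x := eps n * sawtooth (cfq alpha n) (x - xB n).
have bv n : bmeas (v n) := bmeasZ (eps n) (bmeas_shift (- xB n) (bmeas_sawtooth R _)).
have bpsi n : bmeas (psi n) by have [] := hpsi n.
have bw n : bmeas (fun x => `|psi n x - v n x|) by apply: bmeas_norm; exact: bmeasB.
have bV : bmeas (fun x => \sum_(M <= n < N) v n x) by exact: bmeas_sum.
have bnV := bmeas_norm bV.
have bW : bmeas (fun x => \sum_(M <= n < N) `|psi n x - v n x|) by exact: bmeas_sum.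
apply: (@le_trans _ _ (pint (fun x => `|\sum_(M <= n < N) v n x| +
    \sum_(M <= n < N) `|psi n x - v n x|))).
  apply: pint_le; [by apply: bmeas_norm; exact: bmeas_sum|exact: bmeasD|move=> x].
  rewrite -{1}[X in `|X|](subrK (\sum_(M <= n < N) v n x)) -sumrB addrC.
  apply: le_trans (ler_normD _ _) _; rewrite lerD2l; exact: ler_norm_sum.
rewrite pintD // pint_sum //; have -> : e = e / 2 + e / 2 by lra.
apply: lerD.
  rewrite -ler_sqr ?nnegrE ?(ltW e2) //; last exact: pint_ge0.
  apply: le_trans (pint_sqr_norm bV) _.
  apply: le_trans (sawtooth_square Ha eps xB M N) _.
  have := hN1 M N M1; rewrite ler_pdivlMr // mulrC.
  rewrite (eq_bigr (fun n => eps n ^+ 2)) // => n _.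
  by rewrite /eps /dist_int (mulrC s) real_normK ?num_real.
apply: (@le_trans _ _ (\sum_(M <= n < N) 4 * ((absz (b n))%:R / (pqn alpha n)%:R))).
  by apply: ler_sum => n _; have [] := hpsi n.
by rewrite -mulr_sumr; have := hN2 M N M2; move: (\sum_(_ <= _ < _) _) => x; lra.
Qed.

Lemma expi_exprz (x : R) (k : int) : expi x ^ k = expi (x * k%:~R).
Proof.
have N n y : expi y ^+ n = expi (y * n%:R).
  elim: n => [|n IH]; first by rewrite expr0 mulr0 expi0.
  by rewrite exprS IH -expiD -[n.+1%:R]natr1; congr expi; ring.
case: k => n; first exact: N.
by rewrite NegzE -exprnN N -expiN mulrNz mulrN -pmulrn.
Qed.

Lemma frac_cvg (u : nat -> R) l : u @ \oo --> l -> (forall z : int, l <> z%:~R) ->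
  frac (u n) @[n --> \oo] --> frac l.
Proof.
move=> ul lz.
have /andP[l1 l2] := floor_itv l; rewrite intrD in l2.
have l1' : 0 < l - (Num.floor l)%:~R.
  by rewrite subr_gt0 lt_neqAle l1 andbT eq_sym; apply/eqP; exact: lz.
have l2' : 0 < (Num.floor l)%:~R + 1 - l by rewrite subr_gt0.
have h : \forall n \near \oo, u n - (Num.floor l)%:~R = frac (u n).
  have ul' := ul; move/cvgrPdist_lt: ul' => ul'.
  have h1 := ul' _ l1'; have h2 := ul' _ l2'.
  near=> n; rewrite /frac; congr (_ - _%:~R); apply/esym/floor_def; rewrite intrD.
  have : `|l - u n| < l - (Num.floor l)%:~R by near: n.
  have : `|l - u n| < (Num.floor l)%:~R + 1 - l by near: n.
  by rewrite !ltr_norml => *; lra.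
apply: (cvg_trans (near_eq_cvg h)); apply: cvgB => //; exact: cvg_cst.
Unshelve. all: by end_near. Qed.


(** The phase of [f] is the limit of a rapidly Cauchy subsequence of the sums of
    phases. The equation holds modulo 1 for the partial sums, and passes to the limit
    because a limit of integers is an integer. *)
Theorem coboundary_exists (B S : R) : xB @ \oo --> B ->
  series (fun n => (rounded n)%:~R * sgap n) @ \oo --> S ->
  exists f : R -> R[i], [/\ cbm f, periodic1 f, forall v, nm (f v) = 1 &
    {ae mu, forall x, f (x + alpha) =
      expi (2 * pi * (s * B - S)) * expi (- (2 * pi * s)) ^ ccount B x * f x}].
Proof.
move=> hB hS; have [psi hpsi] := digit_phases.
have bpsi n : bmeas (psi n) by have [] := hpsi n.
have ppsi n : periodic1 (psi n) by have [] := hpsi n.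
have [N0 hN0] : exists N0 : nat -> nat, forall k M N, (N0 k <= M)%N ->
    pint (fun x => `|\sum_(M <= n < N) psi n x|) <= (1 / 2) ^+ k.
  suff h k : exists N0, forall M N, (N0 <= M)%N ->
      pint (fun x => `|\sum_(M <= n < N) psi n x|) <= (1 / 2) ^+ k.
    by have [N0 hN0] := choice h; exists N0.
  by apply: phases_cauchy => //; rewrite exprn_gt0 // divr_gt0.
pose Nk k := (\sum_(0 <= i < k.+1) N0 i + k)%N.
have NkS k : (Nk k < Nk k.+1)%N.
  by rewrite /Nk addnS ltnS leq_add2r [leqRHS]big_nat_recr //= leq_addr.
have Nk0 k : (N0 k <= Nk k)%N by rewrite /Nk big_nat_recr //= -addnA addnCA leq_addr.
have Nkk k : (k <= Nk k)%N by rewrite /Nk leq_addl.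
pose T N x := \sum_(0 <= n < N) psi n x.
pose g k x := \sum_(Nk k <= n < Nk k.+1) psi n x.
have bg k : bmeas (g k) by exact: bmeas_sum.
have pg k : periodic1 (g k) by move=> x; apply: eq_bigr => n _; exact: ppsi.
have TE k x : T (Nk k) x = T (Nk 0%N) x + series (fun k => g k x) k.
  elim: k => [|k IH]; first by rewrite /series /= big_geq // addr0.
  rewrite seriesSr addrA -IH /T (big_cat_nat (n := Nk k)) //=; exact: ltnW.
have hg : {ae mu, forall x, cvgn (series (fun k => g k x))}.
  apply: ae_series_cvg => //; exists 2 => K.
  apply: (@le_trans _ _ (\sum_(0 <= k < K) (1 / 2) ^+ k)).
    by apply: ler_sum => k _; exact: hN0.
  have -> : \sum_(0 <= k < K) (1 / 2) ^+ k = 2 - 2 * (1 / 2) ^+ K :> R.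
    elim: K => [|K IH]; first by rewrite big_geq // expr0 mulr1 subrr.
    by rewrite big_nat_recr //= IH exprS; field.
  by rewrite gerBl mulr_ge0 // exprn_ge0.
(* the limit superior is measurable and exactly periodic, and agrees with the
   limit almost everywhere *)
pose F x := fine (limn_esup (fun k => (T (Nk k) x)%:E)).
have FE x : cvgn (series (fun k => g k x)) -> T (Nk k) x @[k --> \oo] --> F x.
  move=> h; have hT : T (Nk k) x @[k --> \oo] --> T (Nk 0%N) x + limn (series (fun k => g k x)).
    rewrite (_ : (fun k => _) = (fun k => T (Nk 0%N) x + series (fun k => g k x) k)).
      by apply: cvgD => //; exact: cvg_cst.
    by apply/funext => k; rewrite TE.
  have hE : (T (Nk k) x)%:E @[k --> \oo] --> (T (Nk 0%N) x + limn (series (fun k => g k x)))%:E.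
    by apply: cvg_EFin => //; exact: nearW.
  by rewrite /F (cvg_limn_einf_sup hE).2.
have pF : periodic1 F.
  move=> x; rewrite /F; congr (fine (limn_esup _)); apply/funext => k.
  by congr EFin; apply: eq_bigr => n _; exact: ppsi.
have mF : measurable_fun [set: R] F.
  apply: (measurableT_comp (fine_measurable measurableT)).
  apply: measurable_fun_limn_esup => k; apply/measurable_EFinP.
  by have [] : bmeas (T (Nk k)) by exact: bmeas_sum.
exists (fun x => expi (2 * pi * F x)); split.
- have m2 : measurable_fun [set: R] (fun x => 2 * pi * F x).
    by apply: measurable_funM => //; exact: measurable_cst.
  split; split.
  + apply: measurableT_comp m2; apply: continuous_measurable_fun; exact: continuous_cos.
  + by exists 1 => x /=; rewrite ler_norml cos_geN1 cos_le1.
  + apply: measurableT_comp m2; apply: continuous_measurable_fun; exact: continuous_sin.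
  + by exists 1 => x /=; rewrite ler_norml sin_geN1 sin_le1.
- by move=> x; rewrite pF.
- by move=> v; exact: expi_nm.
have hB' : {ae mu, forall x : R, forall z : int, x - B <> z%:~R}.
  have cA : countable (range (fun z : int => B + z%:~R)) 
    by apply: card_le_trans (card_image_le _ _) _; exact: countableP.
  exists (range (fun z : int => B + z%:~R)); split.
  - by apply: countable_measurable => // v; exact: measurable_set1.
  - exact: countable_lebesgue_measure0.
  - move=> x nx; apply: contrapT => nB; apply: nx => z e; apply: nB; exists z => //.
    by rewrite -e addrC subrK.
have hg2 := ae_shift alpha hg.
apply: (ae_mono _ (ae_and (ae_and hg hg2) hB')) => x [[c1 c2] xB'].
have l1 := FE _ c1; have l2 := FE _ c2.
have Tstep N : exists z : int, T N (x + alpha) - T N x =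
    - s * (frac (x - xB N) - frac x) - series (fun n => (rounded n)%:~R * sgap n) N + z%:~R.
  elim: N => [|N [z IH]].
    by exists 0; rewrite /T /xB /series /= !big_geq // !subr0 subrr mulr0 addr0.
  have [_ _ /(_ x)[z' hz'] _] := hpsi N; exists (z + z').
  have -> : T N.+1 (x + alpha) - T N.+1 x = (T N (x + alpha) - T N x) +
      (psi N (x + alpha) - psi N x) by rewrite /T !big_nat_recr //=; ring.
  rewrite IH hz' seriesSr intrD.
  have -> : x - xB N.+1 = x - xB N - (b N)%:~R * sgap N.
    by rewrite /xB seriesSr opprD addrA.
  by ring.
have [zz hzz] := choice Tstep.
have subseq_cvg (u : nat -> R) l : u @ \oo --> l -> u (Nk k) @[k --> \oo] --> l.
  move=> ul; apply: (cvg_comp _ _ _ ul).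
  by move=> A [M _ hM]; exists M => // k /= Mk; apply: hM => /=; exact: leq_trans (Nkk k).
have [z hz] : exists z : int, F (x + alpha) - F x + s * (frac (x - B) - frac x) + S = z%:~R.
  apply: (@cvg_int _ (fun k => (zz (Nk k))%:~R) (fun k => zz (Nk k))) => //.
  rewrite (_ : (fun k => _) = (fun k => T (Nk k) (x + alpha) - T (Nk k) x +
     s * (frac (x - xB (Nk k)) - frac x) +
     series (fun n => (rounded n)%:~R * sgap n) (Nk k))); last first.
    by apply/funext => k; rewrite hzz; ring.
  apply: cvgD; last exact: subseq_cvg hS.
  apply: cvgD; first exact: cvgB.
  have hx : frac (x - xB (Nk k)) @[k --> \oo] --> frac (x - B).
    have hfx : (fun N => frac (x - xB N)) @ \oo --> frac (x - B).
      by apply: frac_cvg => //; apply: cvgB => //; exact: cvg_cst.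
    exact: subseq_cvg hfx.
  apply: cvgM; first exact: cvg_cst.
  by apply: cvgB hx _; exact: cvg_cst.
rewrite expi_exprz -!expiD.
have -> : 2 * pi * F (x + alpha) = 2 * pi * (s * B - S) +
    - (2 * pi * s) * (ccount B x)%:~R + 2 * pi * F x + 2 * pi * z%:~R.
  by rewrite -hz /ccount /frac intrB; ring.
by rewrite [LHS]expiD expi_intr mulr1.
Qed.

End sufficiency.

(** * Eigenvalues of the rotation *)

Section eigenvalue.
Variable R : realType.
Notation mu := (@lebesgue_measure R).

(** Double [y] until it is at distance at least 1/4 from the integers. *)
Lemma dist_int_le_nm (y : R) : dist_int y <= nm (expi (2 * pi * y) - 1).
Proof.
have big (x : R) : 4^-1 <= x <= 2^-1 -> x <= nm (expi (2 * pi * x) - 1).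
  move=> /andP[x1 x2]; have p0 := pi_gt0 R.
  have c : cos (2 * pi * x) <= 0.
    have -> : 2 * pi * x = (2 * x - 1) * pi + pi by ring.
    rewrite cosDpi oppr_le0; apply: cos_ge0_pihalf; apply/andP; split.
      rewrite -subr_ge0 (_ : _ - _ = (2 * x - 2^-1) * pi); last by field.
      by apply: mulr_ge0 (ltW p0); lra.
    rewrite -subr_ge0 (_ : _ - _ = (3 / 2 - 2 * x) * pi); last by field.
    by apply: mulr_ge0 (ltW p0); lra.
  rewrite -ler_sqr ?nnegrE ?nm_ge0 //; last by lra.
  rewrite sqr_nm /=; have := cos2Dsin2 (2 * pi * x).
  move: (cos _) (sin _) c => u v c e; rewrite subr0.
  have -> : (u - 1) ^+ 2 + v ^+ 2 = 2 - 2 * u by move: e; rewrite !expr2; lra.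
  have : x ^+ 2 <= 1 by rewrite expr2 mulr_ile1 //; lra.
  by lra.
have dbl k (x : R) : 2^-1 <= 2 ^+ k.+1 * x -> 0 <= x <= 2^-1 -> x <= nm (expi (2 * pi * x) - 1).
  elim: k x => [|k IH] x h1 h2.
    by apply: big; rewrite expr1 in h1; case/andP: h2 => h2 h3; lra.
  case: (leP 4^-1 x) => h3; first by apply: big; case/andP: h2 => _ ->; rewrite h3.
  have h4 : 2 * x <= nm (expi (2 * pi * (2 * x)) - 1).
    apply: IH; first by rewrite mulrA -exprSr.
    by case/andP: h2 => h2 _; lra.
  have e : expi (2 * pi * (2 * x)) - 1 = (expi (2 * pi * x) + 1) * (expi (2 * pi * x) - 1) :> R[i].
    have -> : 2 * pi * (2 * x) = 2 * pi * x + 2 * pi * x by ring.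
    by rewrite expiD; ring.
  rewrite e nmM in h4.
  have h5 : nm (expi (2 * pi * x) + 1) <= 2 :> R.
    by apply: le_trans (nmD _ _) _; rewrite expi_nm nm1; lra.
  have := ler_wpM2r (nm_ge0 (expi (2 * pi * x) - 1)) h5; lra.
have half (x : R) : 0 <= x <= 2^-1 -> x <= nm (expi (2 * pi * x) - 1).
  move=> /andP[x0 x2]; have [->|xn0] := eqVneq x 0; first exact: nm_ge0.
  have xp : 0 < x by rewrite lt_neqAle eq_sym xn0.
  apply: (dbl (Num.trunc x^-1)); last by rewrite x0.
  have h : x^-1 <= 2 ^+ (Num.trunc x^-1).+1.
    apply: ltW; apply: lt_le_trans (truncnS_gt _) _.
    by rewrite -natrX ler_nat ltnW // ltn_expl.
  have := ler_wpM2r x0 h; rewrite mulVf // => h'; apply: le_trans h'.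
  by rewrite invf_le1 // ler1n.
have hd := dist_int_half y; rewrite /dist_int in hd *.
set z := y - (nearest y)%:~R in hd *.
have -> : expi (2 * pi * y) = expi (2 * pi * z) :> R[i].
  have -> : y = z + (nearest y)%:~R by rewrite subrK.
  by rewrite mulrDr expiD expi_intr mulr1.
clearbody z; case: (leP 0 z) => z0; first by rewrite ger0_norm // in hd *; apply: half; rewrite z0.
rewrite ltr0_norm // in hd *; apply: le_trans (half (- z) _) _.
  by rewrite oppr_ge0 (ltW z0).
rewrite mulrN expiN; have e0 := expi_neq0 (2 * pi * z).
have -> : (expi (2 * pi * z))^-1 - 1 = - (expi (2 * pi * z))^-1 * (expi (2 * pi * z) - 1) :> R[i].
  by rewrite mulNr mulrBr mulVf // mulr1 opprB.
by rewrite nmM nmN -expiN expi_nm mul1r.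
Qed.

Variable alpha : R.
Hypothesis Ha : irrational01 alpha.
Notation Q := (cfQ alpha).
Notation P := (cfP alpha).
Notation d := (cfd alpha).

(** The nearest integers to [q_n tau] eventually satisfy the recursion of the
    q_n, hence are combinations of p_n and q_n. *)
Lemma near_multiple (tau C : R) : (forall n, dist_int ((Q n)%:~R * tau) <= C * d n) ->
  exists u v : int, tau = u%:~R + v%:~R * alpha.
Proof.
move=> hC; pose r n := nearest ((Q n)%:~R * tau).
pose th n := (Q n)%:~R * tau - (r n)%:~R.
have thC n : `|th n| <= C * d n by exact: hC.
have C0 : 0 <= C.
  by have := le_trans (normr_ge0 _) (thC 0%N); rewrite pmulr_lge0 // (cfd_gt0 Ha).
have [N hN] : exists N : nat, forall n, (N <= n)%N -> C * d n < 4^-1.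
  exists (Num.trunc (4 * C)).+2 => -[//|n] hn.
  apply: le_lt_trans (ler_wpM2l C0 (cfd_le_inv Ha n)) _.
  rewrite ltr_pdivrMr ?ltr0n // ltr_pdivlMl //.
  by apply: lt_trans (truncnS_gt _) _; rewrite ltr_nat.
have rec n : (N <= n)%N -> r n.+2 = pq alpha n * r n.+1 + r n.
  move=> Nn; have h0 := thC n; have h1 := thC n.+1; have h2 := thC n.+2.
  have a1 : 1 <= (pq alpha n)%:~R :> R by exact: pqr_ge1.
  have h1' : `|(pq alpha n)%:~R * th n.+1| <= C * d n.
    rewrite normrM (ger0_norm (le_trans ler01 a1)).
    apply: le_trans (ler_wpM2l (le_trans ler01 a1) h1) _.
    rewrite mulrCA; apply: ler_wpM2l => //; rewrite (cfd_rec Ha n) lerDl.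
    exact: ltW (cfd_gt0 Ha _).
  have s0 := hN n Nn; have s2 := hN n.+2 (leqW (leqW Nn)).
  have : `|(r n.+2 - (pq alpha n * r n.+1 + r n))%:~R| < 1 :> R.
    have -> : (r n.+2 - (pq alpha n * r n.+1 + r n))%:~R =
        (pq alpha n)%:~R * th n.+1 + th n - th n.+2.
      by rewrite /th cfQSS !intrB !intrD !intrM; ring.
    apply: le_lt_trans (ler_normB _ _) _.
    apply: le_lt_trans (lerD (ler_normD _ _) (lexx _)) _.
    by move: `|_ * th _| `|th n| `|th n.+2| (C * d n) (C * d n.+2) h0 h1' h2 s0 s2 {h1 a1} => *; lra.
  rewrite -intr_norm -[1]/(1%:~R) ltr_int => h; apply/eqP; rewrite -subr_eq0.
  by move: h; move: (_ - _) => k; clear; lia.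
pose e : int := (-1) ^+ N.
have ee : e * e = 1 by rewrite /e -exprMn mulN1r opprK expr1n.
have det := cfdet alpha N; rewrite -/e in det.
pose u := e * (r N.+1 * P N - r N * P N.+1).
pose v := e * (Q N.+1 * r N - Q N * r N.+1).
have b1 : r N = u * Q N + v * P N.
  have -> : u * Q N + v * P N = e * (Q N.+1 * P N - Q N * P N.+1) * r N.
    by rewrite /u /v; ring.
  by rewrite det ee mul1r.
have b2 : r N.+1 = u * Q N.+1 + v * P N.+1.
  have -> : u * Q N.+1 + v * P N.+1 = e * (Q N.+1 * P N - Q N * P N.+1) * r N.+1.
    by rewrite /u /v; ring.
  by rewrite det ee mul1r.
clearbody u v.
have rE k : r (N + k)%N = u * Q (N + k)%N + v * P (N + k)%N.
  suff: r (N + k)%N = u * Q (N + k)%N + v * P (N + k)%N /\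
    r (N + k).+1 = u * Q (N + k).+1 + v * P (N + k).+1 by case.
  elim: k => [|k [IH1 IH2]]; first by rewrite addn0.
  rewrite addnS; split=> //.
  by rewrite rec ?leq_addr // IH1 IH2 cfQSS cfPSS mulrDr mulrDr; ring.
exists u, v; apply/eqP; rewrite -subr_eq0 -normr_le0; set x := tau - _.
have bound k : `|x| <= (C + `|v%:~R|) * d (N + k).+1.
  have Qn : 1 <= (Q (N + k).+1)%:~R :> R by rewrite ler1z; exact: cfQS_ge1.
  apply: (@le_trans _ _ (`|(Q (N + k).+1)%:~R * x|)).
    by rewrite normrM ler_peMl // (le_trans Qn) // ler_norm.
  have -> : (Q (N + k).+1)%:~R * x = th (N + k).+1 -
     v%:~R * ((Q (N + k).+1)%:~R * alpha - (P (N + k).+1)%:~R).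
    by rewrite /th -addnS rE addnS intrD !intrM /x; ring.
  apply: le_trans (ler_normB _ _) _; rewrite mulrDl; apply: lerD => //.
  by rewrite normrM cfD // normrM normrX normrN1 expr1n mul1r (gtr0_norm (cfd_gt0 Ha _)).
apply/ler_addgt0Pr => eps e0; rewrite add0r.
have V0 : 0 <= C + `|v%:~R| by rewrite addr_ge0.
pose k := Num.trunc ((C + `|v%:~R|) / eps).
apply: le_trans (bound k) _; apply: le_trans (ler_wpM2l V0 (cfd_le_inv Ha _)) _.
rewrite ler_pdivrMr ?ltr0n // mulrC -ler_pdivrMr //.
apply: ltW; apply: lt_le_trans (truncnS_gt _) _.
by rewrite ler_nat ltnS leq_addl.
Qed.

(** The window integrals satisfy the same relation at every point and are Lipschitz;
    as one of them is nonzero, exp(2 i pi m tau) is close to 1 when m alpha is close to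
    an integer. *)
Lemma eigenvalue (h : R -> R[i]) (tau : R) : cbm h -> periodic1 h ->
  (forall v, nm (h v) = 1) ->
  {ae mu, forall x, h (x + alpha) = expi (2 * pi * tau) * h x} ->
  exists u v : int, tau = u%:~R + v%:~R * alpha.
Proof.
move=> bh ph h1 Hh.
have h2 : 0 < 2^-1 :> R by rewrite invr_gt0.
have [l0 l00 hl0] := deficit_small bh h1 h2.
have /hl0 hd : 0 < l0 <= l0 by rewrite l00 lexx.
have l0n := ltW l00.
have [x0 hx0] : exists x0, nm (cwin h l0 x0) != 0.
  apply: contrapT => /forallNP H; move: hd; apply/negP; rewrite -ltNge.
  rewrite (_ : deficit h l0 = fun=> 1); first by rewrite pint_cst; lra.
  apply/funext => x; have /negP := H x; rewrite negbK => /eqP e.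
  by rewrite /deficit e expr0n mul0r subr0.
set c := nm (cwin h l0 x0) in hx0.
have c0 : 0 < c by rewrite lt_neqAle eq_sym hx0 nm_ge0.
have step x : cwin h l0 (x + alpha) = expi (2 * pi * tau) * cwin h l0 x.
  have -> : cwin h l0 (x + alpha) = cint (fun v => h (v + alpha)) x (x + l0).
    by rewrite cint_shift // /cwin addrAC.
  rewrite -cintZ //; apply: cint_ae; first exact: cbm_shift.
    by apply: cbmM => //; exact: cbm_cst.
  by apply: ae_mono Hh => v hv _.
have steps (n : nat) x : cwin h l0 (x + n%:R * alpha) =
    expi (2 * pi * (n%:R * tau)) * cwin h l0 x.
  elim: n => [|n IH]; first by rewrite !mul0r addr0 mulr0 expi0 mul1r.
  rewrite -(natr1 n) !mulrDl !mul1r addrA step IH mulrA -expiD; congr (expi _ * _); ring.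
apply: (@near_multiple tau (2 / c)) => n.
have qE : (Q n)%:~R = (absz (Q n))%:R :> R by rewrite pmulrn gez0_abs // cfQ_ge0.
apply: le_trans (dist_int_le_nm _) _.
rewrite [leRHS]mulrAC ler_pdivlMr // -nmM mulrBl mul1r qE -steps -qE.
have -> : cwin h l0 (x0 + (Q n)%:~R * alpha) =
    cwin h l0 (x0 + ((Q n)%:~R * alpha - (P n)%:~R)).
  rewrite -[RHS](periodic1_int (P n) _ (periodic1_cwin l0 bh ph)).
  by congr (cwin _ _ _); ring.
have hle v : nm (h v) <= 1 by rewrite h1.
apply: le_trans (cwin_lip _ _ bh l0n hle) _.
by rewrite addrAC subrr add0r cfD // normrM normrX normrN1 expr1n mul1r
  (gtr0_norm (cfd_gt0 Ha _)).
Qed.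

End eigenvalue.

(** * The equation on the real line *)

Section real_line.
Variables (R : realType) (alpha s : R).
Hypotheses (Ha : irrational01 alpha) (sN : s \isn't a Num.int).
Notation mu := (@lebesgue_measure R).

(** The lifted equation: the value of phi_beta at [x] modulo 1 is
    [ccount beta x - beta]. *)
Definition solvable (beta t : R) := exists f : R -> R[i],
  [/\ cbm f, periodic1 f, forall v, nm (f v) = 1 &
    {ae mu, forall x, f (x + alpha) = expi (2 * pi * (t + s * beta)) *
      expi (- (2 * pi * s)) ^ ccount beta x * f x}].

Definition admissible (b : nat -> int) :=
  bsum (fun n => `|(b n)%:~R| / (partial_quotient alpha n.+1)%:~R : R) /\
  bsum (fun n => dist_int ((b n)%:~R * s) ^+ 2).

Lemma admissibleE b : admissible b ->
  bsum (fun n => (absz (b n))%:R / (pqn alpha n)%:R : R).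
Proof.
by move=> [h _]; apply: bsum_le h => n; rewrite pqnrE // -intr_norm -abszE.
Qed.

(** Only the class of [beta] modulo 1 matters. *)
Lemma expi_rotation beta t (z : int) x :
  expi (2 * pi * (t + s * (beta + z%:~R))) *
    expi (- (2 * pi * s)) ^ ccount (beta + z%:~R) x =
  expi (2 * pi * (t + s * beta)) * expi (- (2 * pi * s)) ^ ccount beta x :> R[i].
Proof.
rewrite !expi_exprz -!expiD; congr expi.
have -> : ccount (beta + z%:~R) x = ccount beta x + z.
  rewrite /ccount (_ : x - (beta + z%:~R) = x - beta + (- z)%:~R).
    by rewrite floor_addz; ring.
  by rewrite mulrNz; ring.
by rewrite intrD; ring.
Qed.

Lemma expi_eq1 (x : R) : expi (2 * pi * x) = 1 -> x \is a Num.int.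
Proof.
move=> e; have := dist_int_le_nm x; rewrite e subrr nm0 normr_le0 subr_eq0 => /eqP ->.
exact: intr_int.
Qed.

Lemma cbm_inv (f : R -> R[i]) : cbm f -> (forall v, nm (f v) = 1) ->
  cbm (fun v => (f v)^-1).
Proof.
move=> [bR bI] f1.
have E v : (f v)^-1 = (complex.Re (f v) -i* complex.Im (f v))%C.
  apply: (mulfI (x := f v)).
    by apply/eqP => f0; have := f1 v; rewrite f0 nm0 => /esym/eqP; rewrite oner_eq0.
  rewrite divff; last first.
    by apply/eqP => f0; have := f1 v; rewrite f0 nm0 => /esym/eqP; rewrite oner_eq0.
  have := sqr_nm (f v); rewrite f1 expr1n; case: (f v) => a c /= e.
  by apply/eqP; rewrite eq_complex /=; apply/andP; split; apply/eqP; rewrite ?e; ring.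
split.
  by rewrite (_ : _ \o _ = complex.Re (R:=R) \o f) //; apply/funext => v /=; rewrite E.
rewrite (_ : _ \o _ = fun v => - (complex.Im (R:=R) \o f) v); first exact: bmeasN.
by apply/funext => v /=; rewrite E.
Qed.

Lemma cbm_expi (k : int) : cbm (fun x : R => expi (2 * pi * (k%:~R * x))).
Proof.
have m : measurable_fun [set: R] (fun x : R => 2 * pi * (k%:~R * x)).
  by apply: measurable_funM => //; exact: measurable_funM.
split; split.
- by apply: measurableT_comp m; apply: continuous_measurable_fun; exact: continuous_cos.
- by exists 1 => x /=; rewrite ler_norml cos_geN1 cos_le1.
- by apply: measurableT_comp m; apply: continuous_measurable_fun; exact: continuous_sin.
- by exists 1 => x /=; rewrite ler_norml sin_geN1 sin_le1.
Qed.

Lemma sum_mod1 (c : nat -> int) N : exists z : int,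
  (\sum_(0 <= n < N) c n * cf_den alpha n)%:~R * alpha =
  series (fun n => (c n)%:~R * sgap alpha n) N + z%:~R.
Proof.
exists (\sum_(0 <= n < N) c n * cfP alpha n.+1).
rewrite /series /= !rmorph_sum /= mulr_suml -big_split; apply: eq_bigr => n _ /=.
by rewrite sgapE // cf_den_cfQ -cfqE // !intrM -!pmulrn; ring.
Qed.

(** The digits fix t up to an eigenvalue of the rotation: divide the solution by the
    one constructed from its digits. *)
Theorem solvable_digits beta t : solvable beta t -> exists (b : nat -> int) (k z w : int),
  [/\ admissible b, beta = limn (series (fun n => (b n)%:~R * sgap alpha n)) + z%:~R &
    t = k%:~R * alpha - limn (series (fun n => (rounded s b n)%:~R * sgap alpha n)) + w%:~R].
Proof.
move=> [f [bf pf f1 Hf]].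
have o1 : nm (expi (2 * pi * (t + s * beta))) = 1 by exact: expi_nm.
have c1 : nm (expi (- (2 * pi * s))) = 1 by exact: expi_nm.
have cN : expi (- (2 * pi * s)) != 1.
  apply: contra sN => /eqP; rewrite expiN => e; apply: expi_eq1.
  by rewrite -[LHS]invrK e invr1.
have [b [z [hz hb hs]]] := expansion Ha o1 c1 cN bf pf f1 Hf.
have hs' : bsum (fun n => dist_int ((b n)%:~R * s) ^+ 2).
  apply: bsum_le hs => n; rewrite ler_sqr ?nnegrE ?nm_ge0 //; last exact: normr_ge0.
  apply: le_trans (dist_int_le_nm _) _.
  have e : expi (2 * pi * ((b n)%:~R * s)) = expi (- (2 * pi * s)) ^ (- b n) :> R[i].
    by rewrite expi_exprz mulrNz; congr expi; ring.
  rewrite e; case: (b n) => m; last by rewrite NegzE opprK.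
  rewrite absz_nat -exprnN; set u := expi _ ^+ m.
  have u1 : nm u = 1 by rewrite /u nmX c1 expr1n.
  have u0 : u != 0 by apply/eqP => h; move: u1; rewrite h nm0 => /esym/eqP; rewrite oner_eq0.
  have -> : u^-1 - 1 = - u^-1 * (u - 1) by rewrite mulNr mulrBr mulVf // mulr1 opprB.
  by rewrite nmM nmN (nmV u1) mul1r.
have had : admissible b.
  by split=> //; apply: bsum_le hb => n; rewrite pqnrE // -intr_norm -abszE.
have hB := digit_series_cvg Ha hb; have hS := rounded_series_cvg (s := s) Ha hb.
set B := limn _ in hB; set S := limn _ in hS.
have [zB eB] : exists zB : int, beta - B = zB%:~R.
  have [w hw] := choice (sum_mod1 b).
  apply: (@cvg_int _ (fun N => (w N + z N)%:~R) (fun N => w N + z N)) => //.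
  have cv : (fun N => beta - (\sum_(0 <= n < N) b n * cf_den alpha n)%:~R * alpha - (z N)%:~R)
      @ \oo --> (0 : R).
    apply/cvgrPdist_lt => e /hz[N0 hN0]; exists N0 => // N /= hN.
    by rewrite sub0r normrN; exact: hN0.
  rewrite (_ : (fun N => _) = (fun N => beta - series (fun n => (b n)%:~R * sgap alpha n) N -
    (beta - (\sum_(0 <= n < N) b n * cf_den alpha n)%:~R * alpha - (z N)%:~R))); last first.
    by apply/funext => N; rewrite hw intrD; ring.
  rewrite -[X in _ --> X]subr0; apply: cvgB cv; apply: cvgB hB; exact: cvg_cst.
have betaE : beta = B + zB%:~R by rewrite -eB addrC subrK.
have [g [bg pg g1 Hg]] := coboundary_exists Ha hb hs' hB hS.
have g0 x : g x != 0.
  by apply/eqP => h; have := g1 x; rewrite h nm0 => /esym/eqP; rewrite oner_eq0.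
have [u [v tv]] : exists u v : int, t + S = u%:~R + v%:~R * alpha.
  apply: (@eigenvalue _ _ Ha (fun x => f x * (g x)^-1)).
  - by apply: cbmM => //; exact: cbm_inv.
  - by move=> x; rewrite pf pg.
  - by move=> x; rewrite nmM (nmV (g1 x)) f1 mulr1.
  apply: (ae_mono _ (ae_and Hf Hg)) => x [-> ->].
  rewrite betaE expi_rotation.
  have cz : expi (- (2 * pi * s)) ^ ccount B x != 0 by rewrite expfz_neq0 // expi_neq0.
  have -> : expi (2 * pi * (t + s * B)) =
     expi (2 * pi * (t + S)) * expi (2 * pi * (s * B - S)) :> R[i].
    by rewrite -expiD; congr expi; ring.
  have e0 := expi_neq0 (2 * pi * (s * B - S)).
  by field; rewrite e0 cz g0.
exists b, v, zB, u; split=> //.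
have -> : t = u%:~R + v%:~R * alpha - S by rewrite -tv addrK.
by rewrite -addrA addrC.
Qed.

(** Multiplying a solution by exp(2 i pi k x) adds k alpha to t. *)
Theorem digits_solvable beta t (b : nat -> int) (k z w : int) : admissible b ->
  beta = limn (series (fun n => (b n)%:~R * sgap alpha n)) + z%:~R ->
  t = k%:~R * alpha - limn (series (fun n => (rounded s b n)%:~R * sgap alpha n)) + w%:~R ->
  solvable beta t.
Proof.
move=> had; have hb := admissibleE had.
have hB := digit_series_cvg Ha hb; have hS := rounded_series_cvg (s := s) Ha hb.
set B := limn _ in hB *; set S := limn _ in hS * => -> ->.
have [g [bg pg g1 Hg]] := coboundary_exists Ha hb had.2 hB hS.
exists (fun x => expi (2 * pi * (k%:~R * x)) * g x); split.
- by apply: cbmM bg; exact: cbm_expi.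
- move=> x; rewrite pg.
  have -> : 2 * pi * (k%:~R * (x + 1)) = 2 * pi * (k%:~R * x) + 2 * pi * k%:~R by ring.
  by rewrite expiD expi_intr mulr1.
- by move=> x; rewrite nmM expi_nm g1 mulr1.
apply: ae_mono Hg => x ->; rewrite expi_rotation.
have -> : expi (2 * pi * (k%:~R * (x + alpha))) = expi (2 * pi * (k%:~R * x)) *
    expi (2 * pi * (k%:~R * alpha)) :> R[i] by rewrite -expiD; congr expi; ring.
have -> : expi (2 * pi * (k%:~R * alpha - S + w%:~R + s * B)) =
    expi (2 * pi * (k%:~R * alpha)) * expi (2 * pi * (s * B - S)) :> R[i].
  rewrite -expiD -[RHS]mulr1 -(expi_intr R w) -expiD; congr expi; ring.
by ring.
Qed.

End real_line.

(** * From the circle to the real line *)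

Section circle.
Variable R : realType.
Implicit Types (x y : R) (u v : torus R).
Notation mu := (@lebesgue_measure R).

Lemma mod1D x y : mod1 (x + y) = mod1 x + mod1 y.
Proof. exact: (Quotient.pi_add (integers R) x y). Qed.

Lemma mod1N x : mod1 (- x) = - mod1 x.
Proof. exact: (Quotient.pi_opp (integers R) x). Qed.

Lemma mod1_eq x y : (mod1 x = mod1 y) <-> (exists z : int, x = y + z%:~R).
Proof.
have e : (x - y \in integers R) <-> mod1 x = mod1 y.
  rewrite (Quotient.idealrBE (integers R) x y).
  by split=> [/eqP h|h]; [exact: h|apply/eqP; exact: h].
split=> [/e/intrP[z hz]|[z xz]]; first by exists z; rewrite -hz addrC subrK.
by apply/e; rewrite xz addrAC subrr add0r; exact: intr_int.
Qed.

Lemma mod1_int (z : int) : mod1 (z%:~R : R) = 0.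
Proof. by apply: (addrI (mod1 0)); rewrite -mod1D addr0; apply/mod1_eq; exists z. Qed.

Lemma mod1_repr u : mod1 (repr u) = u.
Proof. exact: reprK. Qed.

Lemma frac_partE u : frac_part u = frac (repr u).
Proof. by []. Qed.

Lemma frac_part_mod1 x : frac_part (mod1 x) = frac x.
Proof.
have /mod1_eq[z e] := mod1_repr (mod1 x).
by rewrite frac_partE e frac_int.
Qed.

Lemma mod1_frac x : mod1 (frac x) = mod1 x.
Proof. by apply/mod1_eq; exists (- Num.floor x); rewrite mulrNz. Qed.

Lemma mod1_frac_part u : mod1 (frac_part u) = u.
Proof. by rewrite frac_partE mod1_frac mod1_repr. Qed.

Lemma frac_part_itv u : 0 <= frac_part u < 1.
Proof. exact: frac_itv. Qed.

Lemma phi_mod1 u x : phi u (mod1 x) = (ccount (frac_part u) x)%:~R - frac_part u.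
Proof.
rewrite /phi frac_part_mod1; congr (_ - _); have /andP[b0 b1] := frac_part_itv u.
set b := frac_part u in b0 b1 *; rewrite indicE /ccount.
have /andP[f0 f1] := frac_itv x.
have E : Num.floor (x - b) = if frac x < b then Num.floor x - 1 else Num.floor x.
  by case: ltP => h; apply: floor_def; rewrite ?intrB !intrD; move: h f0 f1; rewrite /frac => *; lra.
rewrite E; case: ltP => h.
  by rewrite mem_set ?subKr //= in_itv /= f0 h.
by rewrite memNset ?subrr //= in_itv /= f0 /= ltNge h.
Qed.

(** A null set of the line need not be periodic: its trace on [0, 1[ is transported
    to the circle. *)
Lemma ae_torus (P : torus R -> Prop) :
  {ae @torus_lebesgue R, forall u, P u} <-> {ae mu, forall x, P (mod1 x)}.
Proof.
have mfrac : measurable_fun [set: R] (@frac R) := (bmeas_frac R).1.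
split=> [[N [mN N0 sN]]|[N [mN N0 sN]]].
  apply: ae_periodic => [x|x|].
  - by rewrite (_ : mod1 (x + 1) = mod1 x) //; apply/mod1_eq; exists 1.
  - by rewrite (_ : mod1 (x + 1) = mod1 x) //; apply/mod1_eq; exists 1.
  pose A := (@mod1 R @^-1` N) `&` `[0, 1[%classic.
  have mA : measurable A.
    apply: measurableI; last exact: measurable_itv.
    by rewrite -[_ @^-1` _]setTI; exact: measurable_mod1.
  have A0 : mu A = 0%E by exact: N0.
  exists (A `|` [set 1]); split.
  - by apply: measurableU => //; exact: measurable_set1.
  - have s0 : mu [set 1] = 0%E by exact: lebesgue_measure_set1.
    have mA' : measurable (A : set (measurableTypeR R)) by exact: mA.
    by rewrite (measureU0 mA' (measurable_set1 1) s0).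
  move=> x nx; apply: contrapT => /not_orP[nA n1]; apply: nx => /= /andP[x0 x1].
  apply: contrapT => nP; apply: nA; split; first exact: sN.
  by rewrite /= in_itv /= x0 lt_neqAle x1 andbT; apply/eqP.
pose A := N `&` `[0, 1[%classic.
have mA : measurable A by apply: measurableI => //; exact: measurable_itv.
have A0 : mu A = 0%E.
  apply/eqP; rewrite eq_le measure_ge0 andbT -N0.
  by apply: le_measure; rewrite ?inE //; exact: subIsetl.
pose B := [set u : torus R | A (frac_part u)].
have eB : @mod1 R @^-1` B = @frac R @^-1` A.
  by apply/seteqP; split=> x; rewrite /B /= frac_part_mod1.
have mB : measurable (@mod1 R @^-1` B).
  by rewrite eB -[_ @^-1` _]setTI; exact: mfrac.
exists B; split.
- by rewrite /measurable /= /torus_measurable /image_set_system /= setTI.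
- change (mu (@mod1 R @^-1` B `&` `[0, 1[%classic) = 0%E).
  have mB' : measurable ((@mod1 R @^-1` B `&` `[0, 1[%classic) : set (measurableTypeR R)).
    by apply: measurableI => //; exact: measurable_itv.
  apply: (subset_measure0 mB' mA _ A0); rewrite eB => x [/= h].
  by rewrite in_itv /= => /frac_id e; rewrite e in h.
move=> u nu; rewrite /B /A /=; split; last by rewrite /= in_itv; exact: frac_part_itv.
by apply: sN => /=; rewrite mod1_frac_part.
Qed.

End circle.

Section circle_equation.
Variable R : realType.
Notation mu := (@lebesgue_measure R).

Lemma solvable_torus (alpha s : R) (beta t : torus R) :
  (exists f : torus R -> R[i],
     [/\ cmeasurable f,
         forall x, `|f x| = 1
       & {ae @torus_lebesgue R, forall x,
           expi (2 * pi * s * phi beta x)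
           = expi (2 * pi * frac_part t) * (f x / f (x + mod1 alpha))}])
  <-> solvable alpha s (frac_part beta) (frac_part t).
Proof.
set b := frac_part beta; set t' := frac_part t.
have eqv (F : R -> R[i]) x : F x != 0 -> F (x + alpha) != 0 ->
   (expi (2 * pi * s * phi beta (mod1 x)) =
     expi (2 * pi * t') * (F x / F (x + alpha))) <->
   F (x + alpha) = expi (2 * pi * (t' + s * b)) *
      expi (- (2 * pi * s)) ^ ccount b x * F x.
  move=> F0 F1; rewrite phi_mod1 -/b expi_exprz -expiD.
  have -> : expi (2 * pi * s * ((ccount b x)%:~R - b)) =
      expi (2 * pi * t') * (expi (2 * pi * (t' + s * b) +
        - (2 * pi * s) * (ccount b x)%:~R))^-1 :> R[i].
    by rewrite -expiN -expiD; congr expi; ring.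
  set w := expi (_ + _); have w0 : w != 0 by exact: expi_neq0.
  have e0 := expi_neq0 (2 * pi * t'); split=> [/(mulfI e0) h|->].
    by apply: (mulfI (x := w^-1 * (F (x + alpha))^-1));
      rewrite ?mulf_neq0 ?invr_eq0 // {1}h; field; rewrite F1 w0.
  by congr (_ * _); field; rewrite F0 w0.
have n0 (z : R[i]) : nm z = 1 -> z != 0.
  by move=> z1; apply/eqP => h; move: z1; rewrite h nm0 => /esym/eqP; rewrite oner_eq0.
split=> [[f [[mR mI] f1 Hf]]|[f [bf pf f1 Hf]]].
  pose F x := f (mod1 x).
  have F1 x : nm (F x) = 1 by apply/nm1_normr; exact: f1.
  have ReIm v : `|complex.Re (F v)| <= 1 /\ `|complex.Im (F v)| <= 1.
    have := sqr_nm (F v); rewrite F1 expr1n.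
    move: (complex.Re _) (complex.Im _) => p q e.
    by split; rewrite -(ler_sqr (normr_ge0 _)) ?nnegrE // real_normK ?num_real // expr1n e
       ?lerDl ?lerDr sqr_ge0.
  exists F; split=> //.
  - split; split; [|by exists 1 => v; have [] := ReIm v| |by exists 1 => v; have [] := ReIm v].
      exact: (measurableT_comp mR (@measurable_mod1 R)).
    exact: (measurableT_comp mI (@measurable_mod1 R)).
  - move=> x; rewrite /F mod1D (_ : mod1 1 = 0) ?addr0 //.
    exact: (mod1_int R 1).
  apply: ae_mono ((ae_torus _).1 Hf) => x h; apply/eqv; [exact: n0|exact: n0|].
  by rewrite h /F mod1D.
have fE x : f (frac x) = f x.
  by rewrite -[in RHS](subrK (Num.floor x)%:~R x) periodic1_int.
exists (fun u => f (frac_part u)); split.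
- split=> _ Y mY; rewrite setTI /measurable /= /torus_measurable /image_set_system /= setTI.
    rewrite (_ : _ @^-1` _ = (complex.Re (R:=R) \o f) @^-1` Y).
      by rewrite -[_ @^-1` _]setTI; exact: bf.1.1.
    by apply/seteqP; split=> x /=; rewrite frac_part_mod1 fE.
  rewrite (_ : _ @^-1` _ = (complex.Im (R:=R) \o f) @^-1` Y).
    by rewrite -[_ @^-1` _]setTI; exact: bf.2.1.
  by apply/seteqP; split=> x /=; rewrite frac_part_mod1 fE.
- by move=> u; apply/nm1_normr.
apply/ae_torus; apply: ae_mono Hf => x h.
rewrite -mod1D !frac_part_mod1 !fE.
by apply/eqv; [exact: n0|exact: n0|].
Qed.

End circle_equation.

Section circle_limits.
Variable R : realType.

Lemma cvg_mod1 (x : nat -> R) (l : R) : x @ \oo --> l ->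
  (fun n => mod1 (x n)) @ \oo --> mod1 l.
Proof.
move=> xl; have c : continuous (@mod1 R).
  exact: (@pi_continuous R (Quotient.quot (integers R))).
by apply: continuous_cvg => //; exact: c.
Qed.

(** The union of the balls around the representatives of [u] projects onto an open
    set, so [l] is at distance 0 from the class of [u]. *)
Lemma cvg_mod1_unique (x : nat -> R) (l : R) (u : torus R) : x @ \oo --> l ->
  (fun n => mod1 (x n)) @ \oo --> u -> u = mod1 l.
Proof.
move=> xl xu; pose y := frac_part u.
have yu : mod1 y = u by exact: mod1_frac_part.
have close (e : R) : 0 < e -> exists z : int, `|l + z%:~R - y| < e.
  move=> e0; have e2 : 0 < e / 2 by rewrite divr_gt0.
  pose V : set R := \bigcup_(z : int) ball (y - z%:~R) (e / 2).
  have oV : open V by apply: bigcup_open => z _; exact: ball_open.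
  pose U : set (torus R) := [set v | exists2 a, mod1 a = v & `|a - y| < e / 2].
  have UV : @mod1 R @^-1` U = V.
    apply/seteqP; split=> a.
      move=> [a' /mod1_eq[z ->] h]; exists z => //.
      by rewrite -ball_normE /= distrC opprB addrA.
    move=> [z _]; rewrite -ball_normE /= => h; exists (a + z%:~R).
      by rewrite mod1D mod1_int addr0.
    by move: h; rewrite distrC opprB addrA.
  have oU : open U.
    by change (open (@mod1 R @^-1` U)); rewrite UV.
  have nU : nbhs u U.
    by apply: open_nbhs_nbhs; split=> //; exists y => //; rewrite subrr normr0.
  have h1 := xu _ nU; move/cvgrPdist_lt: xl => /(_ _ e2) h2.
  have [n [[a ea ha] hn]] : exists n, U (mod1 (x n)) /\ `|l - x n| < e / 2.
    case: h1 => N1 _ hN1; case: h2 => N2 _ hN2; exists (maxn N1 N2); split.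
      by apply: hN1 => /=; exact: leq_maxl.
    by apply: hN2 => /=; exact: leq_maxr.
  have /mod1_eq[z ez] := ea; exists z.
  have -> : l + z%:~R - y = (l - x n) + (a - y) by rewrite ez; ring.
  by apply: le_lt_trans (ler_normD _ _) _; rewrite [e]splitr ltrD.
have q0 : 0 < 4^-1 :> R by rewrite invr_gt0.
have [z hz] := close _ q0; rewrite -yu; apply/mod1_eq; exists z.
apply/eqP; rewrite eq_sym -subr_eq0 -normr_le0; apply/ler_addgt0Pr => e e0; rewrite add0r.
have m0 : 0 < Num.min e 4^-1 by rewrite lt_min e0.
have [z' hz'] := close _ m0; move: hz'; rewrite lt_min => /andP[h1 h2].
suff -> : z = z' by exact: ltW.
have h : `|(z - z')%:~R| < 1 :> R.
  by move: hz h2; rewrite intrB !ltr_norml; move: (z%:~R) (z'%:~R) => a b; lra.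
by move: h; rewrite -intr_norm -[1]/(1%:~R) ltr_int; clear; lia.
Qed.

Lemma series_mod1 (alpha : R) (c : nat -> int) : irrational01 alpha ->
  series (fun n => mod1 ((c n * cf_den alpha n)%:~R * alpha)) =
  (fun N => mod1 (series (fun n => (c n)%:~R * sgap alpha n) N)).
Proof.
move=> Ha; apply/funext => N.
have [z hz] := sum_mod1 Ha c N.
transitivity (mod1 ((\sum_(0 <= n < N) c n * cf_den alpha n)%:~R * alpha)).
  rewrite rmorph_sum mulr_suml /series /=.
  elim: N {z hz} => [|N IH]; first by rewrite !big_geq //; exact/esym/(mod1_int R 0).
  by rewrite !big_nat_recr //= IH -mod1D.
by rewrite hz mod1D mod1_int addr0.
Qed.

End circle_limits.

(** * The criterion *)

Theorem mainTheorem1 (R : realType) (alpha s : R) (beta t : torus R)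
    (alpha_gt0 : 0 < alpha) (alpha_lt1 : alpha < 1)
    (alpha_irr : irrational alpha) (s_nint : s \isn't a Num.int) :
  (exists f : torus R -> R[i],
     [/\ cmeasurable f,
         forall x, `|f x| = 1
       & {ae @torus_lebesgue R, forall x,
           expi (2 * pi * s * phi beta x)
           = expi (2 * pi * frac_part t) * (f x / f (x + mod1 alpha))}])
  <->
  (exists (b : nat -> int) (k' : int),
     [/\ series (fun n => mod1 ((b n * cf_den alpha n)%:~R * alpha)) @ \oo
           --> beta,
         exists2 S : torus R,
           series (fun n =>
             mod1 ((nearest ((b n)%:~R * s) * cf_den alpha n)%:~R * alpha))
             @ \oo --> S
         & t = mod1 (k'%:~R * alpha) - S,
         (\sum_(0 <= n <oo)
            (`|(b n)%:~R| / (partial_quotient alpha n.+1)%:~R : R)%:E < +oo)%E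
       & (\sum_(0 <= n <oo) (dist_int ((b n)%:~R * s) ^+ 2)%:E < +oo)%E]).
Proof.
have Ha : irrational01 alpha by split.
apply: (iff_trans (solvable_torus alpha s beta t)).
split=> [hsol|[b [k [hbeta [S hS tE] h1 h2]]]].
  have [b [k [z [w [[h1 h2] betaE tE]]]]] := solvable_digits Ha s_nint hsol.
  have hb : bsum (fun n => (absz (b n))%:R / (pqn alpha n)%:R : R).
    exact: (admissibleE Ha (conj h1 h2)).
  have hB := digit_series_cvg Ha hb; have hS := rounded_series_cvg (s := s) Ha hb.
  exists b, k; split.
  - rewrite (series_mod1 b Ha) -[X in _ --> X]mod1_frac_part betaE mod1D mod1_int addr0.
    exact: cvg_mod1 hB.
  - exists (mod1 (limn (series (fun n => (rounded s b n)%:~R * sgap alpha n)))).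
      by rewrite (series_mod1 (rounded s b) Ha); exact: cvg_mod1 hS.
    by rewrite -[LHS]mod1_frac_part tE mod1D mod1_int addr0 mod1D mod1N.
  - by apply: (proj2 (bsum_lty _)) => // n; rewrite divr_ge0 // ler0z (le_trans _ (pq_ge1 Ha n)).
  - by apply: (proj2 (bsum_lty _)) => // n; exact: sqr_ge0.
have had : admissible alpha s b.
  split; first by apply: (proj1 (bsum_lty _)) h1 => n; rewrite divr_ge0 // ler0z (le_trans _ (pq_ge1 Ha n)).
  by apply: (proj1 (bsum_lty _)) h2 => n; exact: sqr_ge0.
have hb := admissibleE Ha had.
have cB := digit_series_cvg Ha hb; have cS := rounded_series_cvg (s := s) Ha hb.
rewrite (series_mod1 b Ha) in hbeta; rewrite (series_mod1 (rounded s b) Ha) in hS.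
have eB := cvg_mod1_unique cB hbeta; have eS := cvg_mod1_unique cS hS.
rewrite eS -mod1N -mod1D in tE.
have [z hz] : exists z : int, frac_part beta =
    limn (series (fun n => (b n)%:~R * sgap alpha n)) + z%:~R.
  by apply/mod1_eq; rewrite mod1_frac_part.
have [w hw] : exists w : int, frac_part t = k%:~R * alpha -
    limn (series (fun n => (rounded s b n)%:~R * sgap alpha n)) + w%:~R.
  by apply/mod1_eq; rewrite mod1_frac_part.
by have := digits_solvable Ha had hz hw.
Qed.
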